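(* Let $n\ge 2$, $0\le \alpha<1$, $\mu\ge 0$ and let $p$ satisfy $$1<p\le p_G'(n,\alpha,\mu):= 1+\frac{2}{(1-\alpha)(n-1)+\mu+\alpha}\quad\text{or}\quad 1<p<p_0(n,\alpha,\mu):= 1+\frac{1}{n(1-\alpha)+\mu}.$$ Assume that $u_0\in C^2(\mathbb{R}^n)$ and $u_1\in C^1(\mathbb{R}^n)$ are nontrivial and satisfy $u_1(x)\ge u_0(x)\ge 0$ and $\operatorname{supp}u_0,\ \operatorname{supp}u_1\subset\{|x|\le R\}$ with $R>0$. Suppose that the Cauchy problem $$u_{tt}-\frac{1}{t^{2\alpha}}\Delta u+\frac{\mu}{t}u_t=|u_t|^p,\quad t>1,\ x\in\mathbb{R}^n,\qquad u(1,x)=\varepsilon u_0(x),\quad u_t(1,x)=\varepsilon u_1(x),\quad x\in\mathbb{R}^n,$$ has a classical solution $u\in C^2([1,T)\times\mathbb{R}^n)$. Then $T<\infty$, and there exists a constant $\varepsilon_0>0$ depending on $p,\alpha,\mu,R,u_0,u_1$ such that the lifespan $T_\varepsilon$ has to satisfy $$T_\varepsilon\le C\varepsilon^{\frac{-(p-1)}{1-\{(1-\alpha)(n-1)+\mu+\alpha\}(p-1)/2}}\quad\text{if } p<p_G'(n,\alpha,\mu),$$ $$T_\varepsilon\le \exp\left(C\varepsilon^{-(p-1)}\right)\quad\text{if } p=p_G'(n,\alpha,\mu),$$ $$T_\varepsilon\le C\varepsilon^{\frac{-(p-1)}{1-(p-1)\{n(1-\alpha)+\mu\}}}\quad\text{if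 } p<p_0(n,\alpha,\mu)$$ for $0<\varepsilon\le\varepsilon_0$, where $C>0$ is a constant independent of $\varepsilon$.
   Context: Here $\Delta=\sum_{j=1}^n\partial^2/\partial x_j^2$ and $\varepsilon>0$ is a small parameter. The lifespan $T_\varepsilon$ is the supremum of all $T$ such that the Cauchy problem has a solution for $x\in\mathbb{R}^n$ and $1\le t<T$. *)

(* Defs.v *)
From HB Require Import structures.
From mathcomp Require Import all_boot all_order all_algebra.
From mathcomp Require Import all_classical all_reals all_analysis.
Import Order.TTheory GRing.Theory Num.Theory.
Import numFieldNormedType.Exports.

Set Implicit Arguments.
Unset Strict Implicit.
Unset Printing Implicit Defensive.

Local Open Scope classical_set_scope.
Local Open Scope ring_scope.

Section DerivativesOnASet.
Context {R : realType} {V : normedModType R}.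
Implicit Types (D B : set V) (f : V -> R) (z v : V).

(* Difference quotients at z that only use values of f at points of D.  On the
   face {t = 1} of [1, T) x R^n the time derivative is thus the right one, and
   at interior points of D these notions are [derivable] and ['D_v]. *)
Definition derivable_in D f z v : Prop :=
  cvg ((fun h : R => h^-1 *: (f (h *: v + z) - f z))
         @ within [set h | D (h *: v + z)] 0^').

Definition derive_in D f v z : R :=
  lim ((fun h : R => h^-1 *: (f (h *: v + z) - f z))
         @ within [set h | D (h *: v + z)] 0^').

(* C^k on D, where B is the set of coordinate directions of V: all the iterated
   partial derivatives up to order k exist and are continuous on D. *)
Fixpoint Ck_on B (k : nat) D f : Prop :=
  {within D, continuous f} /\
  (if k is k'.+1 then
     forall v, B v -> (forall z, D z -> derivable_in D f z v) /\
                      Ck_on B k' D (derive_in D f v)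
   else True).

Lemma within_interior D z v : D^° z ->
  within [set h : R | D (h *: v + z)] 0^' = 0^'.
Proof.
move=> Dz; have near_D : \forall h \near 0^', D (h *: v + z).
  apply: cvg_within.
  have /= c : h *: v + z @[h --> (0 : R)] --> (0 : R) *: v + z.
    by apply: cvgD; [apply: cvgZr_tmp; exact: cvg_id | exact: cvg_cst].
  by apply: c; rewrite scale0r add0r.
apply/seteqP; split => P /= HP; last first.
  by apply: filterS HP => h Ph _.
by apply: filterS2 near_D HP => h Dh /(_ Dh).
Qed.

Lemma derivable_in_interior D f z v :
  D^° z -> derivable_in D f z v = derivable f z v.
Proof. by move=> Dz; rewrite /derivable_in within_interior. Qed.

Lemma derive_in_interior D f z v : D^° z -> derive_in D f v z = 'D_v f z.
Proof. by move=> Dz; rewrite /derive_in within_interior. Qed.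

End DerivativesOnASet.

Section SpaceTime.
Context {R : realType} {n : nat}.

Definition space_dirs : set 'rV[R]_n := range (fun i : 'I_n => delta_mx 0 i).

Definition dir_t : R * 'rV[R]_n := (1, 0).
Definition dir_x (i : 'I_n) : R * 'rV[R]_n := (0, delta_mx 0 i).
Definition spacetime_dirs : set (R * 'rV[R]_n) := [set dir_t] `|` range dir_x.

(* The norm of 'rV[R]_n provided by the library is the sup norm. *)
Definition enorm (x : 'rV[R]_n) : R := Num.sqrt (\sum_(i < n) x 0 i ^+ 2).

Definition supp (f : 'rV[R]_n -> R) : set 'rV[R]_n :=
  closure [set x | f x != 0].

(* [1, T) x R^n, where T may be +oo *)
Definition strip (T : \bar R) : set (R * 'rV[R]_n) :=
  [set z | 1 <= z.1 /\ (z.1%:E < T)%E].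

Definition d_t (T : \bar R) (u : R * 'rV[R]_n -> R) : R * 'rV[R]_n -> R :=
  derive_in (strip T) u dir_t.

Definition d_x (T : \bar R) (i : 'I_n) (u : R * 'rV[R]_n -> R) :
    R * 'rV[R]_n -> R :=
  derive_in (strip T) u (dir_x i).

Definition laplacian (T : \bar R) (u : R * 'rV[R]_n -> R) :
    R * 'rV[R]_n -> R :=
  fun z => \sum_(i < n) d_x T i (d_x T i u) z.

Definition classical_solution (alpha mu p eps : R) (u0 u1 : 'rV[R]_n -> R)
    (T : \bar R) (u : R * 'rV[R]_n -> R) : Prop :=
  [/\ Ck_on spacetime_dirs 2 (strip T) u,
      (forall (t : R) (x : 'rV[R]_n), 1 < t -> (t%:E < T)%E ->
         d_t T (d_t T u) (t, x)
         - 1 / (t `^ (2 * alpha)) * laplacian T u (t, x)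
         + mu / t * d_t T u (t, x)
         = `|d_t T u (t, x)| `^ p),
      (forall x, u (1, x) = eps * u0 x) &
      (forall x, d_t T u (1, x) = eps * u1 x)].

(* Equals -oo if there is no classical solution at all, which C^2 x C^1 data do
   not exclude when n >= 2. *)
Definition lifespan (alpha mu p eps : R) (u0 u1 : 'rV[R]_n -> R) : \bar R :=
  ereal_sup [set T : \bar R | (1%:E < T)%E /\
               exists u, classical_solution alpha mu p eps u0 u1 T u].

End SpaceTime.

Definition p_G' {R : realType} (n : nat) (alpha mu : R) : R :=
  1 + 2 / ((1 - alpha) * (n%:R - 1) + mu + alpha).

Definition p_0 {R : realType} (n : nat) (alpha mu : R) : R :=
  1 + 1 / (n%:R * (1 - alpha) + mu).

(* Main.v *)
Require Import Defs.
From mathcomp Require Import all_boot all_order all_algebra.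
From mathcomp Require Import all_classical all_reals all_analysis.
From mathcomp Require Import ring lra.
Import Order.TTheory GRing.Theory Num.Theory.
Import numFieldNormedType.Exports.
Set Implicit Arguments.
Unset Strict Implicit.
Unset Printing Implicit Defensive.
Local Open Scope classical_set_scope.
Local Open Scope ring_scope.

(** The solution is tested against two spatial weights, the constant 1 and the
    plane exponential exp(x_1), and the resulting means of u_t are shown to
    satisfy a Riccati inequality whose solutions blow up in the stated time.

    Finite speed of propagation makes this possible: u(t, x) vanishes as soon as
    |x| > rad + s(t) - s(1), where s(t) = t^(1-alpha) / (1-alpha) is the distance
    covered at the speed t^(-alpha) ([cone_ut0], [u_out]). The proof is an energy
    estimate in a shrinking ball, with a C^1 cut-off instead of a moving domain of
    integration; on a compact piece of the strip u_t is bounded, so that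
    |u_t|^p u_t is controlled by the energy and Gronwall's inequality applies.
    Hence all spatial integrals may be taken over a cube that contains the support
    of u up to the time considered, and integrations by parts leave no boundary
    terms.

    For a weight w with Delta w = k w, the mean A(t) of u w satisfies
    A'' + (mu/t) A' - k t^(-2 alpha) A = N, where N is the mean of |u_t|^p w
    ([moment_utt]). Hoelder's inequality bounds N below by V^(1-p) (A'/2)^p, where V
    bounds the integral of w over the support of u(t, .) ([cubeint_hoelder]).

    With w = 1 one has k = 0 and V of order t^(n(1-alpha)). Then b = t^mu A' is
    nondecreasing and satisfies b' >= c t^(-(p-1)(n(1-alpha)+mu)) b^p
    ([mean_blowup]). Integration in t gives the bound for p < p_0.

    With w = exp(x_1) one has k = 1. The exponential concentrates in the cap of
    the ball of radius r where x_1 is close to r, whose width in the other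
    directions is of order sqrt r; thus V is of order
    exp(s(t)) t^((1-alpha)(n-1)/2) ([cubeint_cap_majorant]). The homogeneous equation
    for A has a solution that grows like t^((alpha-mu)/2) exp(s(t)), with a derivative
    that grows like t^(-(alpha+mu)/2) exp(s(t)). Dividing the combination
    A' + (t^(-alpha) + (mu-alpha)/(2t)) A by the latter leaves an error of relative
    size t^(alpha-2), which is integrable because alpha < 1; up to a bounded factor
    that absorbs it, the quotient b satisfies b' >= c t^(-q) b^p with
    q = ((1-alpha)(n-1) + mu + alpha)(p-1)/2 ([wave_blowup]). The hypothesis
    u_1 >= u_0 enters in A' >= c t^(-alpha) A, which lets A' be compared with that
    combination ([wave_slope]). A primitive of t^(-q) is a power of t for q < 1, that
    is for p < p_G', and the logarithm for q = 1, which accounts for the two kinds of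
    lifespan bounds. *)

(** * Integration over an interval *)

Section Segment.
Context {R : realType}.
Implicit Types (L : R) (f g F : R -> R).

Definition segint L f : R := \int[lebesgue_measure]_(y in `[- L, L]) f y.

Lemma segment_integrable L f : continuous f ->
  lebesgue_measure.-integrable `[- L, L] (EFin \o f).
Proof.
move=> cf; apply: continuous_compact_integrable; first exact: segment_compact.
exact: continuous_subspaceT.
Qed.

Lemma segint_le L f g : continuous f -> continuous g ->
  (forall y, - L <= y <= L -> f y <= g y) -> segint L f <= segint L g.
Proof.
move=> cf cg fg; apply: le_Rintegral => //; try exact: segment_integrable.
Qed.

Lemma segint_lin L a f g : continuous f -> continuous g ->
  segint L (fun y => a * f y + g y) = a * segint L f + segint L g.
Proof.
move=> cf cg; have caf : continuous (fun y => a * f y).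
  by move=> y; apply: cvgM; [exact: cvg_cst|exact: cf].
rewrite /segint RintegralD//; try exact: segment_integrable.
by rewrite RintegralZl//; exact: segment_integrable.
Qed.

Lemma segint_ftc L f F : 0 < L -> continuous f ->
  (forall y : R, is_derive y (1 : R) F (f y)) -> segint L f = F L - F (- L).
Proof.
move=> L0 cf dF; rewrite /segint /Rintegral.
have cF : continuous F.
  move=> y; apply: differentiable_continuous; apply/derivable1_diffP.
  exact: ex_derive.
rewrite (@continuous_FTC2 _ _ F)//; first by rewrite lt_neqAle -subr_eq0; lra.
- exact: continuous_subspaceT.
- split; [by move=> y _; exact: ex_derive| |].
    exact/cvg_at_right_filter/cF.
  exact/cvg_at_left_filter/cF.
- by move=> y _; rewrite derive1E derive_val.
Qed.

Lemma ge0_subset_Rintegral (A B : set R) f : measurable A -> measurable B ->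
  A `<=` B -> lebesgue_measure.-integrable B (EFin \o f) ->
  (forall y, B y -> 0 <= f y) ->
  \int[lebesgue_measure]_(y in A) f y <= \int[lebesgue_measure]_(y in B) f y.
Proof.
move=> mA mB AB fB f0; rewrite /Rintegral fine_le//.
- apply: integrable_fin_num => //; exact: integrableS fB.
- exact: integrable_fin_num.
- by apply: ge0_subset_integral => //; case/integrableP: fB.
Qed.

Lemma segint_widen L L' f : L <= L' -> continuous f ->
  (forall y, 0 <= f y) -> segint L f <= segint L' f.
Proof.
move=> LL cf f0; apply: ge0_subset_Rintegral => //; last exact: segment_integrable.
by apply: subset_itv; rewrite !bnd_simp// lerN2.
Qed.

Lemma segint_gt0 L f (y0 : R) : continuous f -> (forall y, 0 <= f y) ->
  - L < y0 < L -> 0 < f y0 -> 0 < segint L f.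
Proof.
move=> cf f0 /andP[y1 y2] fy0.
have /nbhs_ballP[e /= e0 He] : \forall y \near y0, f y0 / 2 < f y.
  by apply: (cvgr_gt _ (cf y0)); rewrite ltr_pdivrMr// ltr_pMr// ltr1n.
pose d := Num.min (e / 2) (Num.min (L - y0) (y0 + L)).
have d0 : 0 < d by rewrite !lt_min divr_gt0//; apply/andP; split => //; apply/andP; split; lra.
have [de dL1 dL2] : [/\ d <= e / 2, d <= L - y0 & d <= y0 + L].
  by rewrite /d !ge_min !lexx !orbT.
have sub : `[y0 - d, y0 + d] `<=` `[- L, L].
  by apply: subset_itv; rewrite !bnd_simp; lra.
apply: (@lt_le_trans _ _ (\int[lebesgue_measure]_(y in `[y0 - d, y0 + d]) (f y0 / 2))).
  rewrite Rintegral_cst// [X in fine X]lebesgue_measure_itv /= lte_fin.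
  by rewrite ifT/=; [apply: mulr_gt0|]; lra.
apply: (@le_trans _ _ (\int[lebesgue_measure]_(y in `[y0 - d, y0 + d]) f y)).
  apply: le_Rintegral => //.
  - apply: continuous_compact_integrable; first exact: segment_compact.
    by apply: continuous_subspaceT => y; exact: cvg_cst.
  - apply: continuous_compact_integrable; first exact: segment_compact.
    exact: continuous_subspaceT.
  - move=> y; rewrite /= in_itv/= => /andP[ya yb]; apply/ltW/He.
    by rewrite /ball/= ltr_norml; apply/andP; split; lra.
by apply: ge0_subset_Rintegral => //; exact: segment_integrable.
Qed.
End Segment.

(** * Continuity of composite functions *)

Lemma pair_continuous {X Y Z : topologicalType} (f : X -> Y) (g : X -> Z) (x : X) :
  {for x, continuous f} -> {for x, continuous g} ->
  {for x, continuous (fun x => (f x, g x))}.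
Proof. by move=> cf cg; exact: cvg_pair. Qed.

Section PointwiseContinuity.
Context {R : realType} {T : topologicalType}.
Implicit Types (f g : T -> R) (x : T).

Lemma cont_cst (c : R) x : {for x, continuous (fun _ : T => c)}.
Proof. exact: cst_continuous. Qed.

Lemma cont_add f g x : {for x, continuous f} -> {for x, continuous g} ->
  {for x, continuous (fun y => f y + g y)}.
Proof. by move=> cf cg; exact: cvgD. Qed.

Lemma cont_sub f g x : {for x, continuous f} -> {for x, continuous g} ->
  {for x, continuous (fun y => f y - g y)}.
Proof. by move=> cf cg; exact: cvgB. Qed.

Lemma cont_mul f g x : {for x, continuous f} -> {for x, continuous g} ->
  {for x, continuous (fun y => f y * g y)}.
Proof. by move=> cf cg; exact: cvgM. Qed.

Lemma cont_comp (h : R -> R) f x : {for f x, continuous h} ->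
  {for x, continuous f} -> {for x, continuous (fun y => h (f y))}.
Proof. by move=> ch cf; exact: (@continuous_comp _ _ _ f h). Qed.

Lemma cont_sum (I : finType) (f : I -> T -> R) x :
  (forall i, {for x, continuous (f i)}) ->
  {for x, continuous (fun y => \sum_i f i y)}.
Proof.
move=> cf; elim: (index_enum I) => [|i s IH].
  rewrite (_ : (fun _ => _) = fun=> 0); first exact: cont_cst.
  by apply/funext => y; rewrite big_nil.
rewrite (_ : (fun _ => _) = fun y => f i y + \sum_(j <- s) f j y).
  exact: cont_add.
by apply/funext => y; rewrite big_cons.
Qed.

End PointwiseContinuity.

Section GlobalContinuity.
Context {R : realType} {T : topologicalType}.
Implicit Types (f g : T -> R).

Lemma contT_cst (c : R) : continuous (fun _ : T => c).
Proof. exact: cst_continuous. Qed.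

Lemma contT_add f g : continuous f -> continuous g ->
  continuous (fun y => f y + g y).
Proof. by move=> cf cg x; exact: cont_add (cf x) (cg x). Qed.

Lemma contT_sub f g : continuous f -> continuous g ->
  continuous (fun y => f y - g y).
Proof. by move=> cf cg x; exact: cont_sub (cf x) (cg x). Qed.

Lemma contT_mul f g : continuous f -> continuous g ->
  continuous (fun y => f y * g y).
Proof. by move=> cf cg x; exact: cont_mul (cf x) (cg x). Qed.

Lemma contT_comp (h : R -> R) f : continuous h -> continuous f ->
  continuous (fun y => h (f y)).
Proof. by move=> ch cf x; exact: cont_comp (ch (f x)) (cf x). Qed.

Lemma contT_sum (I : finType) (f : I -> T -> R) : (forall i, continuous (f i)) ->
  continuous (fun y => \sum_i f i y).
Proof. by move=> cf x; apply: cont_sum => i; exact: cf. Qed.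

End GlobalContinuity.

Lemma pairl_continuous {X Y : topologicalType} (x : X) :
  continuous (fun y : Y => (x, y)).
Proof. by move=> y; apply: pair_continuous; [exact: cvg_cst|exact: cvg_id]. Qed.

(** * Positive linear functionals *)

Section PositiveFunctional.
Context {R : realType}.

(** The properties of an integral over a compact set K on which the dependence on
    parameters rests. Working with them treats the integrals over an interval and
    over a cube alike, and needs neither measurability nor dominated convergence. *)
Definition positive_linear {Y : topologicalType} (K : set Y)
    (Lam : (Y -> R) -> R) : Prop :=
  (forall (a : R) (f g : Y -> R), continuous f -> continuous g ->
     Lam (fun y => a * f y + g y) = a * Lam f + Lam g) /\
  (forall (f g : Y -> R), continuous f -> continuous g ->
     (forall y, K y -> f y <= g y) -> Lam f <= Lam g).

Section Theory.
Context {Y : topologicalType} (K : set Y) (Lam : (Y -> R) -> R).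
Hypothesis Lam_pos : positive_linear K Lam.
Implicit Types (f g : Y -> R) (a e : R).

Lemma poslin0 : Lam (fun=> 0) = 0.
Proof.
have [lin _] := Lam_pos.
have c0 : continuous (fun _ : Y => 0 : R) by move=> y; exact: cvg_cst.
have := lin 1 _ _ c0 c0; rewrite (_ : (fun=> _) = fun=> 0); first lra.
by apply/funext => y; rewrite mulr0 addr0.
Qed.

Lemma poslinD f g : continuous f -> continuous g ->
  Lam (fun y => f y + g y) = Lam f + Lam g.
Proof.
have [lin _] := Lam_pos => cf cg; rewrite -[Lam f]mul1r -lin//.
by congr Lam; apply/funext => y; rewrite mul1r.
Qed.

Lemma poslinZ a f : continuous f -> Lam (fun y => a * f y) = a * Lam f.
Proof.
have [lin _] := Lam_pos => cf; rewrite -[RHS]addr0 -poslin0 -lin//.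
  by congr Lam; apply/funext => y; rewrite addr0.
by move=> y; exact: cvg_cst.
Qed.

Lemma poslinB f g : continuous f -> continuous g ->
  Lam (fun y => f y - g y) = Lam f - Lam g.
Proof.
have [lin _] := Lam_pos => cf cg; rewrite addrC -mulN1r -lin//.
by congr Lam; apply/funext => y; rewrite mulN1r addrC.
Qed.

Lemma poslin_bound e f : continuous f -> (forall y, K y -> `|f y| <= e) ->
  `|Lam f| <= e * Lam (fun=> 1).
Proof.
have [_ le] := Lam_pos => cf fe.
have c1 : continuous (fun _ : Y => 1 : R) by move=> y; exact: cvg_cst.
have cc a : continuous (fun _ : Y => a * 1 : R) by move=> y; exact: cvg_cst.
rewrite ler_norml -mulNr -!poslinZ//; apply/andP; split; apply: le => // y Ky;
  by rewrite mulr1; have := fe _ Ky; rewrite ler_norml => /andP[].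
Qed.

Lemma poslin1_ge0 : 0 <= Lam (fun=> 1).
Proof.
have [_ le] := Lam_pos; rewrite -poslin0; apply: le => //; by move=> y; exact: cvg_cst.
Qed.

(** A tube lemma: compactness of K makes the continuity at the points of {x0} x K
    uniform. *)
Lemma near_uniform {X : topologicalType} (F : X -> Y -> R) (x0 : X) e :
  compact K -> 0 < e ->
  (forall y, K y -> {for (x0, y), continuous (fun z : X * Y => F z.1 z.2)}) ->
  \forall x \near x0, forall y, K y -> `|F x y - F x0 y| < e.
Proof.
move=> /compact_near_coveringP cK e0 cF.
apply: (cK _ _ (fun x y => `|F x y - F x0 y| < e)) => y Ky.
have e20 : 0 < e / 2 by rewrite divr_gt0.
have /cvgrPdist_lt/(_ _ e20)[[A B]/= [HA HB] AB] := cF y Ky.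
exists (B, A) => //= -[y' x'] /= [By' Ax'].
have h1 := AB (x', y') (conj Ax' By').
have h2 := AB (x0, y') (conj (nbhs_singleton HA) By').
rewrite /= in h1 h2.
rewrite -(subrKA (F x0 y)) (le_lt_trans (ler_normD _ _))//.
by rewrite [X in _ < X]splitr ltrD// distrC.
Qed.

Lemma poslin_continuous {X : topologicalType} (F : X -> Y -> R) :
  compact K -> continuous (fun z : X * Y => F z.1 z.2) ->
  continuous (fun x => Lam (F x)).
Proof.
move=> cK cF x0; apply/cvgrPdist_lt => e e0.
have cFx x : continuous (F x).
  move=> y; apply: (@continuous_comp _ _ _ (fun y => (x, y)) (fun z => F z.1 z.2)).
    exact: pairl_continuous.
  exact: cF.
pose M := Lam (fun=> 1) + 1.
have M0 : 0 < M by rewrite ltr_wpDl// poslin1_ge0.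
near=> x.
have Hx : forall y, K y -> `|F x y - F x0 y| < e / M.
  by near: x; apply: near_uniform => //; [exact: divr_gt0|move=> y _; exact: cF].
rewrite distrC -poslinB//; apply: le_lt_trans (poslin_bound (e := e / M) _ _) _.
- by move=> y; apply: cvgB; exact: cFx.
- by move=> y Ky; exact/ltW/Hx.
- rewrite mulrAC ltr_pdivrMr// ltr_pM2l// /M ltrDl//.
Unshelve. all: end_near. Qed.

End Theory.
End PositiveFunctional.

(** * Derivation under a positive functional *)

Lemma is_derive_cvg {R : realType} {V : normedModType R} (f : V -> R) (x v : V)
    (l : R) :
  (fun h : R => h^-1 *: (f (h *: v + x) - f x)) @ 0^' --> l ->
  is_derive x v f l.
Proof.
move=> fl; apply: DeriveDef; first by apply/cvg_ex; exists l.
exact: (cvg_lim (@Rhausdorff R) fl).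
Qed.

Lemma is_deriveP {R : realType} {V : normedModType R} (f : V -> R) (x v : V)
    (l : R) :
  is_derive x v f l ->
  (fun h : R => h^-1 *: (f (h *: v + x) - f x)) @ 0^' --> l.
Proof. by case=> df <-; exact: df. Qed.

Lemma is_derive1_continuous {R : realType} (f : R -> R) (x l : R) :
  is_derive x (1 : R) f l -> {for x, continuous f}.
Proof.
move=> df; apply: differentiable_continuous; apply/derivable1_diffP.
exact: ex_derive.
Qed.

Lemma MVT_around {R : realType} (f g : R -> R) (t0 d h : R) :
  (forall t, `|t - t0| < d -> is_derive t (1 : R) f (g t)) -> `|h| < d ->
  exists2 c, `|c - t0| <= `|h| & f (h + t0) - f t0 = g c * h.
Proof.
move=> df hd.
have cf t : `|t - t0| < d -> {for t, continuous f}.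
  by move=> /df; exact: is_derive1_continuous.
have [h0|h0] := leP 0 h.
  have [|||c] := @MVT_segment _ f g t0 (h + t0); first by lra.
    move=> t; rewrite in_itv/= => /andP[? ?]; apply: df.
    by rewrite ger0_norm in hd *; rewrite ?ger0_norm; lra.
  - apply: continuous_in_subspaceT => t; rewrite inE/= in_itv/= => /andP[? ?]; apply: cf.
    by rewrite ger0_norm in hd *; rewrite ?ger0_norm; lra.
  rewrite in_itv/= => /andP[c1 c2] ->; exists c; last by congr (_ * _); lra.
  by rewrite !ger0_norm; lra.
have [|||c] := @MVT_segment _ f g (h + t0) t0; first lra.
  move=> t; rewrite in_itv/= => /andP[? ?]; apply: df.
  by move: hd; rewrite ltr0_norm// ler0_norm; lra.
  apply: continuous_in_subspaceT => t; rewrite inE/= in_itv/= => /andP[? ?]; apply: cf.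
  by move: hd; rewrite ltr0_norm// ler0_norm; lra.
rewrite in_itv/= => /andP[c1 c2] cE; exists c.
  by rewrite ler0_norm ?ltr0_norm; lra.
by rewrite -[LHS]opprB cE; ring.
Qed.

(** By the mean value theorem, the difference quotient at y is the derivative at a
    nearby time; by [near_uniform] it is close to the derivative at t0 uniformly in
    y, which is all that a positive functional needs. *)
Lemma poslin_derive {R : realType} {Y : topologicalType} (K : set Y)
    (Lam : (Y -> R) -> R) (F G : R -> Y -> R) (t0 : R) :
  positive_linear K Lam -> compact K ->
  (\forall t \near t0, continuous (F t) /\
     forall y, is_derive t (1 : R) (F^~ y) (G t y)) ->
  (forall y, {for (t0, y), continuous (fun z : R * Y => G z.1 z.2)}) ->
  is_derive t0 (1 : R) (fun t => Lam (F t)) (Lam (G t0)).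
Proof.
move=> LP cK dF cG; apply: is_derive_cvg; apply/cvgrPdist_lt => e e0.
have cG0 : continuous (G t0).
  move=> y; apply: (@continuous_comp _ _ _ (fun y => (t0, y)) (fun z => G z.1 z.2)).
    exact: pairl_continuous.
  exact: cG.
pose M := Lam (fun=> 1) + 1.
have M0 : 0 < M by rewrite ltr_wpDl// (poslin1_ge0 LP).
have eM : 0 < e / M by exact: divr_gt0.
have near2 := near_uniform cK eM (fun y _ => cG y).
have /nbhs_ballP[d /= d0 Hd] :
    \forall t \near t0, (forall y, K y -> `|G t y - G t0 y| < e / M) /\
     continuous (F t) /\ forall y, is_derive t (1 : R) (F^~ y) (G t y).
  by near=> t; split; [near: t|near: t].
have Hd' t : `|t - t0| < d -> (forall y, K y -> `|G t y - G t0 y| < e / M) /\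
     continuous (F t) /\ forall y, is_derive t (1 : R) (F^~ y) (G t y).
  by move=> td; apply: Hd; rewrite /ball/= distrC.
have [_ [cF0 _]] : (forall y, K y -> `|G t0 y - G t0 y| < e / M) /\
     continuous (F t0) /\ forall y, is_derive t0 (1 : R) (F^~ y) (G t0 y).
  by apply: Hd'; rewrite subrr normr0.
near=> h.
have h0 : h != 0 by near: h; exact: nbhs_dnbhs_neq.
have hd : `|h| < d by near: h; exact: dnbhs0_lt.
have [_ [cFh _]] := Hd' (h + t0) ltac:(by rewrite addrK).
have scE (a b : R) : a *: (b : R^o) = a * b by [].
rewrite /= scaler1 -(poslinB LP)// scE -(poslinZ LP); last first.
  by move=> y; apply: cvgB; [exact: cFh|exact: cF0].
have cq : continuous (fun y => h^-1 * (F (h + t0) y - F t0 y)).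
  by move=> y; apply: cvgM; [exact: cvg_cst|apply: cvgB; [exact: cFh|exact: cF0]].
rewrite -(poslinB LP)//.
apply: (@le_lt_trans _ _ (e / M * Lam (fun=> 1))).
  apply: (poslin_bound LP); first by move=> y; apply: cvgB; [exact: cG0|exact: cq].
  move=> y Ky.
  have [|c cd ->] := @MVT_around _ (F^~ y) (G^~ y) t0 d h _ hd.
    by move=> t /Hd'[_ [_]].
  rewrite mulrC mulfK// distrC ltW//.
  by apply: (Hd' c _).1 => //; exact: le_lt_trans cd hd.
by rewrite mulrAC ltr_pdivrMr// ltr_pM2l// /M ltrDl.
Unshelve. all: end_near. Qed.

(** * Integration over a cube *)

Section BoxIntegral.
Context {R : realType} {n : nat}.
Implicit Types (x z : 'rV[R]_n) (i j : 'I_n) (L : R) (f g h : 'rV[R]_n -> R).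
Implicit Types (s : seq 'I_n).

(** Written as a translation, which makes its continuity and its behaviour under
    derivation along another coordinate apparent. *)
Definition set_coord i x (y : R) : 'rV[R]_n :=
  x + (y - x 0 i) *: delta_mx 0 i.

Lemma set_coordE i x y j :
  set_coord i x y 0 j = if j == i then y else x 0 j.
Proof.
rewrite !mxE eqxx/=; case: eqVneq => [->|_]; first by rewrite mulr1 addrC subrK.
by rewrite mulr0 addr0.
Qed.

Lemma set_coord_id i x : set_coord i x (x 0 i) = x.
Proof. by rewrite /set_coord subrr scale0r addr0. Qed.

Lemma set_coord_continuous i :
  continuous (fun z : 'rV[R]_n * R => set_coord i z.1 z.2).
Proof.
move=> [x y]; rewrite /set_coord; apply: cvgD; first exact: cvg_fst.
apply: cvgZr_tmp; apply: cvgB; first exact: cvg_snd.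
apply: (@continuous_comp _ _ _ fst (fun x : 'rV[R]_n => x 0 i)).
  exact: cvg_fst.
exact: coord_continuous.
Qed.

(** Only the coordinates listed in s are integrated; the others are frozen at
    those of x. The recursion on s keeps the type of the vectors fixed, and the
    coordinates not yet integrated remain available for derivation. *)
Fixpoint boxint L s f x : R :=
  if s is i :: s' then segint L (fun y => boxint L s' f (set_coord i x y))
  else f x.

Lemma segint_poslin L : positive_linear `[- L, L] (@segint R L).
Proof.
split; first exact: segint_lin.
by move=> f g cf cg fg; apply: segint_le => // y yL; apply: fg; rewrite /= in_itv.
Qed.

Lemma boxint_continuous L s f : continuous f -> continuous (boxint L s f).
Proof.
move=> cf; elim: s => //= i s IH.
apply: (poslin_continuous (segint_poslin L)
  (F := fun x y => boxint L s f (set_coord i x y))).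
  exact: segment_compact.
move=> z; apply: (@continuous_comp _ _ _ (fun z : 'rV[R]_n * R => set_coord i z.1 z.2) (boxint L s f)).
  exact: set_coord_continuous.
exact: IH.
Qed.

Lemma boxint_slice_continuous L s f i x : continuous f ->
  continuous (fun y => boxint L s f (set_coord i x y)).
Proof.
move=> cf y; apply: (@continuous_comp _ _ _ (set_coord i x) (boxint L s f)); last first.
  exact: boxint_continuous.
apply: (@continuous_comp _ _ _ (fun y : R => (x, y)) (fun z : 'rV[R]_n * R => set_coord i z.1 z.2)).
  exact: pairl_continuous.
exact: set_coord_continuous.
Qed.

Lemma boxint_lin L s (a : R) f g x : continuous f -> continuous g ->
  boxint L s (fun z => a * f z + g z) x = a * boxint L s f x + boxint L s g x.
Proof.
move=> cf cg; elim: s x => //= i s IH x.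
rewrite -segint_lin; [|exact: boxint_slice_continuous..].
by congr segint; apply/funext => y; exact: IH.
Qed.

Lemma boxint_le L s f g x : continuous f -> continuous g ->
  (forall z, (forall j, j \in s -> - L <= z 0 j <= L) ->
     (forall j, j \notin s -> z 0 j = x 0 j) -> f z <= g z) ->
  boxint L s f x <= boxint L s g x.
Proof.
move=> cf cg; elim: s x => [|i s IH] x fg /=; first exact: fg.
apply: segint_le; [exact: boxint_slice_continuous..|] => y yL.
apply: IH => z zs zx; apply: fg => j.
  rewrite inE; have [js _|js] := boolP (j \in s); first exact: zs.
  by rewrite orbF => /eqP ji; rewrite zx// set_coordE ji eqxx.
by rewrite inE negb_or => /andP[ji js]; rewrite zx// set_coordE (negbTE ji).
Qed.

Lemma boxint_eq0 L s f x : continuous f ->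
  (forall z, (forall j, j \in s -> - L <= z 0 j <= L) ->
     (forall j, j \notin s -> z 0 j = x 0 j) -> f z = 0) ->
  boxint L s f x = 0.
Proof.
move=> cf f0; have c0 : continuous (fun _ : 'rV[R]_n => 0 : R).
  exact: cst_continuous.
have I0 : boxint L s (fun=> 0) x = 0.
  have := boxint_lin L s 1 x c0 c0.
  by rewrite [in LHS]mulr0 [in LHS]addr0 => ?; lra.
apply/le_anti/andP; split; [rewrite -[leRHS]I0|rewrite -[leLHS]I0];
  by apply: boxint_le => // z z1 z2; rewrite f0.
Qed.

Lemma boxint_indep L s f x x' : (forall j, j \notin s -> x 0 j = x' 0 j) ->
  boxint L s f x = boxint L s f x'.
Proof.
elim: s x x' => [|i s IH] x x' xx /=.
  by congr f; apply/rowP => j; exact: xx.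
congr segint; apply/funext => y; apply: IH => j js.
by rewrite !set_coordE; case: ifPn => // ji; apply: xx; rewrite inE negb_or ji.
Qed.

Lemma boxint_gt0 L s f x : continuous f -> (forall z, 0 <= f z) ->
  (forall j, - L < x 0 j < L) -> 0 < f x -> 0 < boxint L s f x.
Proof.
move=> cf f0 xL fx; elim: s => //= i s IH.
apply: (@segint_gt0 _ _ _ (x 0 i)) => //; last by rewrite set_coord_id.
  exact: boxint_slice_continuous.
move=> y; rewrite -[leLHS](@boxint_eq0 L s (fun=> 0) (set_coord i x y))//; last first.
  exact: cst_continuous.
by apply: boxint_le=> //; exact: cst_continuous.
Qed.

Lemma boxint_widen L L' s f x : L <= L' -> continuous f -> (forall z, 0 <= f z) ->
  boxint L s f x <= boxint L' s f x.
Proof.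
move=> LL cf f0; elim: s x => //= i s IH x.
apply: (@le_trans _ _ (segint L' (fun y => boxint L s f (set_coord i x y)))).
  apply: segint_widen => //; first exact: boxint_slice_continuous.
  move=> y; rewrite -[leLHS](@boxint_eq0 L s (fun=> 0) (set_coord i x y))//; last first.
    exact: cst_continuous.
  by apply: boxint_le=> //; exact: cst_continuous.
by apply: segint_le => //; exact: boxint_slice_continuous.
Qed.

Lemma boxint_prod L s (g : 'I_n -> R -> R) x : uniq s ->
  (forall j, continuous (g j)) ->
  boxint L s (fun z => \prod_(j < n) g j (z 0 j)) x =
  \prod_(j < n) (if j \in s then segint L (g j) else g j (x 0 j)).
Proof.
move=> + cg; elim: s x => [|i s IH] x //= /andP[iNs us].
under [X in segint L X]funext => y.
  rewrite IH// (bigD1 i)//= (negbTE iNs) set_coordE eqxx mulrC.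
  rewrite (eq_bigr (fun j => if j \in i :: s then segint L (g j) else g j (x 0 j))); last first.
    by move=> j ji; rewrite inE (negbTE ji)/= set_coordE (negbTE ji).
  over.
by rewrite (poslinZ (segint_poslin L))// [RHS](bigD1 i)//= inE eqxx/= mulrC.
Qed.

Lemma is_derive_line f (v x : 'rV[R]_n) (t l : R) :
  is_derive (t *: v + x) v f l -> is_derive t (1 : R) (fun t => f (t *: v + x)) l.
Proof.
move=> df; apply: is_derive_cvg; have := is_deriveP df.
rewrite (_ : (fun h : R => _) = (fun h : R => h^-1 *: (f ((h *: (1 : R) + t) *: v + x) - f (t *: v + x))))//.
by apply/funext => h; rewrite scaler1 scalerDl addrA.
Qed.

Lemma boxint_derive L s f f' i x : i \notin s ->
  continuous f -> continuous f' ->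
  (forall z, is_derive z (delta_mx 0 i : 'rV[R]_n) f (f' z)) ->
  is_derive x (delta_mx 0 i : 'rV[R]_n) (boxint L s f) (boxint L s f' x).
Proof.
move=> + cf cf' df; elim: s x => [|j s IH] x //=.
rewrite inE negb_or => /andP[ij iNs].
have sc (t y : R) : set_coord j (t *: delta_mx 0 i + x) y =
    t *: delta_mx 0 i + set_coord j x y.
  by rewrite /set_coord !mxE eqxx eq_sym (negbTE ij)/= mulr0 add0r addrA.
have := @poslin_derive R _ _ _
  (fun t y => boxint L s f (set_coord j (t *: delta_mx 0 i + x) y))
  (fun t y => boxint L s f' (set_coord j (t *: delta_mx 0 i + x) y)) 0
  (segint_poslin L) (@segment_compact R (- L) L).
rewrite scale0r add0r => H.
apply: is_derive_cvg.
have {H} /is_deriveP : is_derive (0 : R) (1 : R)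
   (fun t : R => segint L (fun y => boxint L s f (set_coord j (t *: delta_mx 0 i + x) y)))
   (segint L (fun y => boxint L s f' (set_coord j x y))).
  apply: H.
    near=> t; split; first exact: boxint_slice_continuous.
    move=> y; rewrite sc.
    rewrite (_ : (fun _ => _) = (fun t => boxint L s f (t *: delta_mx 0 i + set_coord j x y))); last first.
      by apply/funext => t'; rewrite sc.
    by apply: is_derive_line; exact: IH.
  move=> y.
  apply: (@continuous_comp _ _ _ (fun z : R * R => set_coord j (z.1 *: delta_mx 0 i + x) z.2) (boxint L s f')); last first.
    exact: boxint_continuous.
  apply: (@continuous_comp _ _ _ (fun z : R * R => (z.1 *: delta_mx 0 i + x, z.2)) (fun z : 'rV[R]_n * R => set_coord j z.1 z.2)).
    apply: pair_continuous; last exact: cvg_snd.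
    apply: cvgD; last exact: cvg_cst.
    by apply: cvgZr_tmp; exact: cvg_fst.
  exact: set_coord_continuous.
rewrite (_ : (fun h : R => _) = (fun h : R => h^-1 *: (segint L (fun y => boxint L s f (set_coord j (h *: delta_mx 0 i + x) y)) -
  segint L (fun y => boxint L s f (set_coord j x y)))))//.
by apply/funext => h; rewrite scaler1 addr0 scale0r add0r.
Unshelve. all: end_near. Qed.

(** The integrations inside the i-th one commute with the i-th derivative
    ([boxint_derive]). The i-th one thus integrates a derivative, and only values on
    the two faces remain; the outer integrations see 0. *)
Lemma boxint_div L s f f' i x : 0 < L -> uniq s -> i \in s ->
  continuous f -> continuous f' ->
  (forall z, is_derive z (delta_mx 0 i : 'rV[R]_n) f (f' z)) ->
  (forall z, `|z 0 i| = L -> f z = 0) ->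
  boxint L s f' x = 0.
Proof.
move=> L0 + + cf cf' df f0; elim: s x => [|j s IH] x //= /andP[jNs us].
rewrite inE => /orP[/eqP ij|iS]; last first.
  rewrite -[RHS](poslin0 (segint_poslin L)); congr segint.
  by apply/funext => y; exact: IH.
subst j; have dF (y : R) : is_derive y (1 : R)
    (fun y => boxint L s f (set_coord i x y)) (boxint L s f' (set_coord i x y)).
  have E t : set_coord i x t = t *: delta_mx 0 i + (x - x 0 i *: delta_mx 0 i).
    by rewrite /set_coord scalerBl addrCA addrA.
  rewrite (_ : (fun y => _) = (fun t => boxint L s f (t *: delta_mx 0 i + (x - x 0 i *: delta_mx 0 i)))); last first.
    by apply/funext => t; rewrite E.
  by apply: is_derive_line; rewrite E; exact: boxint_derive.
rewrite (segint_ftc L0 _ dF); last exact: boxint_slice_continuous.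
rewrite !boxint_eq0 ?subrr// => z _ zs; apply: f0.
  by rewrite zs// set_coordE eqxx normrN ger0_norm// ltW.
by rewrite zs// set_coordE eqxx ger0_norm// ltW.
Qed.

(** The base point is arbitrary, because every coordinate is integrated
    ([boxint_indep]). *)
Definition cubeint L f : R := boxint L (enum 'I_n) f 0.

Definition cube L : set 'rV[R]_n := [set x | forall i, - L <= x 0 i <= L].

Lemma cube_compact L : compact (cube L).
Proof.
rewrite (_ : cube L = [set x | forall i, `[- L, L]%classic (x ord0 i)]); last first.
  by apply/funext => x; apply/propext; split => xL i; have := xL i; rewrite /= in_itv.
by apply: (@rV_compact _ _ (fun=> `[- L, L]%classic)) => i; exact: segment_compact.
Qed.

Lemma cubeint_poslin L : positive_linear (cube L) (cubeint L).
Proof.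
split; first by move=> a f g cf cg; exact: boxint_lin.
move=> f g cf cg fg; apply: boxint_le => // z zs _; apply: fg => i.
by apply: zs; rewrite mem_enum.
Qed.

Lemma cubeint_gt0 L f x : continuous f -> (forall z, 0 <= f z) ->
  (forall j, - L < x 0 j < L) -> 0 < f x -> 0 < cubeint L f.
Proof.
move=> cf f0 xL fx; rewrite /cubeint (@boxint_indep _ _ _ 0 x).
  exact: boxint_gt0.
by move=> j; rewrite mem_enum.
Qed.

Lemma cubeint_widen L L' f : L <= L' -> continuous f -> (forall z, 0 <= f z) ->
  cubeint L f <= cubeint L' f.
Proof. exact: boxint_widen. Qed.

Lemma cubeint_prod L (g : 'I_n -> R -> R) : (forall j, continuous (g j)) ->
  cubeint L (fun z => \prod_(j < n) g j (z 0 j)) = \prod_(j < n) segint L (g j).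
Proof.
move=> cg; rewrite /cubeint boxint_prod ?enum_uniq//.
by apply: eq_bigr => j _; rewrite mem_enum.
Qed.

Lemma cubeint_div L f f' i : 0 < L ->
  continuous f -> continuous f' ->
  (forall z, is_derive z (delta_mx 0 i : 'rV[R]_n) f (f' z)) ->
  (forall z, `|z 0 i| = L -> f z = 0) ->
  cubeint L f' = 0.
Proof.
move=> L0 cf cf' df f0; apply: (@boxint_div L _ f f' i) => //.
  exact: enum_uniq.
by rewrite mem_enum.
Qed.

End BoxIntegral.

(** * Rules of derivation *)

(** The rules are stated for functions given by their values, so that the
    derivative of a composite expression is assembled as a term and compared with
    the expected one by [der_eq]. *)
Section Calculus.
Context {R : realType} {V : normedModType R}.
Implicit Types (f g : V -> R) (x v : V).

Lemma der_eq f x v (a b : R) : is_derive x v f a -> a = b -> is_derive x v f b.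
Proof. by move=> df <-. Qed.

Lemma der_cst (c : R) x v : is_derive x v (fun=> c) 0.
Proof. exact: is_derive_cst. Qed.

Lemma der_add f g x v (a b : R) : is_derive x v f a -> is_derive x v g b ->
  is_derive x v (fun y => f y + g y) (a + b).
Proof. by move=> df dg; exact: (is_deriveD df dg). Qed.

Lemma der_sub f g x v (a b : R) : is_derive x v f a -> is_derive x v g b ->
  is_derive x v (fun y => f y - g y) (a - b).
Proof. by move=> df dg; exact: (is_deriveB df dg). Qed.

Lemma der_opp f x v (a : R) : is_derive x v f a ->
  is_derive x v (fun y => - f y) (- a).
Proof. by move=> df; exact: (is_deriveN df). Qed.

Lemma der_mul f g x v (a b : R) : is_derive x v f a -> is_derive x v g b ->
  is_derive x v (fun y => f y * g y) (a * g x + f x * b).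
Proof.
move=> df dg; apply: der_eq (is_deriveM df dg) _.
by rewrite addrC /GRing.scale/= [g x * _]mulrC.
Qed.

Lemma der_sum (I : finType) (f : I -> V -> R) x v (a : I -> R) :
  (forall i, is_derive x v (f i) (a i)) ->
  is_derive x v (fun y => \sum_i f i y) (\sum_i a i).
Proof.
move=> df; elim: (index_enum I) => [|i s IH].
  rewrite big_nil (_ : (fun _ => _) = fun=> 0); first exact: der_cst.
  by apply/funext => y; rewrite big_nil.
rewrite big_cons (_ : (fun _ => _) = fun y => f i y + \sum_(j <- s) f j y).
  exact: der_add.
by apply/funext => y; rewrite big_cons.
Qed.

Lemma der_comp (h : R -> R) f x v (a b : R) : is_derive (f x) (1 : R) h a ->
  is_derive x v f b -> is_derive x v (fun y => h (f y)) (a * b).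
Proof.
move=> dh df; apply: is_derive_cvg.
have dl : is_derive (0 : R) (1 : R) (fun t : R => f (t *: v + x)) b.
  apply: is_derive_cvg; have := is_deriveP df.
  rewrite (_ : (fun h0 : R => _) = (fun h : R => h^-1 *: (f ((h *: (1 : R) + 0) *: v + x) - f (0 *: v + x))))//.
  by apply/funext => t; rewrite scaler1 addr0 scale0r add0r.
have dh' : is_derive (f (0 *: v + x)) (1 : R) h a by rewrite scale0r add0r.
have /is_deriveP := @is_derive1_comp _ h (fun t : R => f (t *: v + x)) 0 _ _ dh' dl.
rewrite (_ : (fun h0 : R => _) = (fun t : R => t^-1 *: (h (f (t *: v + x)) - h (f x)))); first by rewrite mulrC.
by apply/funext => t; rewrite /= scaler1 addr0 scale0r add0r.
Qed.
End Calculus.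

Section RealCalculus.
Context {R : realType}.
Implicit Types (f g : R -> R) (t x : R).

Lemma der_id x : is_derive x (1 : R) (fun y : R => y) 1.
Proof. exact: is_derive_id. Qed.

Lemma der_inv x : x != 0 -> is_derive x (1 : R) (fun y : R => y^-1) (- x ^- 2).
Proof.
move=> x0; have := @is_deriveV R id x 1 1 x0 (der_id x).
by move=> /der_eq; apply; rewrite /GRing.scale/= mulr1.
Qed.

Lemma der_exp x : is_derive x (1 : R) expR (expR x).
Proof. exact: is_derive_expR. Qed.

Lemma der_powR (a x : R) : 0 < x ->
  is_derive x (1 : R) (fun y => y `^ a) (a * x `^ (a - 1)).
Proof. by move=> x0; exact: is_derive1_powR. Qed.

Lemma der_ge0_le f (df : R -> R) (a b : R) : a <= b ->
  (forall t, a <= t <= b -> {for t, continuous f}) ->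
  (forall t, a < t < b -> is_derive t (1 : R) f (df t)) ->
  (forall t, a < t < b -> 0 <= df t) -> f a <= f b.
Proof.
rewrite le_eqVlt => /orP[/eqP->//|ab] cf Df df0.
have Df' t : t \in `]a, b[%R -> is_derive t (1 : R) f (df t).
  by rewrite in_itv/=; exact: Df.
have cf' : {within `[a, b], continuous f}.
  by apply: continuous_in_subspaceT => t; rewrite inE/= in_itv/=; exact: cf.
have [c] := MVT ab Df' cf'.
rewrite in_itv/= => cab E; rewrite -subr_ge0 E mulr_ge0//; first exact: df0.
by rewrite subr_ge0 ltW.
Qed.

(** Continuous induction on an interval, in place of an argument at the first
    zero: at the infimum of the set where f <= 0, all earlier values are positive. *)
Lemma positive_continuation f (a b : R) :
  (forall t, a <= t <= b -> {for t, continuous f}) -> 0 < f a ->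
  (forall t, a < t <= b -> (forall r, a <= r < t -> 0 < f r) -> 0 < f t) ->
  forall t, a <= t <= b -> 0 < f t.
Proof.
move=> cf fa step t0 t0ab; rewrite ltNge; apply/negP => ft0.
pose S := [set t | a <= t <= b /\ f t <= 0].
have S0 : S !=set0 by exists t0.
have lS : has_lbound S by exists a => t [/andP[]].
pose m := inf S.
have am : a <= m by apply: lb_le_inf => // t [/andP[]].
have mt0 : m <= t0 by apply: ge_inf.
have mab : a <= m <= b by case/andP: t0ab => _ t0b; rewrite am (le_trans mt0).
have fm : 0 < f m.
  have := am; rewrite le_eqVlt => /orP[/eqP<-//|am'].
  apply: step; first by rewrite am'; case/andP: mab.
  move=> r /andP[ar rm]; rewrite ltNge; apply/negP => fr.
  suff : m <= r by rewrite leNgt rm.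
  by apply: ge_inf => //; split=> //; rewrite ar (le_trans (ltW rm))//; case/andP: mab.
have /nbhs_ballP[e /= e0 He] : \forall t \near m, 0 < f t.
  exact: (cvgr_gt _ (cf _ mab)).
have [r [rab fr] re] := inf_adherent e0 (conj S0 lS).
have mr : m <= r by apply: ge_inf.
have : 0 < f r.
  by apply: He; rewrite /ball/= distrC ger0_norm ?subr_ge0// ltrBlDl.
by rewrite ltNge fr.
Qed.

End RealCalculus.

(** * A Riccati inequality *)

Section Riccati.
Context {R : realType}.
Implicit Types t : R.

(** The hypotheses give b' >= c t^(-(p-1)a) b^p: the weight th enters N with the
    power 1 and b^p with the power p, and th V <= Cv t^a compensates the difference.
    Hence b^(1-p) + (p-1) c Q is nonincreasing. Leaving the primitive Q arbitrary
    covers the powers and the logarithm at once. *)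
Lemma weighted_riccati (p a Cv D T1 : R) (b db th N P V Q : R -> R) :
  1 < p -> 0 < Cv -> 0 < D -> 1 < T1 ->
  (forall t, 1 <= t <= T1 -> {for t, continuous b}) ->
  (forall t, 1 < t < T1 -> is_derive t (1 : R) b (db t)) ->
  (forall t, 1 <= t <= T1 -> b t = th t * P t /\ 0 < th t /\ 0 < P t) ->
  (forall t, 1 < t < T1 -> [/\ th t * N t <= db t, 0 < V t,
     th t * V t <= Cv * t `^ a & V t `^ (1 - p) * (P t / D) `^ p <= N t]) ->
  (forall t, 0 < t -> is_derive t (1 : R) Q (t `^ (- ((p - 1) * a)))) ->
  Q T1 - Q 1 <= Cv `^ (p - 1) * D `^ p / (p - 1) * b 1 `^ (1 - p).
Proof.
move=> p1 Cv0 D0 T11 cb Db bE H DQ.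
have b0 t : 1 <= t <= T1 -> 0 < b t.
  by move=> /bE[-> [? ?]]; exact: mulr_gt0.
pose c := Cv `^ (1 - p) * D `^ (- p).
have c0 : 0 < c by rewrite mulr_gt0// powR_gt0.
have p10 : 0 < p - 1 by rewrite subr_gt0.
have key t : 1 < t < T1 -> c * t `^ (- ((p - 1) * a)) * b t `^ p <= db t.
  move=> t1; have t1' : 1 <= t <= T1 by case/andP: t1 => /ltW-> /ltW->.
  have [bt [th0 P0]] := bE _ t1'; have [dbt V0 thV Nt] := H _ t1.
  have t0 : 0 < t by case/andP: t1 => u _; exact: lt_trans u.
  apply: le_trans dbt; apply: (@le_trans _ _ (th t * (V t `^ (1 - p) * (P t / D) `^ p))); last first.
    by rewrite ler_pM2l.
  have E : th t * (V t `^ (1 - p) * (P t / D) `^ p) = (th t * V t) `^ (1 - p) * D `^ (- p) * b t `^ p.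
    rewrite bt !powRM ?invr_ge0 ?ltW// -[D^-1]powR_inv1 ?ltW// -powRrM mulN1r.
    rewrite -[X in X * (V t `^ _ * _) = _](powRr1 (ltW th0)).
    have -> : th t `^ 1 = th t `^ (1 - p) * th t `^ p.
      by rewrite -powRD ?subrK// gt_eqF ?implybT.
    ring.
  rewrite E /c ler_pM2r ?powR_gt0 ?b0// mulrAC ler_pM2r ?powR_gt0//.
  have -> : t `^ (- ((p - 1) * a)) = (t `^ a) `^ (1 - p).
    by rewrite -powRrM; congr (_ `^ _); ring.
  rewrite -powRM ?powR_ge0 ?(ltW Cv0)//.
  rewrite (_ : 1 - p = - (p - 1)); last by ring.
  rewrite !powRN lef_pV2 ?posrE ?powR_gt0 ?mulr_gt0 ?powR_gt0//.
  apply: ge0_ler_powR => //; rewrite ?nnegrE; apply: ltW => //.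
    exact: mulr_gt0.
  by rewrite mulr_gt0 ?powR_gt0.
(* The function whose monotonicity is the integrated inequality. *)
pose h t := - (b t `^ (1 - p)) - ((p - 1) * c) * Q t.
have : h 1 <= h T1.
  apply: (@der_ge0_le _ h (fun t => - ((1 - p) * b t `^ (1 - p - 1) * db t) -
      (0 * Q t + ((p - 1) * c) * t `^ (- ((p - 1) * a)))) _ _ (ltW T11)).
  - move=> t t1; have t0 : 0 < t by case/andP: t1 => u _; exact: lt_le_trans u.
    apply: cvgB.
      apply: cvgN; apply: (@continuous_comp _ _ _ b (fun y => y `^ (1 - p))); first exact: cb.
      exact: is_derive1_continuous (der_powR _ (b0 _ t1)).
    by apply: cvgM; [exact: cvg_cst|exact: is_derive1_continuous (DQ _ t0)].
  - move=> t t1; have t1' : 1 <= t <= T1 by case/andP: t1 => /ltW-> /ltW->.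
    have t0 : 0 < t by case/andP: t1 => u _; exact: lt_trans u.
    apply: der_sub.
      by apply: der_opp; apply: der_comp (der_powR _ (b0 _ t1')) (Db _ t1).
    exact: der_mul (der_cst _ _ _) (DQ _ t0).
  - move=> t t1; have t1' : 1 <= t <= T1 by case/andP: t1 => /ltW-> /ltW->.
    have := key _ t1; set X := t `^ _ => kt.
    have e : b t `^ (1 - p - 1) * b t `^ p = 1.
      rewrite -powRD; last by rewrite (gt_eqF (b0 _ t1')) implybT.
      by rewrite (_ : 1 - p - 1 + p = 0) ?powRr0//; ring.
    have := ler_wpM2l (powR_ge0 (b t) (1 - p - 1)) kt.
    rewrite mulrCA e mulr1 => kt'.
    have := ler_wpM2l (ltW p10) kt'; lra.
have bT : 0 <= b T1 `^ (1 - p) := powR_ge0 _ _.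
rewrite /h => hh.
have {hh} : (p - 1) * c * (Q T1 - Q 1) <= b 1 `^ (1 - p) by lra.
rewrite -ler_pdivlMl ?(mulr_gt0 p10 c0)// => /le_trans; apply.
rewrite le_eqVlt; apply/orP; left; apply/eqP; congr (_ * _).
rewrite /c !invfM -!powRN !opprK opprB; ring.
Qed.

End Riccati.

(** * Ordinary differential inequalities for the means *)

Section BlowupODE.
Context {R : realType}.
Implicit Types t r : R.

Lemma powR_continuous (a t : R) : 0 < t -> {for t, continuous (fun y : R => y `^ a)}.
Proof. by move=> t0; exact: is_derive1_continuous (der_powR _ t0). Qed.

(** The factor t^mu removes the damping: b = t^mu F1 has the derivative t^mu N, so
    that it increases from its positive initial value and the lower bound on N is
    available at all times. *)
Lemma mean_blowup (mu p e Cv T1 : R) (F1 N Q : R -> R) :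
  1 < p -> 0 < Cv -> 1 < T1 ->
  (forall t, 1 <= t <= T1 -> {for t, continuous F1}) ->
  (forall t, 1 < t < T1 -> is_derive t (1 : R) F1 (- (mu / t * F1 t) + N t)) ->
  (forall t, 1 < t < T1 -> 0 <= N t) ->
  (forall t, 1 < t < T1 -> 0 < F1 t ->
     (Cv * t `^ e) `^ (1 - p) * (F1 t / 2) `^ p <= N t) ->
  0 < F1 1 ->
  (forall t, 0 < t -> is_derive t (1 : R) Q (t `^ (- ((p - 1) * (mu + e))))) ->
  Q T1 - Q 1 <= Cv `^ (p - 1) * 2 `^ p / (p - 1) * F1 1 `^ (1 - p).
Proof.
move=> p1 Cv0 T11 cF DF N0 HN F0 DQ.
pose b t := t `^ mu * F1 t.
have Db t : 1 < t < T1 -> is_derive t (1 : R) b (t `^ mu * N t).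
  move=> t1; have t0 : 0 < t by case/andP: t1 => u _; exact: lt_trans u.
  apply: der_eq (der_mul (der_powR _ t0) (DF _ t1)) _.
  rewrite powRB ?(gt_eqF t0) ?implybT// powRr1 ?ltW//.
  by field; rewrite gt_eqF.
have cb t : 1 <= t <= T1 -> {for t, continuous b}.
  move=> t1; have t0 : 0 < t by case/andP: t1 => u _; exact: lt_le_trans u.
  by apply: cvgM; [exact: powR_continuous|exact: cF].
have b1 : b 1 = F1 1 by rewrite /b powR1 mul1r.
have bpos t : 1 <= t <= T1 -> 0 < b t.
  move=> /andP[t1 tT]; apply: (@lt_le_trans _ _ (b 1)); first by rewrite b1.
  apply: (@der_ge0_le _ b (fun t => t `^ mu * N t)) => //.
  - by move=> r /andP[r1 rt]; apply: cb; rewrite r1 (le_trans rt).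
  - by move=> r /andP[r1 rt]; apply: Db; rewrite r1 (lt_le_trans rt).
  - move=> r /andP[r1 rt]; rewrite mulr_ge0 ?powR_ge0//; apply: N0.
    by rewrite r1 (lt_le_trans rt).
have F1pos t : 1 <= t <= T1 -> 0 < F1 t.
  move=> t1; have := bpos _ t1; rewrite /b pmulr_rgt0// powR_gt0//.
  by case/andP: t1 => u _; exact: lt_le_trans u.
have two0 : (0 : R) < 2 by [].
rewrite -b1.
apply: (@weighted_riccati _ p (mu + e) Cv 2 T1 b (fun t => t `^ mu * N t)
  (fun t => t `^ mu) N F1 (fun t => Cv * t `^ e) Q) => // t t1.
  split=> //; split; last exact: F1pos.
  by case/andP: t1 => u _; rewrite powR_gt0// (lt_le_trans _ u).
have t0 : 0 < t by case/andP: t1 => u _; exact: lt_trans u.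
split => //; first by rewrite mulr_gt0// powR_gt0.
  by rewrite mulrCA powRD// (gt_eqF t0) implybT.
by apply: HN => //; apply: F1pos; case/andP: t1 => /ltW-> /ltW->.
Qed.

Section Wave.
Variables (alpha mu : R).
Hypotheses (alpha01 : 0 <= alpha < 1) (mu0 : 0 <= mu).

(** [reach] is a primitive of [speed]: a difference of its values is the distance
    covered by the characteristics between two times. *)
Definition speed t : R := t `^ (- alpha).
Definition reach t : R := t `^ (1 - alpha) / (1 - alpha).

Lemma oneBalpha_gt0 : 0 < 1 - alpha.
Proof. by case/andP: alpha01 => _; rewrite subr_gt0. Qed.

Lemma speed_gt0 t : 0 < t -> 0 < speed t.
Proof. exact: powR_gt0. Qed.

Lemma der_speed t : 0 < t ->
  is_derive t (1 : R) speed (- (alpha * speed t / t)).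
Proof.
move=> t0; apply: der_eq (der_powR _ t0) _.
by rewrite powRB ?(gt_eqF t0) ?implybT// powRr1 ?ltW// mulNr mulrA.
Qed.

Lemma der_reach t : 0 < t -> is_derive t (1 : R) reach (speed t).
Proof.
move=> t0; apply: der_eq (der_mul (der_powR _ t0) (der_cst _ _ _)) _.
rewrite mulr0 addr0 (_ : 1 - alpha - 1 = - alpha); last by ring.
by rewrite mulrAC divff ?mul1r// gt_eqF// oneBalpha_gt0.
Qed.

Lemma speed_ge_inv t : 1 <= t -> t^-1 <= speed t.
Proof.
move=> t1; have t0 : 0 < t by exact: lt_le_trans t1.
rewrite -powR_inv1 ?(ltW t0)// /speed ler_powR//.
by case/andP: alpha01 => _ /ltW; rewrite lerN2.
Qed.

Variables (T1 : R) (A A1 N : R -> R).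
Hypotheses (T1_gt1 : 1 < T1)
  (cA : forall t, 1 <= t <= T1 -> {for t, continuous A})
  (cA1 : forall t, 1 <= t <= T1 -> {for t, continuous A1})
  (DA : forall t, 1 < t < T1 -> is_derive t (1 : R) A (A1 t))
  (DA1 : forall t, 1 < t < T1 ->
     is_derive t (1 : R) A1 (speed t ^+ 2 * A t - mu / t * A1 t + N t))
  (N_ge0 : forall t, 1 < t < T1 -> 0 <= N t)
  (A_ge0 : 0 <= A 1) (A1_gt0 : 0 < A1 1) (A_le : A 1 <= A1 1).

(** As long as A1 is positive, A increases and stays nonnegative, so that t^mu A1
    is nondecreasing; hence A1 never reaches 0. *)
Lemma wave_pos t : 1 <= t <= T1 -> 0 < A1 t /\ 0 <= A t.
Proof.
have Age r : 1 <= r <= T1 -> (forall q, 1 <= q < r -> 0 < A1 q) -> 0 <= A r.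
  move=> /andP[r1 rT] H; apply: (le_trans A_ge0).
  apply: (@der_ge0_le _ A A1) => //.
  - by move=> q /andP[q1 qt]; apply: cA; rewrite q1 (le_trans qt).
  - by move=> q /andP[q1 qt]; apply: DA; rewrite q1 (lt_le_trans qt).
  - by move=> q /andP[q1 qt]; apply/ltW/H; rewrite (ltW q1).
have pos : forall t, 1 <= t <= T1 -> 0 < A1 t.
  apply: positive_continuation => // {}t /andP[t1 tT] H.
  have t0 : 0 < t by exact: lt_trans t1.
  have : t `^ mu * A1 t >= 1 `^ mu * A1 1.
    apply: (@der_ge0_le _ (fun t => t `^ mu * A1 t)
      (fun t => t `^ mu * (speed t ^+ 2 * A t + N t)) _ _ (ltW t1)).
    - move=> q /andP[q1 qt]; apply: cvgM; last by apply: cA1; rewrite q1 (le_trans qt).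
      by apply: powR_continuous; exact: lt_le_trans q1.
    - move=> q /andP[q1 qt]; have q0 : 0 < q by exact: lt_trans q1.
      have qT : 1 < q < T1 by rewrite q1 (lt_le_trans qt).
      apply: der_eq (der_mul (der_powR _ q0) (DA1 qT)) _.
      rewrite powRB ?(gt_eqF q0) ?implybT// powRr1 ?ltW//.
      by field; rewrite gt_eqF.
    - move=> q /andP[q1 qt]; rewrite mulr_ge0 ?powR_ge0// addr_ge0//.
        rewrite mulr_ge0 ?sqr_ge0//; apply: Age.
          by rewrite (ltW q1) (le_trans (ltW qt)).
        by move=> r /andP[r1 rq]; apply: H; rewrite r1 (lt_trans rq).
      by apply: N_ge0; rewrite q1 (lt_le_trans qt).
  rewrite powR1 mul1r => /(lt_le_trans A1_gt0).
  by rewrite pmulr_rgt0// powR_gt0.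
move=> tT; split; first exact: pos.
apply: Age => // q /andP[q1 qt]; apply: pos; rewrite q1 (le_trans (ltW qt))//.
by case/andP: tT.
Qed.

Let k : R := (1 + mu)^-1.

Let k_gt0 : 0 < k.
Proof. by rewrite invr_gt0 ltr_wpDr. Qed.

(** Y = A1 - k t^(-alpha) A satisfies a linear equation whose source is N plus a
    multiple of A. The choice k = 1 / (1 + mu) makes this multiple nonnegative, by
    k^2 + k mu <= 1 and 1/t <= t^(-alpha), so that Y keeps its initial sign. *)
Lemma wave_slope t : 1 <= t <= T1 -> speed t * A t <= (1 + mu) * A1 t.
Proof.
have k1 : k <= 1 by rewrite invf_le1 ?ler_wpDr// ltr_wpDr.
have kk : k ^+ 2 + k * mu <= 1.
  have e : k * (1 + mu) = 1 by rewrite mulVf// gt_eqF// ltr_wpDr.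
  have := ler_wpM2l (ltW k_gt0) k1; lra.
move=> /andP[t1 tT]; have t0 : 0 < t by exact: lt_le_trans t1.
pose h t := t `^ mu * (expR (k * reach t) * (A1 t - k * (speed t * A t))).
pose dh t := t `^ mu * (expR (k * reach t) *
  ((speed t ^+ 2 * (1 - k ^+ 2) - k * mu * speed t / t + k * alpha * speed t / t) * A t + N t)).
have : h 1 <= h t.
  apply: (@der_ge0_le _ h dh _ _ t1).
  - move=> q /andP[q1 qt]; have q0 : 0 < q by exact: lt_le_trans q1.
    have qT : 1 <= q <= T1 by rewrite q1 (le_trans qt).
    apply: cvgM; first exact: powR_continuous.
    apply: cvgM.
      apply: (@continuous_comp _ _ _ (fun t => k * reach t) expR); last exact: continuous_expR.
      by apply: cvgM; [exact: cvg_cst|exact: is_derive1_continuous (der_reach q0)].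
    apply: cvgB; first exact: cA1.
    apply: cvgM; first exact: cvg_cst.
    by apply: cvgM; [exact: powR_continuous|exact: cA].
  - move=> q /andP[q1 qt]; have q0 : 0 < q by exact: lt_trans q1.
    have qT : 1 < q < T1 by rewrite q1 (lt_le_trans qt).
    apply: der_eq (der_mul (der_powR _ q0) (der_mul
      (der_comp (der_exp _) (der_mul (der_cst k _ _) (der_reach q0)))
      (der_sub (DA1 qT) (der_mul (der_cst k _ _) (der_mul (der_speed q0) (DA qT)))))) _.
    rewrite /dh powRB ?(gt_eqF q0) ?implybT// powRr1 ?ltW//.
    by field; rewrite gt_eqF.
  - move=> q /andP[q1 qt]; have q0 : 0 < q by exact: lt_trans q1.
    have qT : 1 < q < T1 by rewrite q1 (lt_le_trans qt).
    have [_ Aq] : 0 < A1 q /\ 0 <= A q.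
      by apply: wave_pos; rewrite (ltW q1) (le_trans (ltW qt)).
    rewrite /dh mulr_ge0 ?powR_ge0// mulr_ge0 ?expR_ge0// addr_ge0//; last exact: N_ge0.
    rewrite mulr_ge0//.
    have s0 := speed_gt0 q0; have sq := speed_ge_inv (ltW q1).
    have := ler_wpM2l (ltW s0) sq => X.
    have kmu : 0 <= k * mu by rewrite mulr_ge0 ?(ltW k_gt0).
    have Y := ler_wpM2l kmu X.
    have Z : 0 <= k * alpha * speed q / q.
      case/andP: alpha01 => ? _.
      by rewrite divr_ge0 ?(ltW q0)// mulr_ge0 ?(ltW s0)// mulr_ge0 ?(ltW k_gt0).
    have W := ler_wpM2l (sqr_ge0 (speed q)) kk.
    lra.
rewrite /h powR1 mul1r => H.
have h1 : 0 <= expR (k * reach 1) * (A1 1 - k * (speed 1 * A 1)).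
  rewrite mulr_ge0 ?expR_ge0// /speed powR1 mul1r subr_ge0.
  by rewrite (le_trans _ A_le)// ler_piMl.
have := le_trans h1 H; rewrite pmulr_rge0 ?powR_gt0// pmulr_rge0 ?expR_gt0//.
rewrite subr_ge0 /k mulrC ler_pdivrMr ?ltr_wpDr// => {}H.
by rewrite [leRHS]mulrC.
Qed.

Let beta : R := (mu - alpha) / 2.
Let gam : R := beta * ((mu + alpha) / 2 - 1).
Let K : R := `|gam| * (1 + mu).

(** Up to a factor between two positive constants, the inverse of the growth
    t^(-(mu+alpha)/2) exp(reach t) of the derivative of an exponentially growing
    solution of the homogeneous equation. The term in t^(alpha-1), which tends to 0,
    is a primitive of a bound on the relative error that is left when this growth is
    factored out. *)
Definition wave_weight t : R :=
  expR (- reach t + K / (alpha - 1) * t `^ (alpha - 1)) * t `^ ((mu + alpha) / 2).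

Definition wave_ratio : R := 1 + (1 + `|beta|) * (1 + mu).

(** The combination of A1 and A for which beta cancels all terms of order
    t^(-1-alpha) in the derivative of [wave_weight t * P t]; what remains is
    gam t^(-2) A, and K t^(alpha-2) P dominates it by [wave_slope]. *)
Let P t : R := A1 t + (speed t + beta / t) * A t.

Let P_bounds t : 1 <= t <= T1 -> A1 t <= P t <= wave_ratio * A1 t.
Proof.
move=> tT; have [t1 _] := andP tT; have t0 : 0 < t by exact: lt_le_trans t1.
have [A1t At] := wave_pos tT; have sl := wave_slope tT.
have si := speed_ge_inv t1; have s0 := speed_gt0 t0.
have b1 : - 1 <= beta by rewrite /beta; have := mu0; case/andP: alpha01 => ? ? ?; lra.
have ti : 0 < t^-1 by rewrite invr_gt0.
have bt : 0 <= speed t + beta / t.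
  have := ler_wpM2r (ltW ti) b1; lra.
rewrite /P /wave_ratio lerDl mulr_ge0//=.
rewrite [leRHS]mulrDl mul1r lerD2l -[leRHS]mulrA.
apply: (@le_trans _ _ ((1 + `|beta|) * (speed t * A t))); last first.
  by rewrite ler_wpM2l ?addr_ge0.
rewrite mulrA ler_wpM2r// mulrDl mul1r lerD2l.
by rewrite (le_trans (ler_wpM2r (ltW ti) (ler_norm beta)))// ler_wpM2l.
Qed.

Lemma wave_blowup (p e Cv : R) (Q : R -> R) : 1 < p -> 0 < Cv ->
  (forall t, 1 < t < T1 -> 0 < A1 t ->
     (Cv * (expR (reach t) * t `^ e)) `^ (1 - p) * (A1 t / 2) `^ p <= N t) ->
  (forall t, 0 < t -> is_derive t (1 : R) Q
     (t `^ (- ((p - 1) * ((mu + alpha) / 2 + e))))) ->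
  Q T1 - Q 1 <= Cv `^ (p - 1) * (2 * wave_ratio) `^ p / (p - 1) *
    wave_weight 1 `^ (1 - p) * A1 1 `^ (1 - p).
Proof.
move=> p1 Cv0 HN DQ.
have r0 : 0 < wave_ratio by rewrite ltr_wpDr// mulr_ge0// addr_ge0.
have al := oneBalpha_gt0.
have w0 t : 0 < t -> 0 < wave_weight t.
  by move=> t0; rewrite mulr_gt0 ?expR_gt0 ?powR_gt0.
pose b t := wave_weight t * P t.
pose db t := wave_weight t * (N t + K * t `^ (alpha - 1) / t * P t + gam / t ^+ 2 * A t).
have Db t : 1 < t < T1 -> is_derive t (1 : R) b (db t).
  move=> t1; have t0 : 0 < t by case/andP: t1 => u _; exact: lt_trans u.
  apply: der_eq (der_mul (der_mul (der_comp (der_exp _) (der_add (der_opp (der_reach t0))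
    (der_mul (der_cst _ _ _) (der_powR (alpha - 1) t0)))) (der_powR _ t0))
    (der_add (DA1 t1) (der_mul (der_add (der_speed t0) (der_mul (der_cst _ _ _)
     (der_inv _))) (DA t1)))) _; first by rewrite gt_eqF.
  rewrite /db /wave_weight /P /gam /beta.
  rewrite [t `^ ((mu + alpha) / 2 - 1)]powRB ?(gt_eqF t0) ?implybT// powRr1 ?ltW//.
  rewrite [t `^ (alpha - 1 - 1)]powRB ?(gt_eqF t0) ?implybT// powRr1 ?ltW//.
  by field; rewrite (gt_eqF t0) -oppr_eq0 opprB gt_eqF.
have T1' : 1 <= (1 : R) <= T1 by apply/andP; split => //; exact: ltW.
have b1 : wave_weight 1 * A1 1 <= b 1.
  rewrite /b ler_pM2l ?w0//.
  by have /andP[] := P_bounds T1'.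
have W1 : 0 < wave_weight 1 * A1 1 by rewrite mulr_gt0 ?w0.
apply: (@le_trans _ _ (Cv `^ (p - 1) * (2 * wave_ratio) `^ p / (p - 1) * b 1 `^ (1 - p))); last first.
  rewrite -[leRHS]mulrA -powRM ?(ltW A1_gt0) ?(ltW (w0 _ _))//.
  rewrite ler_wpM2l//.
    by rewrite !mulr_ge0 ?powR_ge0// invr_ge0 subr_ge0 ltW.
  rewrite (_ : 1 - p = - (p - 1)); last by ring.
  rewrite !powRN lef_pV2 ?posrE ?powR_gt0//; last exact: lt_le_trans b1.
  apply: ge0_ler_powR => //; rewrite ?nnegrE ?subr_ge0; apply: ltW => //.
  exact: lt_le_trans b1.
apply: (@weighted_riccati _ p ((mu + alpha) / 2 + e) Cv (2 * wave_ratio) T1 b db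
  wave_weight N P (fun t => Cv * (expR (reach t) * t `^ e)) Q) => //.
- by rewrite mulr_gt0.
- move=> t t1; have t0 : 0 < t by case/andP: t1 => u _; exact: lt_le_trans u.
  apply: cvgM.
    apply: cvgM; last exact: powR_continuous.
    apply: (@continuous_comp _ _ _ (fun t => - reach t + K / (alpha - 1) * t `^ (alpha - 1)) expR);
      last exact: continuous_expR.
    apply: cvgD; first by apply: cvgN; exact: is_derive1_continuous (der_reach t0).
    by apply: cvgM; [exact: cvg_cst|exact: powR_continuous].
  apply: cvgD; first exact: cA1.
  apply: cvgM; last exact: cA.
  apply: cvgD; first exact: powR_continuous.
  apply: cvgM; first exact: cvg_cst.
  by apply: cvgV; [rewrite gt_eqF|exact: cvg_id].
- move=> t t1; have t0 : 0 < t by case/andP: t1 => u _; exact: lt_le_trans u.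
  split=> //; split; first exact: w0.
  have [/lt_le_trans H _] := wave_pos t1; apply: H.
  by have /andP[] := P_bounds t1.
- move=> t t1; have tT : 1 <= t <= T1 by case/andP: t1 => /ltW-> /ltW->.
  have [tgt1 _] := andP t1; have t0 : 0 < t by exact: lt_trans tgt1.
  have [A1t At] := wave_pos tT; have sl := wave_slope tT.
  have /andP[AP PA] := P_bounds tT; have s0 := speed_gt0 t0.
  split.
  + rewrite /db ler_pM2l ?w0// -addrA lerDl.
    have E : t `^ (alpha - 1) * (speed t * t) = 1.
      rewrite /speed -[X in _ * (_ * X)](powRr1 (ltW t0)) -!powRD ?(gt_eqF t0) ?implybT//.
      by rewrite (_ : alpha - 1 + (- alpha + 1) = 0) ?powRr0//; ring.
    set rho := t `^ (alpha - 1) in E *.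
    have rho0 : 0 < rho by rewrite powR_gt0.
    have K0 : 0 <= K by rewrite mulr_ge0// addr_ge0.
    have ti : 0 < t^-1 by rewrite invr_gt0.
    have h1 : K * rho / t * A1 t <= K * rho / t * P t.
      by rewrite ler_wpM2l// mulr_ge0 ?(ltW ti)// mulr_ge0 ?(ltW rho0).
    have h2 : `|gam| * A t / t ^+ 2 <= K * rho / t * A1 t.
      have := ler_wpM2l (normr_ge0 gam) sl.
      have c0 : 0 <= rho / t by rewrite mulr_ge0 ?(ltW ti) ?(ltW rho0).
      move=> /(ler_wpM2l c0); rewrite (_ : rho / t * (`|gam| * (speed t * A t)) = `|gam| * A t / t ^+ 2 * (rho * (speed t * t))); last first.
        by field; rewrite gt_eqF.
      by rewrite E mulr1 /K; lra.
    have h3 : - (`|gam| * A t / t ^+ 2) <= gam / t ^+ 2 * A t.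
      have g0 : - `|gam| <= gam by rewrite lerNl -normrN ler_norm.
      have c0 : 0 <= A t / t ^+ 2 by rewrite mulr_ge0// invr_ge0 exprn_ge0 ?ltW.
      have := ler_wpM2r c0 g0; lra.
    lra.
  + by rewrite !mulr_gt0 ?expR_gt0 ?powR_gt0.
  + rewrite /wave_weight mulrCA ler_pM2l//.
    rewrite [t `^ (_ + e)]powRD ?(gt_eqF t0) ?implybT// expRD.
    rewrite (_ : _ * _ * _ * _ = expR (- reach t) * expR (reach t) * (expR (K / (alpha - 1) * t `^ (alpha - 1)) * (t `^ ((mu + alpha) / 2) * t `^ e))); last by ring.
    rewrite -expRD addNr expR0 mul1r ler_piMl//.
      by rewrite mulr_ge0 ?powR_ge0.
    rewrite -[leRHS]expR0 ler_expR.
    rewrite mulr_le0_ge0 ?powR_ge0// mulr_ge0_le0//.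
      by rewrite mulr_ge0// addr_ge0.
    by rewrite invr_le0 subr_le0; case/andP: alpha01 => _ /ltW.
  + apply: le_trans (HN _ t1 A1t); rewrite ler_wpM2l ?powR_ge0//.
    apply: ge0_ler_powR; rewrite ?nnegrE.
    - by apply: ltW; exact: lt_trans p1.
    - rewrite divr_ge0//; first exact: le_trans (ltW A1t) AP.
      by rewrite mulr_ge0// ltW.
    - by rewrite divr_ge0// ltW.
    - rewrite invfM mulrA mulrAC ler_wpM2r//.
      by rewrite ler_pdivrMr// mulrC.
Qed.

End Wave.
End BlowupODE.

(** * Weighted volume of balls and Hoelder's inequality *)

Section Volume.
Context {R : realType}.
Implicit Types (L c d r y : R).

Lemma abs_powR_continuous (p : R) : 0 < p -> continuous (fun y : R => `|y| `^ p).
Proof.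
move=> p0 y; have [->|y0] := eqVneq y 0.
  apply/cvgrPdist_lt => e e0; apply/nbhs_ballP.
  exists (e `^ p^-1); first by rewrite /= powR_gt0.
  move=> z; rewrite /ball/= sub0r normrN => ze.
  rewrite normr0 powR0 ?gt_eqF// sub0r normrN ger0_norm ?powR_ge0//.
  have -> : e = (e `^ p^-1) `^ p by rewrite -powRrM mulVf ?gt_eqF// powRr1 ?ltW.
  by rewrite gt0_ltr_powR// nnegrE// powR_ge0.
apply: (@continuous_comp _ _ _ (fun y : R => `|y|) (fun y => y `^ p)).
  exact: norm_continuous.
by apply: powR_continuous; rewrite normr_gt0.
Qed.

(** Products of these functions of one coordinate dominate the weights on a ball;
    they decay slower than the exponentials that they replace, and arctan gives
    their integrals over an interval of any length. *)
Definition bump c d y : R := (1 + ((y - c) / d) ^+ 2)^-1.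

Lemma bump_gt0 c d y : 0 < bump c d y.
Proof. by rewrite invr_gt0 ltr_wpDr// sqr_ge0. Qed.

Lemma bump_continuous c d : continuous (bump c d).
Proof.
move=> y; apply: cvgV; first by rewrite gt_eqF// ltr_wpDr// sqr_ge0.
apply: cvgD; first exact: cvg_cst.
have h : {for y, continuous (fun y => (y - c) / d)}.
  by apply: cvgM; [apply: cvgB; [exact: cvg_id|exact: cvg_cst]|exact: cvg_cst].
under [X in X @ _]funext => z do rewrite expr2.
by rewrite expr2; apply: cvgM; exact: h.
Qed.

Lemma segint_bump L c d : 0 < L -> 0 < d -> segint L (bump c d) <= pi * d.
Proof.
move=> L0 d0.
have dF (y : R) : is_derive y (1 : R) (fun y => d * atan ((y - c) / d)) (bump c d y).
  have H : is_derive y (1 : R) (fun y : R => (y - c) / d) d^-1.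
    by apply: der_eq (der_mul (der_sub (der_id y) (der_cst c _ _)) (der_cst d^-1 _ _)) _; ring.
  apply: der_eq (der_mul (der_cst d _ _) (der_comp (is_derive1_atan _) H)) _.
  rewrite /bump; set X := (1 + _)^-1.
  by field; rewrite gt_eqF.
rewrite (segint_ftc L0 (@bump_continuous c d) dF).
have := atan_ltpi2 ((L - c) / d); have := atan_gtNpi2 ((- L - c) / d) => h1 h2.
have : atan ((L - c) / d) - atan ((- L - c) / d) <= pi by lra.
move=> /(ler_wpM2l (ltW d0)); lra.
Qed.

Lemma prod_continuous {T : topologicalType} (n : nat) (g : 'I_n -> T -> R) :
  (forall j, continuous (g j)) -> continuous (fun x => \prod_(j < n) g j x).
Proof.
move=> cg; elim: (index_enum 'I_n) => [|i s IH].
  rewrite (_ : (fun _ => _) = fun=> 1); first exact: cst_continuous.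
  by apply/funext => x; rewrite big_nil.
rewrite (_ : (fun _ => _) = fun x => g i x * \prod_(j <- s) g j x).
  by move=> x; apply: cvgM; [exact: cg|exact: IH].
by apply/funext => x; rewrite big_cons.
Qed.

Section Cube.
Context {n : nat}.
Implicit Types (x : 'rV[R]_n) (f v w W : 'rV[R]_n -> R).

Lemma coord_comp_continuous (g : R -> R) (j : 'I_n) : continuous g ->
  continuous (fun x : 'rV[R]_n => g (x 0 j)).
Proof.
move=> cg x; apply: (@continuous_comp _ _ _ (fun x : 'rV[R]_n => x 0 j) g).
  exact: coord_continuous.
exact: cg.
Qed.

Lemma enorm_sqr x r : 0 <= r -> (enorm x <= r) = (\sum_(i < n) x 0 i ^+ 2 <= r ^+ 2).
Proof.
move=> r0; have S0 : 0 <= \sum_(i < n) x 0 i ^+ 2 by apply: sumr_ge0 => i _; rewrite sqr_ge0.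
rewrite /enorm -[LHS]ler_sqr ?nnegrE ?sqrtr_ge0//.
by rewrite sqr_sqrtr.
Qed.

Lemma enorm_coord x r j : 0 <= r -> enorm x <= r -> x 0 j ^+ 2 <= r ^+ 2.
Proof.
move=> r0; rewrite enorm_sqr//; apply: le_trans.
by rewrite (bigD1 j)//= lerDl sumr_ge0// => i _; rewrite sqr_ge0.
Qed.

Lemma coord_le_enorm x j : `|x 0 j| <= enorm x.
Proof.
rewrite -ler_sqr ?nnegrE ?sqrtr_ge0// -normrX ger0_norm ?sqr_ge0//.
by apply: enorm_coord; rewrite ?sqrtr_ge0.
Qed.

Definition ball_majorant r x : R := \prod_(j < n) (2 * bump 0 r (x 0 j)).

(** On the ball each coordinate lies in [-r, r], where [bump 0 r] is at least 1/2. *)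
Lemma ball_majorant_ge1 r x : 0 < r -> enorm x <= r -> 1 <= ball_majorant r x.
Proof.
move=> r0 xr; rewrite /ball_majorant; elim/big_ind: _ => //.
  by move=> a b a1 b1; rewrite -[1]mulr1 ler_pM.
move=> j _; rewrite /bump subr0 ler_pdivlMr ?ltr_wpDr ?sqr_ge0// mul1r.
have h : x 0 j ^+ 2 / r ^+ 2 <= 1.
  by rewrite ler_pdivrMr ?exprn_gt0// mul1r; exact: enorm_coord (ltW r0) xr.
by rewrite expr_div_n; lra.
Qed.

Lemma ball_majorant_continuous r : continuous (ball_majorant r).
Proof.
apply: prod_continuous => j; apply: (@coord_comp_continuous (fun y => 2 * bump 0 r y)) => y.
by apply: cvgM; [exact: cvg_cst|exact: bump_continuous].
Qed.

Lemma prod_le_expr (F : 'I_n -> R) c (P : pred 'I_n) : (forall j, 0 <= F j <= c) ->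
  \prod_(j < n | P j) F j <= c ^+ #|P|.
Proof.
move=> Fc; rewrite -prodr_const; apply: ler_prod => j _; exact: Fc.
Qed.

Lemma cubeint_ball_majorant L r : 0 < L -> 0 < r ->
  cubeint L (ball_majorant r) <= (2 * pi * r) ^+ n.
Proof.
move=> L0 r0; rewrite /ball_majorant (@cubeint_prod _ _ _ (fun j y => 2 * bump 0 r y)); last first.
  by move=> _ y; apply: cvgM; [exact: cvg_cst|exact: bump_continuous].
rewrite -[X in _ ^+ X](card_ord n); apply: prod_le_expr => j.
rewrite (poslinZ (segint_poslin L)); last exact: bump_continuous.
apply/andP; split; last first.
  by rewrite -mulrA ler_wpM2l//; exact: segint_bump.
rewrite mulr_ge0//; apply/ltW; apply: (@segint_gt0 _ _ _ 0).
- exact: bump_continuous.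
- by move=> y; exact/ltW/bump_gt0.
- by rewrite oppr_lt0 L0.
- exact: bump_gt0.
Qed.

Variable i0 : 'I_n.

Definition cap_factor r d (j : 'I_n) : R -> R :=
  if j == i0 then fun y => 16 * expR r * bump r 1 y else bump 0 d.

(** The exponential concentrates at the cap where x_i0 is close to r, whose width
    in the other directions is d, of order sqrt r. *)
Definition cap_majorant r d x : R := \prod_(j < n) cap_factor r d j (x 0 j).

(** With z = r - x_i0, the other coordinates satisfy |x'|^2 <= 2 r z, hence
    x_i0 = r - z <= r - z/2 - |x'|^2 / (4 r). One half of the decay in z is kept for
    the direction i0, the other one is converted into decay in x'. *)
Lemma cap_majorant_ge r d x : 0 < r -> 4 * r <= d ^+ 2 -> 0 < d -> enorm x <= r ->
  expR (x 0 i0) <= cap_majorant r d x.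
Proof.
move=> r0 rd d0 xr; set z := r - x 0 i0.
have := enorm_coord i0 (ltW r0) xr; rewrite -subr_ge0 subr_sqr => zr.
have z0 : 0 <= z.
  rewrite leNgt; apply/negP => zl.
  have : z * (r + x 0 i0) < 0 by rewrite nmulr_rlt0//; move: zl; rewrite /z => zl; lra.
  by rewrite /z ltNge zr.
have sumle : \sum_(j < n | j != i0) x 0 j ^+ 2 <= 2 * r * z.
  have h := xr; rewrite (enorm_sqr _ (ltW r0)) (bigD1 i0)//= in h.
  apply: (@le_trans _ _ (z * (r + x 0 i0))); first by rewrite /z; lra.
  by rewrite mulrC ler_wpM2r//; move: z0; rewrite /z => z0; lra.
have E1 : expR (- (z / 2)) <= 16 * bump r 1 (x 0 i0).
  rewrite expRN /bump divr1 -[16]invrK -invfM lef_pV2 ?posrE ?expR_gt0//; last first.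
    by rewrite mulr_gt0 ?invr_gt0// ltr_wpDr// sqr_ge0.
  have h : 1 + z / 4 <= expR (z / 4) by exact: expR_ge1Dx.
  have h1 : 0 <= 1 + z / 4 by lra.
  have := ler_pM h1 h1 h h; rewrite -expRD (_ : z / 4 + z / 4 = z / 2); last by lra.
  apply: le_trans; rewrite -[x 0 i0 - r]opprB sqrrN -/z; lra.
have E2 : expR (- (z / 2)) <= \prod_(j < n | j != i0) bump 0 d (x 0 j).
  apply: (@le_trans _ _ (\prod_(j < n | j != i0) expR (- (x 0 j / d) ^+ 2))).
    rewrite -expR_sum ler_expR sumrN lerN2.
    under eq_bigr do rewrite expr_div_n.
    rewrite -mulr_suml ler_pdivrMr ?exprn_gt0// (le_trans sumle)//.
    have := ler_wpM2l z0 rd; lra.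
  apply: ler_prod => j _; rewrite expR_ge0/= expRN /bump subr0.
  by rewrite lef_pV2 ?posrE ?expR_gt0 ?ltr_wpDr ?sqr_ge0//; exact: expR_ge1Dx.
rewrite /cap_majorant (bigD1 i0)//= {1}/cap_factor eqxx.
rewrite (eq_bigr (fun j => bump 0 d (x 0 j))); last first.
  by move=> j ji; rewrite /cap_factor (negbTE ji).
have -> : expR (x 0 i0) = expR r * (expR (- (z / 2)) * expR (- (z / 2))).
  by rewrite -!expRD; congr expR; rewrite /z; lra.
have := ler_wpM2l (expR_ge0 r) (ler_pM (expR_ge0 _) (expR_ge0 _) E1 E2); lra.
Qed.

Lemma cap_factor_continuous r d j : continuous (cap_factor r d j).
Proof.
rewrite /cap_factor; case: ifP => _ y; last exact: bump_continuous.
by apply: cvgM; [exact: cvg_cst|exact: bump_continuous].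
Qed.

Lemma cap_majorant_continuous r d : continuous (cap_majorant r d).
Proof.
apply: prod_continuous => j; apply: coord_comp_continuous.
exact: cap_factor_continuous.
Qed.

Lemma cubeint_cap_majorant L r d : 0 < L -> 0 < d ->
  cubeint L (cap_majorant r d) <= 16 * expR r * pi * (pi * d) ^+ n.-1.
Proof.
move=> L0 d0; rewrite /cap_majorant cubeint_prod; last first.
  by move=> j; exact: cap_factor_continuous.
have seg0 c e : 0 < e -> 0 <= segint L (bump c e).
  move=> e0; apply/ltW; apply: (@segint_gt0 _ _ _ 0).
  - exact: bump_continuous.
  - by move=> y; exact/ltW/bump_gt0.
  - by rewrite oppr_lt0 L0.
  - exact: bump_gt0.
rewrite (bigD1 i0)//= {1}/cap_factor eqxx (poslinZ (segint_poslin L)); last exact: bump_continuous.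
apply: ler_pM.
- by rewrite !mulr_ge0 ?expR_ge0 ?seg0.
- apply: prodr_ge0 => j ji; rewrite /cap_factor (negbTE ji); exact: seg0.
- rewrite ler_wpM2l ?mulr_ge0 ?expR_ge0//.
  by rewrite -[leRHS]mulr1; exact: segint_bump.
rewrite (eq_bigr (fun _ => segint L (bump 0 d))); last first.
  by move=> j ji; rewrite /cap_factor (negbTE ji).
apply: le_trans (prod_le_expr (c := pi * d) _ _) _.
  by move=> j; rewrite seg0//= segint_bump.
by rewrite cardC1 card_ord.
Qed.

(** Hoelder's inequality on the support of v, where W dominates the weight w. It
    is read off pointwise from s <= a + a^(1-p) s^p with a = B / (2 V). *)
Lemma cubeint_hoelder L p (V : R) v w W : 1 < p -> 0 < V ->
  continuous v -> continuous w -> continuous W ->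
  (forall x, 0 <= w x) -> (forall x, 0 <= W x) ->
  (forall x, v x != 0 -> w x <= W x) -> cubeint L W <= V ->
  0 < cubeint L (fun x => v x * w x) ->
  V `^ (1 - p) * (cubeint L (fun x => v x * w x) / 2) `^ p <=
  cubeint L (fun x => `|v x| `^ p * w x).
Proof.
move=> p1 V0 cv cw cW w0 W0 vw WV; set B := cubeint _ _ => B0.
set N := cubeint _ _.
have p0 : 0 < p by exact: lt_trans p1.
have p10 : 0 < p - 1 by rewrite subr_gt0.
pose a := B / 2 / V.
have a0 : 0 < a by rewrite !divr_gt0.
have cvp : continuous (fun x => `|v x| `^ p * w x).
  apply: contT_mul => //; apply: (contT_comp (h := fun y : R => `|y| `^ p)) => //.
  exact: abs_powR_continuous.
have cvw : continuous (fun x => v x * w x) by exact: contT_mul.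
have caW : continuous (fun x => a * W x).
  by apply: contT_mul => //; exact: contT_cst.
have [lin le] := @cubeint_poslin R n L.
have : B <= a `^ (1 - p) * N + a * cubeint L W.
  rewrite /N -(poslinZ (cubeint_poslin L) a cW) -lin//.
  apply: le => //.
    by apply: contT_add => //; apply: contT_mul => //; exact: contT_cst.
  move=> x _; have t1 : 0 <= a `^ (1 - p) * (`|v x| `^ p * w x).
    by rewrite !mulr_ge0 ?powR_ge0.
  have t2 : 0 <= a * W x by rewrite mulr_ge0 ?(ltW a0).
  have [v0|vpos] := leP (v x) 0.
    apply: (@le_trans _ _ 0); first by rewrite mulr_le0_ge0.
    by rewrite addr_ge0.
  have [va|av] := leP (v x) a.
    apply: (@le_trans _ _ (a * W x)); last by rewrite lerDr.
    by apply: ler_pM => //; [exact: ltW|apply: vw; rewrite gt_eqF].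
  apply: (@le_trans _ _ (a `^ (1 - p) * (`|v x| `^ p * w x))); last by rewrite lerDl.
  rewrite mulrA ler_wpM2r// gtr0_norm//.
  rewrite -(mulr_powRB1 (ltW vpos) p0) mulrCA ler_pMr//.
  rewrite (_ : 1 - p = - (p - 1)); last by ring.
  rewrite powRN mulrC ler_pdivlMr ?powR_gt0// mul1r.
  by apply: ge0_ler_powR; rewrite ?nnegrE ?(ltW p10) ?(ltW a0) ?(ltW vpos) ?(ltW av).
move=> H; have {}H : B / 2 <= a `^ (1 - p) * N.
  have : a * cubeint L W <= B / 2.
    have := ler_wpM2l (ltW a0) WV; rewrite {2}/a divfK// gt_eqF//.
  lra.
have := ler_wpM2l (powR_ge0 a (p - 1)) H.
rewrite (mulrA (a `^ (p - 1)) (a `^ (1 - p))) -powRD; last by rewrite (gt_eqF a0) implybT.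
rewrite (_ : p - 1 + (1 - p) = 0) ?powRr0 ?mul1r; last by ring.
apply: le_trans.
have B20 : 0 < B / 2 by rewrite divr_gt0.
have -> : a `^ (p - 1) = (B / 2) `^ (p - 1) * V `^ (1 - p).
  rewrite /a powRM ?invr_ge0 ?(ltW V0) ?(ltW B20)//.
  by rewrite -[V^-1]powR_inv1 ?(ltW V0)// -powRrM mulN1r opprB.
rewrite -(mulr_powRB1 (ltW B20) p0) le_eqVlt; apply/orP; left; apply/eqP.
ring.
Qed.

End Cube.
End Volume.

(** * Symmetry of second derivatives *)

Section MixedDerivatives.
Context {R : realType}.

(** The second difference of f over a small square of side h is h^2 times either
    mixed derivative at some point of the square, by two applications of the mean
    value theorem in either order. *)
Lemma mixed_partials_eq (f fs fy fsy fys : R -> R -> R) (a b d : R) : 0 < d ->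
  (forall s y : R, `|s - a| < d -> `|y - b| < d ->
     [/\ is_derive s (1 : R) (f^~ y) (fs s y),
         is_derive y (1 : R) (f s) (fy s y),
         is_derive y (1 : R) (fs s) (fsy s y) &
         is_derive s (1 : R) (fy^~ y) (fys s y)]) ->
  {for (a, b), continuous (fun z : R * R => fsy z.1 z.2)} ->
  {for (a, b), continuous (fun z : R * R => fys z.1 z.2)} ->
  fsy a b = fys a b.
Proof.
move=> d0 D c1 c2; apply/eqP; rewrite -subr_eq0 -normr_le0.
apply/ler_addgt0Pr => e e0; rewrite add0r.
have e20 : 0 < e / 2 by rewrite divr_gt0.
have /cvgrPdist_lt/(_ _ e20) H1 := c1; have /cvgrPdist_lt/(_ _ e20) H2 := c2.
have /nbhs_ballP[r /= r0 Hr] : \forall z \near (a, b),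
    `|fsy a b - fsy z.1 z.2| < e / 2 /\ `|fys a b - fys z.1 z.2| < e / 2.
  exact: filterI H1 H2.
pose h := Num.min d r / 2.
have m0 : 0 < Num.min d r by rewrite lt_min d0.
have h0 : 0 < h by rewrite divr_gt0.
have [hd hr] : h < d /\ h < r.
  have [m1 m2] : Num.min d r <= d /\ Num.min d r <= r by rewrite !ge_min !lexx orbT.
  by rewrite /h; split; lra.
have hn : `|h| < d by rewrite gtr0_norm.
have hb : `|h + b - b| < d by rewrite addrK.
have ha : `|h + a - a| < d by rewrite addrK.
have b0 : `|b - b| < d by rewrite subrr normr0.
have aa0 : `|a - a| < d by rewrite subrr normr0.
have [c ca Ec] := @MVT_around R (fun s => f s (h + b) - f s b)
  (fun s => fs s (h + b) - fs s b) a d h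
  (fun s sa => let: And4 A _ _ _ := D s (h + b) sa hb in
               let: And4 B _ _ _ := D s b sa b0 in der_sub A B) hn.
have ca' : `|c - a| < d by apply: le_lt_trans ca _.
have [c' cb Ec'] := @MVT_around R (fs c) (fsy c) b d h
  (fun y yb => let: And4 _ _ A _ := D c y ca' yb in A) hn.
have [k kb Ek] := @MVT_around R (fun y => f (h + a) y - f a y)
  (fun y => fy (h + a) y - fy a y) b d h
  (fun y yb => let: And4 _ A _ _ := D (h + a) y ha yb in
               let: And4 _ B _ _ := D a y aa0 yb in der_sub A B) hn.
have kb' : `|k - b| < d by apply: le_lt_trans kb _.
have [k' ka Ek'] := @MVT_around R (fy^~ k) (fys^~ k) a d h
  (fun s sa => let: And4 _ _ _ A := D s k sa kb' in A) hn.
have E : fsy c c' = fys k' k.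
  apply: (mulIf (lt0r_neq0 h0)); apply: (mulIf (lt0r_neq0 h0)).
  by rewrite -Ec' -Ec -Ek' -Ek; ring.
have hnr : `|h| < r by rewrite gtr0_norm.
have [A _] : `|fsy a b - fsy c c'| < e / 2 /\ `|fys a b - fys c c'| < e / 2.
  by apply: (Hr (c, c')); split; rewrite /ball/= distrC; exact: le_lt_trans hnr.
have [_ B] : `|fsy a b - fsy k' k| < e / 2 /\ `|fys a b - fys k' k| < e / 2.
  by apply: (Hr (k', k)); split; rewrite /ball/= distrC; exact: le_lt_trans hnr.
rewrite -(subrKA (fsy c c')) (le_trans (ler_normD _ _))//.
rewrite [leRHS]splitr lerD// ?(ltW A)// E distrC; exact: ltW.
Qed.

End MixedDerivatives.

(** * Functions on the space-time strip *)

Section Strip.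
Context {R : realType} {n : nat}.
Local Notation point := (R * 'rV[R]_n)%type.
Variables (T : \bar R).
Implicit Types (F : point -> R) (t r : R) (x : 'rV[R]_n) (i : 'I_n).

Lemma near_strip t : 1 < t -> (t%:E < T)%E ->
  \forall r \near t, 1 < r /\ (r%:E < T)%E.
Proof.
move=> t1 tT; near=> r; split; near: r; first exact: lt_nbhsr.
case: T tT => [T'||]//; last by move=> _; near=> r; rewrite ltry.
rewrite lte_fin => tT; near=> r; rewrite lte_fin; near: r; exact: lt_nbhsl.
Unshelve. all: end_near. Qed.

Lemma strip_interior t x : 1 < t -> (t%:E < T)%E -> (strip T)^° (t, x).
Proof.
move=> t1 tT; have := near_strip t1 tT => H.
rewrite /interior; exists ([set r | 1 < r /\ (r%:E < T)%E], setT).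
  by split => //=; exact: filterT.
by move=> [r y] /= [[r1 rT] _]; split => //=; exact: ltW.
Qed.

Lemma within_continuous_interior F t x : {within strip T, continuous F} ->
  1 < t -> (t%:E < T)%E -> {for (t, x), continuous F}.
Proof.
move=> /subspace_continuousP cF t1 tT A /= HA.
have int := strip_interior x t1 tT.
have W : \forall z \near (t, x), strip T z -> A (F z).
  exact: (cF _ (interior_subset int) A HA).
have V : \forall z \near (t, x), strip T z by exact: int.
by apply: filterS2 V W => z Tz; apply.
Qed.

Variable T1 : R.
Hypotheses (T1_ge1 : 1 <= T1) (T1T : (T1%:E < T)%E).

(** Times are clipped to [1, T1], so that a function that is continuous on the
    strip becomes continuous on the whole space-time. *)
Definition clip t : R := Num.max 1 (Num.min t T1).

Lemma clip_bounds t : 1 <= clip t <= T1.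
Proof. by rewrite /clip le_max lexx/= ge_max T1_ge1 ge_min lexx orbT. Qed.

Lemma clip_id t : 1 <= t <= T1 -> clip t = t.
Proof.
by move=> /andP[t1 tT]; rewrite /clip (min_idPl tT) (max_idPr t1).
Qed.

Lemma near_clip t : 1 < t < T1 -> \forall r \near t, clip r = r.
Proof.
move=> /andP[t1 tT]; near=> r; apply: clip_id; apply/andP; split; apply: ltW; near: r.
  exact: lt_nbhsr.
exact: lt_nbhsl.
Unshelve. all: end_near. Qed.

Lemma clip_strip t x : strip T (clip t, x).
Proof.
have /andP[t1 tT] := clip_bounds t; split => //=.
by apply: le_lt_trans T1T; rewrite lee_fin.
Qed.

Lemma clip_continuous : continuous clip.
Proof.
move=> t; apply: (@continuous_max R R (fun=> 1) (fun t => Num.min t T1)).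
  exact: cvg_cst.
by apply: (@continuous_min R R id (fun=> T1)); [exact: cvg_id|exact: cvg_cst].
Qed.

Definition clipped F (z : point) : R := F (clip z.1, z.2).

Lemma clipped_continuous F : {within strip T, continuous F} ->
  continuous (clipped F).
Proof.
move=> /subspace_continuousP cF [t x] A /= HA.
have W : \forall y \near (clip t, x), strip T y -> A (F y).
  exact: (cF (clip t, x) (clip_strip _ _) A HA).
have cg : {for (t, x), continuous (fun z : point => (clip z.1, z.2))}.
  apply: pair_continuous; last exact: cvg_snd.
  apply: (@continuous_comp _ _ _ fst clip); first exact: cvg_fst.
  exact: clip_continuous.
have V : \forall y \near (t, x), strip T (clip y.1, y.2) -> A (F (clip y.1, y.2)).
  exact: (cg _ W).
have G : \forall y \near (t, x), A (F (clip y.1, y.2)).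
  by apply: filterS V => y; apply; exact: clip_strip.
exact: G.
Qed.

Lemma clipped_slice_continuous F t : {within strip T, continuous F} ->
  1 <= t <= T1 -> continuous (fun x => F (t, x)).
Proof.
move=> cF t1.
rewrite (_ : (fun x => _) = (fun x => clipped F (t, x))); last first.
  by apply/funext => x; rewrite /clipped/= clip_id.
move=> x; apply: (@continuous_comp _ _ _ (fun x => (t, x)) (clipped F)).
  exact: pairl_continuous.
exact: clipped_continuous.
Qed.

End Strip.

Section Slices.
Context {R : realType} {n : nat}.
Local Notation point := (R * 'rV[R]_n)%type.
Variables (T : \bar R).
Implicit Types (F : point -> R) (t r : R) (x : 'rV[R]_n) (i : 'I_n).

Definition derivable_strip F (v : point) : Prop :=
  forall z, strip T z -> derivable_in (strip T) F z v.

Lemma strip_is_derive_t F t x : derivable_strip F (dir_t (R := R) (n := n)) ->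
  1 < t -> (t%:E < T)%E ->
  is_derive t (1 : R) (fun r => F (r, x)) (d_t T F (t, x)).
Proof.
move=> dF t1 tT; have int := strip_interior x t1 tT.
have dI : derivable F (t, x) dir_t.
  by rewrite -(derivable_in_interior _ _ int); apply: dF; exact: interior_subset int.
apply: is_derive_cvg; rewrite /d_t derive_in_interior//.
have := dI; rewrite /derivable /derive => /cvgP.
rewrite (_ : (fun h : R => h^-1 *: (F (h *: (1 : R) + t, x) - F (t, x))) =
  (fun h : R => h^-1 *: (F (h *: dir_t + (t, x)) - F (t, x)))); first by [].
apply/funext => h; congr (_ *: (F _ - _)).
by rewrite /dir_t /GRing.scale/= /GRing.add/= /add_pair/= scaler0 add0r.
Qed.

(** Spatial directions never leave the strip, so that the derivative restricted to
    the strip is the usual one on each time slice, including the slice t = 1. *)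
Lemma strip_is_derive_x F t x i : derivable_strip F (dir_x i) ->
  1 <= t -> (t%:E < T)%E ->
  is_derive x (delta_mx 0 i : 'rV[R]_n) (fun y => F (t, y)) (d_x T i F (t, x)).
Proof.
move=> dF t1 tT; have Tz : strip T (t, x) by split.
have E h : h *: dir_x i + (t, x) = (t, h *: delta_mx 0 i + x) :> point.
  by rewrite /dir_x /GRing.scale/= /GRing.add/= /add_pair/= scaler0 add0r.
apply: is_derive_cvg; rewrite /d_x /derive_in.
have := dF _ Tz; rewrite /derivable_in.
have W : within [set h : R | strip T (h *: dir_x i + (t, x))] 0^' = 0^'.
  rewrite (_ : [set h : R | _] = setT).
    apply/funext => P; rewrite /within/=; congr (0^' _).
    by apply/funext => h; apply/propext; split => [/(_ I)|//].
  by apply/seteqP; split => h //= _; rewrite E; split.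
rewrite W => /cvgP.
rewrite (_ : (fun h : R => h^-1 *: (F (h *: dir_x i + (t, x)) - F (t, x))) =
  (fun h : R => h^-1 *: (F (t, h *: delta_mx 0 i + x) - F (t, x))))//.
by apply/funext => h; rewrite E.
Qed.

Section SecondOrder.
Variable u : point -> R.
Hypothesis C2u : Ck_on spacetime_dirs 2 (strip T) u.

Lemma C2_dir_t : spacetime_dirs (dir_t (R := R) (n := n)).
Proof. by left. Qed.

Lemma C2_dir_x i : spacetime_dirs (dir_x (R := R) i).
Proof. by right; exists i. Qed.

Lemma C2_continuous : {within strip T, continuous u}.
Proof. by case: C2u. Qed.

Lemma C2_derivable (v : point) : spacetime_dirs v -> derivable_strip u v.
Proof. by move=> Bv; have [_ /(_ v Bv)[]] := C2u. Qed.

Lemma C2_derive_continuous (v : point) : spacetime_dirs v ->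
  {within strip T, continuous (derive_in (strip T) u v)}.
Proof. by move=> Bv; have [_ /(_ v Bv)[_ []]] := C2u. Qed.

Lemma C2_derive_derivable (v w : point) : spacetime_dirs v -> spacetime_dirs w ->
  derivable_strip (derive_in (strip T) u v) w.
Proof. by move=> Bv Bw; have [_ /(_ v Bv)[_ [_ /(_ w Bw)[]]]] := C2u. Qed.

Lemma C2_derive2_continuous (v w : point) : spacetime_dirs v -> spacetime_dirs w ->
  {within strip T, continuous (derive_in (strip T) (derive_in (strip T) u v) w)}.
Proof. by move=> Bv Bw; have [_ /(_ v Bv)[_ [_ /(_ w Bw)[_ []]]]] := C2u. Qed.

Lemma slice_plane_continuous F t x i : {for (t, x), continuous F} ->
  {for (t, 0 : R), continuous (fun z : R * R => F (z.1, z.2 *: delta_mx 0 i + x))}.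
Proof.
move=> cF.
have E : (t, x) = (t, (0 : R) *: delta_mx 0 i + x) :> point by rewrite scale0r add0r.
rewrite E in cF.
apply: (@continuous_comp _ _ _
  (fun z : R * R => (z.1, z.2 *: delta_mx 0 i + x) : point) F) => //.
apply: pair_continuous; first exact: cvg_fst.
apply: cvgD; last exact: cvg_cst.
by apply: cvgZr_tmp; exact: cvg_snd.
Qed.

Lemma C2_mixed t x i : 1 < t -> (t%:E < T)%E ->
  d_x T i (d_t T u) (t, x) = d_t T (d_x T i u) (t, x).
Proof.
move=> t1 tT; have /nbhs_ballP[d /= d0 Hd] := near_strip t1 tT.
have Hd' s : `|s - t| < d -> 1 < s /\ (s%:E < T)%E.
  by move=> st; apply: Hd; rewrite /ball/= distrC.
pose L (y : R) : 'rV[R]_n := y *: delta_mx 0 i + x.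
have := @mixed_partials_eq R (fun s y => u (s, L y)) (fun s y => d_t T u (s, L y))
  (fun s y => d_x T i u (s, L y)) (fun s y => d_x T i (d_t T u) (s, L y))
  (fun s y => d_t T (d_x T i u) (s, L y)) t 0 d d0.
rewrite /L scale0r add0r; apply.
- move=> s y st _; have [s1 sT] := Hd' _ st; split.
  + apply: strip_is_derive_t => //; exact: C2_derivable C2_dir_t.
  + apply: (@is_derive_line _ _ (fun y => u (s, y))).
    apply: strip_is_derive_x => //; last exact: ltW.
    exact: C2_derivable (C2_dir_x i).
  + apply: (@is_derive_line _ _ (fun y => d_t T u (s, y))).
    apply: strip_is_derive_x => //; last exact: ltW.
    exact: C2_derive_derivable C2_dir_t (C2_dir_x i).
  + apply: strip_is_derive_t => //.
    exact: C2_derive_derivable (C2_dir_x i) C2_dir_t.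
- apply: slice_plane_continuous; apply: within_continuous_interior t1 tT.
  exact: C2_derive2_continuous C2_dir_t (C2_dir_x i).
- apply: slice_plane_continuous; apply: within_continuous_interior t1 tT.
  exact: C2_derive2_continuous (C2_dir_x i) C2_dir_t.
Qed.

End SecondOrder.
End Slices.

(** * Cut-offs and Euclidean balls *)

Section EnergyTools.
Context {R : realType}.

Lemma poslin_sum {Y : topologicalType} (K : set Y) (Lam : (Y -> R) -> R)
    (I : finType) (f : I -> Y -> R) : positive_linear K Lam ->
  (forall i, continuous (f i)) ->
  Lam (fun y => \sum_i f i y) = \sum_i Lam (f i).
Proof.
move=> LP cf; elim: (index_enum I) => [|i s IH].
  rewrite big_nil -[RHS](poslin0 LP); congr Lam.
  by apply/funext => y; rewrite big_nil.
rewrite big_cons -IH -(poslinD LP)//.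
  by congr Lam; apply/funext => y; rewrite big_cons.
elim: s {IH} => [|j s IH].
  rewrite (_ : (fun _ => _) = fun=> 0); first exact: cst_continuous.
  by apply/funext => y; rewrite big_nil.
rewrite (_ : (fun _ => _) = fun y => f j y + \sum_(k <- s) f k y).
  exact: contT_add.
by apply/funext => y; rewrite big_cons.
Qed.

Lemma is_derive_near0 {V : normedModType R} (f : V -> R) (x v : V) (l : R) :
  is_derive x v f l -> (\forall y \near x, f y = 0) -> l = 0.
Proof.
move=> df f0; have d0 : is_derive x v f 0.
  apply: near_eq_is_derive (der_cst 0 x v).
  by apply: filterS f0 => y ->.
by rewrite -(@derive_val _ _ _ _ _ _ _ df) (@derive_val _ _ _ _ _ _ _ d0).
Qed.

Lemma der_coord {n : nat} (x : 'rV[R]_n) (i j : 'I_n) :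
  is_derive x (delta_mx 0 i : 'rV[R]_n) (fun y : 'rV[R]_n => y 0 j) (j == i)%:R.
Proof.
apply: is_derive_cvg; apply/cvgrPdist_lt => e e0; near=> h.
have h0 : h != 0 by near: h; exact: nbhs_dnbhs_neq.
rewrite !mxE eqxx/= addrK [_ *: _]mulrA mulVf// mul1r.
by rewrite subrr normr0.
Unshelve. all: end_near. Qed.

Lemma contT_sqr {X : topologicalType} (f : X -> R) : continuous f ->
  continuous (fun y => f y ^+ 2).
Proof.
move=> cf; rewrite (_ : (fun _ => _) = fun y => f y * f y); first exact: contT_mul.
by apply/funext => y; rewrite expr2.
Qed.

Lemma cont_sqr {X : topologicalType} (f : X -> R) (x : X) :
  {for x, continuous f} -> {for x, continuous (fun y => f y ^+ 2)}.
Proof.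
move=> cf; rewrite (_ : (fun _ => _) = fun y => f y * f y); first exact: cont_mul.
by apply/funext => y; rewrite expr2.
Qed.

Lemma der_sqr {V : normedModType R} (f : V -> R) (x v : V) (a : R) :
  is_derive x v f a -> is_derive x v (fun y => f y ^+ 2) (2 * f x * a).
Proof.
move=> df; rewrite (_ : (fun _ => _) = fun y => f y * f y); last first.
  by apply/funext => y; rewrite expr2.
by apply: der_eq (der_mul df df) _; ring.
Qed.

Lemma cont_uncurry {X Y : topologicalType} (F : X * Y -> R) (x : X) (y : Y) :
  {for (x, y), continuous F} ->
  {for (x, y), continuous (fun z : X * Y => F (z.1, z.2))}.
Proof.
by rewrite (_ : (fun z => F (z.1, z.2)) = F)//; apply/funext => -[].
Qed.

Lemma cont_fst {X Y : topologicalType} (f : X -> R) (x : X) (y : Y) :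
  {for x, continuous f} -> {for (x, y), continuous (fun z : X * Y => f z.1)}.
Proof.
by move=> cf; apply: (@continuous_comp _ _ _ fst f) => //; exact: cvg_fst.
Qed.

Lemma cont_snd {X Y : topologicalType} (f : Y -> R) (x : X) (y : Y) :
  {for y, continuous f} -> {for (x, y), continuous (fun z : X * Y => f z.2)}.
Proof.
by move=> cf; apply: (@continuous_comp _ _ _ snd f) => //; exact: cvg_snd.
Qed.

(** A cut-off that is only C^1, which suffices for one integration by parts. *)
Definition pos_sqr (z : R) : R := Num.max z 0 ^+ 2.

Lemma pos_sqr_ge0 z : 0 <= pos_sqr z.
Proof. exact: sqr_ge0. Qed.

Lemma der_pos_sqr z : is_derive z (1 : R) pos_sqr (2 * Num.max z 0).
Proof.
apply: is_derive_cvg; apply/cvgrPdist_lt => e e0; near=> h.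
have h0 : h != 0 by near: h; exact: nbhs_dnbhs_neq.
have he : `|h| < e by near: h; exact: dnbhs0_lt.
apply: le_lt_trans he.
(* The second derivative lies between 0 and 2 away from the kink. *)
have E : `|pos_sqr (h + z) - pos_sqr z - 2 * Num.max z 0 * h| <= h ^+ 2.
  rewrite ler_norml /pos_sqr.
  have [a|a] := leP (h + z) 0; have [b|b] := leP z 0; nra.
have scE (a b : R) : a *: (b : R^o) = a * b by [].
rewrite scaler1 scE distrC.
have -> : h^-1 * (pos_sqr (h + z) - pos_sqr z) - 2 * Num.max z 0 =
   (pos_sqr (h + z) - pos_sqr z - 2 * Num.max z 0 * h) / h by field.
have hh : `|h| * `|h| = h ^+ 2 by rewrite -normrM -expr2 ger0_norm ?sqr_ge0.
by rewrite normrM normfV ler_pdivrMr ?normr_gt0// hh.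
Unshelve. all: end_near. Qed.

Lemma pos_sqr_continuous : continuous pos_sqr.
Proof. by move=> z; exact: is_derive1_continuous (der_pos_sqr z). Qed.

Lemma max0_continuous : continuous (fun z : R => Num.max z 0).
Proof.
move=> z; apply: (@continuous_max R R id (fun=> 0)); first exact: cvg_id.
exact: cvg_cst.
Qed.

(** The triangle inequality, from the convexity of the square with the weights
    a / (a + b) and b / (a + b): in each coordinate,
    a b (v + w)^2 <= (a + b) (b v^2 + a w^2). *)
Lemma enorm_separation {n : nat} (x y : 'rV[R]_n) (a b : R) : 0 < a -> 0 < b ->
  enorm x <= a -> \sum_(j < n) (x 0 j - y 0 j) ^+ 2 <= b ^+ 2 ->
  enorm y <= a + b.
Proof.
move=> a0 b0; rewrite !enorm_sqr ?addr_ge0 ?(ltW a0) ?(ltW b0)// => xa xyb.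
have ab0 : 0 < a * b by exact: mulr_gt0.
rewrite -(ler_pM2l ab0).
have : a * b * (\sum_(j < n) y 0 j ^+ 2) <=
    (a + b) * (b * (\sum_(j < n) x 0 j ^+ 2) + a * (\sum_(j < n) (x 0 j - y 0 j) ^+ 2)).
  rewrite !mulr_sumr -big_split/= mulr_sumr; apply: ler_sum => j _.
  have := sqr_ge0 (b * x 0 j - a * (y 0 j - x 0 j)); lra.
move=> /le_trans; apply.
have ab1 : 0 <= a + b by rewrite addr_ge0 ?ltW.
have H1 := ler_wpM2l (ltW b0) xa; have H2 := ler_wpM2l (ltW a0) xyb.
have := ler_wpM2l ab1 (lerD H1 H2); lra.
Qed.

Lemma enorm_continuous {n : nat} : continuous (@enorm R n).
Proof.
have cs : continuous (fun x : 'rV[R]_n => \sum_(i < n) x 0 i ^+ 2).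
  apply: contT_sum => i; rewrite (_ : (fun _ => _) = fun x : 'rV[R]_n => x 0 i * x 0 i).
    by apply: contT_mul => x; exact: coord_continuous.
  by apply/funext => x; rewrite expr2.
apply: (contT_comp (h := @Num.sqrt R)) cs => z; exact: sqrt_continuous.
Qed.

End EnergyTools.

(** * Finite speed of propagation *)

Section EnergyDensity.
Context {R : realType} {n : nat}.

(** Here a, b, P, Q, S stand for u_t, u_tt, the gradient of u, its time derivative
    and the pure second derivatives of u, and psi = pos_sqr z is a weight supported
    in a ball whose radius w decreases at the speed sg. The left-hand side is the
    time derivative of the energy density minus the divergence of sg^2 a P psi.
    The terms where the weight is differentiated have a sign by the Cauchy-Schwarz
    inequality, because |y| <= w wherever dpsi does not vanish; the equation
    replaces b - sg^2 (sum of S) by |a|^p - (m/t) a, and the damping has a sign. *)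
Lemma energy_pointwise (a b sg w m t alpha K p z psi dpsi : R) (P Q S y : 'I_n -> R) :
  1 < p -> 0 < sg -> 0 < w -> 0 <= m -> 0 <= alpha -> 0 < t ->
  `|a| <= K ->
  b - sg ^+ 2 * \sum_i S i + m / t * a = `|a| `^ p ->
  z = w ^+ 2 - \sum_i y i ^+ 2 -> psi = pos_sqr z -> dpsi = 2 * Num.max z 0 ->
  ((a * b + sg ^+ 2 * \sum_i P i * Q i - sg * (alpha * sg / t) * \sum_i P i ^+ 2) * psi
   + (a ^+ 2 + sg ^+ 2 * \sum_i P i ^+ 2) / 2 * (dpsi * (- 2 * w * sg)))
  - sg ^+ 2 * \sum_i (Q i * P i * psi + a * S i * psi + a * P i * (dpsi * (- 2 * y i)))
  <= 2 * K `^ (p - 1) * ((a ^+ 2 + sg ^+ 2 * \sum_i P i ^+ 2) / 2 * psi).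
Proof.
move=> p1 sg0 w0 m0 al0 t0 aK pde + psiE dpsiE.
have psi0 : 0 <= psi by rewrite psiE pos_sqr_ge0.
set P2 := \sum_i P i ^+ 2; set PQ := \sum_i P i * Q i; set SS := \sum_i S i in pde *.
set Y2 := \sum_i y i ^+ 2 => zE; pose X := \sum_i P i * y i.
have P20 : 0 <= P2 by apply: sumr_ge0 => i _; exact: sqr_ge0.
have -> : \sum_i (Q i * P i * psi + a * S i * psi + a * P i * (dpsi * (- 2 * y i)))
   = PQ * psi + a * SS * psi + a * dpsi * (- 2 * X).
  rewrite !big_split/=; congr (_ + _ + _).
  - by rewrite mulr_suml; apply: eq_bigr => i _; ring.
  - by rewrite mulr_sumr mulr_suml; apply: eq_bigr => i _; ring.
  - by rewrite !mulr_sumr; apply: eq_bigr => i _; ring.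
have cs : dpsi * (2 * sg * a * X) <= dpsi * (w * (a ^+ 2 + sg ^+ 2 * P2)).
  rewrite dpsiE; have [zl|zg] := leP z 0; first by rewrite !mulr0 !mul0r.
  rewrite ler_pM2l ?mulr_gt0//.
  have Yw : Y2 <= w ^+ 2 by move: zg; rewrite zE subr_gt0 => /ltW.
  have sq : 0 <= \sum_i (sg * w * P i - a * y i) ^+ 2.
    by apply: sumr_ge0 => i _; exact: sqr_ge0.
  have E : \sum_i (sg * w * P i - a * y i) ^+ 2 =
      sg ^+ 2 * w ^+ 2 * P2 - 2 * sg * w * a * X + a ^+ 2 * Y2.
    rewrite /P2 /X /Y2 !mulr_sumr -sumrB -big_split/=.
    by apply: eq_bigr => i _; ring.
  rewrite E in sq.
  have aY := ler_wpM2l (sqr_ge0 a) Yw.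
  rewrite -(ler_pM2l w0); lra.
have src : a * (b - sg ^+ 2 * SS) <= K `^ (p - 1) * a ^+ 2.
  have K0 : 0 <= K by apply: le_trans aK; exact: normr_ge0.
  rewrite (_ : b - sg ^+ 2 * SS = `|a| `^ p - m / t * a); last by rewrite -pde; ring.
  have t1 : 0 <= m / t * a ^+ 2.
    by rewrite mulr_ge0 ?sqr_ge0// divr_ge0 ?(ltW t0).
  have t2 : a * `|a| `^ p <= K `^ (p - 1) * a ^+ 2.
    apply: (@le_trans _ _ (`|a| * `|a| `^ p)).
      by rewrite ler_wpM2r ?powR_ge0 ?ler_norm.
    rewrite -(mulr_powRB1 (normr_ge0 a)); last by exact: lt_trans p1.
    rewrite mulrA mulrC -expr2 -normrX [`|a ^+ 2|]ger0_norm ?sqr_ge0//.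
    rewrite ler_wpM2r ?sqr_ge0//.
    by apply: ge0_ler_powR; rewrite ?nnegrE ?normr_ge0// subr_ge0 ltW.
  lra.
have damp : 0 <= sg * (alpha * sg / t) * P2 * psi.
  by rewrite mulr_ge0// mulr_ge0// mulr_ge0 ?(ltW sg0)// divr_ge0 ?(ltW t0)// mulr_ge0 ?(ltW sg0).
have pot : 0 <= K `^ (p - 1) * (sg ^+ 2 * P2) * psi.
  by rewrite mulr_ge0// mulr_ge0 ?powR_ge0// mulr_ge0 ?sqr_ge0.
have H1 := ler_wpM2r psi0 src.
have H2 := ler_wpM2l (ltW sg0) cs.
lra.
Qed.

End EnergyDensity.

Section FiniteSpeed.
Context {R : realType} {n : nat}.
Local Notation point := (R * 'rV[R]_n)%type.
Variables (T : \bar R) (u : point -> R) (alpha mu p eps rad : R).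
Variables (u0 u1 : 'rV[R]_n -> R).
Hypotheses (alpha01 : 0 <= alpha < 1) (mu0 : 0 <= mu) (p1 : 1 < p).
Hypotheses (rad0 : 0 < rad)
  (supp0 : supp u0 `<=` [set x | enorm x <= rad])
  (supp1 : supp u1 `<=` [set x | enorm x <= rad]).
Hypothesis sol : classical_solution alpha mu p eps u0 u1 T u.
Implicit Types (t r : R) (x : 'rV[R]_n) (i : 'I_n).

Let C2u : Ck_on spacetime_dirs 2 (strip T) u. Proof. by case: sol. Qed.

Let ut : point -> R := d_t T u.
Let ux i : point -> R := d_x T i u.
Let utt : point -> R := d_t T ut.
Let uxt i : point -> R := d_t T (ux i).
Let uxx i : point -> R := d_x T i (ux i).

Lemma solution_pde t x : 1 < t -> (t%:E < T)%E ->
  utt (t, x) - speed alpha t ^+ 2 * \sum_(i < n) uxx i (t, x) + mu / t * ut (t, x)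
  = `|ut (t, x)| `^ p.
Proof.
move=> t1 tT; have [_ /(_ t x t1 tT) <- _ _] := sol; congr (_ - _ * _ + _).
have t0 : 0 < t by exact: lt_trans t1.
rewrite /speed -powR_mulrn ?powR_ge0// -powRrM div1r -powRN; congr (_ `^ _).
by rewrite mulNr mulrC.
Qed.

Lemma out_of_supp (f : 'rV[R]_n -> R) x :
  supp f `<=` [set x | enorm x <= rad] -> rad < enorm x ->
  \forall y \near x, f y = 0.
Proof.
move=> sf xr; have xs : (~` supp f) x by move=> /sf/=; rewrite leNgt xr.
have op : open (~` supp f) by apply: closed_openC; exact: closed_closure.
apply: filterS (open_nbhs_nbhs (conj op xs)) => y ys; apply/eqP/negPn/negP => fy.
by apply: ys; exact: subset_closure.
Qed.

Let cut : {within strip T, continuous ut}.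
Proof. exact: C2_derive_continuous C2u _ C2_dir_t. Qed.
Let cux i : {within strip T, continuous (ux i)}.
Proof. exact: C2_derive_continuous C2u _ (C2_dir_x i). Qed.
Let cutt : {within strip T, continuous utt}.
Proof. exact: C2_derive2_continuous C2u _ _ C2_dir_t C2_dir_t. Qed.
Let cuxt i : {within strip T, continuous (uxt i)}.
Proof. exact: C2_derive2_continuous C2u _ _ (C2_dir_x i) C2_dir_t. Qed.
Let cuxx i : {within strip T, continuous (uxx i)}.
Proof. exact: C2_derive2_continuous C2u _ _ (C2_dir_x i) (C2_dir_x i). Qed.

Let Dut t x : 1 < t -> (t%:E < T)%E ->
  is_derive t (1 : R) (fun r => ut (r, x)) (utt (t, x)).
Proof.
by apply: strip_is_derive_t; exact: C2_derive_derivable C2u _ _ C2_dir_t C2_dir_t.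
Qed.
Let Duxt i t x : 1 < t -> (t%:E < T)%E ->
  is_derive t (1 : R) (fun r => ux i (r, x)) (uxt i (t, x)).
Proof.
by apply: strip_is_derive_t; exact: C2_derive_derivable C2u _ _ (C2_dir_x i) C2_dir_t.
Qed.
Let Dutx i t x : 1 < t -> (t%:E < T)%E ->
  is_derive x (delta_mx 0 i : 'rV[R]_n) (fun y => ut (t, y)) (uxt i (t, x)).
Proof.
move=> t1 tT.
have D := strip_is_derive_x x (C2_derive_derivable C2u C2_dir_t (C2_dir_x i)) (ltW t1) tT.
exact: der_eq D (C2_mixed C2u x i t1 tT).
Qed.
Let Dux i t x : 1 <= t -> (t%:E < T)%E ->
  is_derive x (delta_mx 0 i : 'rV[R]_n) (fun y => u (t, y)) (ux i (t, x)).
Proof. by apply: strip_is_derive_x; exact: C2_derivable C2u _ (C2_dir_x i). Qed.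
Let Duxx i t x : 1 <= t -> (t%:E < T)%E ->
  is_derive x (delta_mx 0 i : 'rV[R]_n) (fun y => ux i (t, y)) (uxx i (t, x)).
Proof.
by apply: strip_is_derive_x; exact: C2_derive_derivable C2u _ _ (C2_dir_x i) (C2_dir_x i).
Qed.

Section Cone.
Variables (t0 : R) (x0 : 'rV[R]_n).
Hypotheses (t01 : 1 < t0) (t0T : (t0%:E < T)%E).
Hypothesis far : rad + (reach alpha t0 - reach alpha 1) < enorm x0.

(** At time t the energy is localised in the ball of radius [wd t] about x0. At
    time 1 this ball lies where the data vanish; at time t0 it still contains x0. *)
Let rho : R := enorm x0 - rad.
Let wd t : R := rho - (reach alpha t - reach alpha 1).
Let dist2 x : R := \sum_(j < n) (x 0 j - x0 0 j) ^+ 2.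
Let zz t x : R := wd t ^+ 2 - dist2 x.
Let en t x : R := (ut (t, x) ^+ 2 + speed alpha t ^+ 2 * \sum_(i < n) ux i (t, x) ^+ 2) / 2
   * pos_sqr (zz t x).
Let L : R := enorm x0 + rho + 1.

Lemma reach_homo r t : 1 <= r -> r <= t -> reach alpha r <= reach alpha t.
Proof.
move=> r1 rt; rewrite /reach ler_wpM2r ?invr_ge0 ?(ltW (oneBalpha_gt0 alpha01))//.
have r0 : 0 < r by exact: lt_le_trans r1.
apply: ge0_ler_powR; rewrite ?nnegrE ?(ltW (oneBalpha_gt0 alpha01)) ?(ltW r0)//.
by apply: le_trans rt; exact: ltW.
Qed.

Let wd_gt0 t : 1 <= t <= t0 -> 0 < wd t.
Proof.
move=> /andP[t1 tt]; have := reach_homo t1 tt.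
by rewrite /wd /rho => ?; have := far; lra.
Qed.

Let wd_le t : 1 <= t -> wd t <= rho.
Proof. by move=> t1; have := reach_homo (lexx 1) t1; rewrite /wd; lra. Qed.

Let rho_gt0 : 0 < rho.
Proof.
have := @wd_gt0 1; rewrite lexx (ltW t01) => /(_ isT) h.
by apply: lt_le_trans h (wd_le (lexx _)).
Qed.

Let L_gt0 : 0 < L.
Proof. by rewrite /L; have := rho_gt0; have := sqrtr_ge0 (\sum_(i < n) x0 0 i ^+ 2); rewrite /enorm; lra. Qed.

Let zz_face t x i : 1 <= t <= t0 -> `|x 0 i| = L -> pos_sqr (zz t x) = 0.
Proof.
move=> tt xL; suff z0 : zz t x <= 0 by rewrite /pos_sqr (max_idPr z0) expr0n.
have h1 := coord_le_enorm x0 i.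
have h2 : rho <= `|x 0 i - x0 0 i|.
  have := lerB_dist (x 0 i) (x0 0 i); rewrite xL /L; lra.
have h3 : rho ^+ 2 <= (x 0 i - x0 0 i) ^+ 2.
  rewrite -[leRHS]ger0_norm ?sqr_ge0// normrX.
  by rewrite ler_sqr ?nnegrE ?(ltW rho_gt0)// (le_trans (ltW rho_gt0)).
have h4 : (x 0 i - x0 0 i) ^+ 2 <= dist2 x.
  by rewrite /dist2 (bigD1 i)//= lerDl sumr_ge0// => j _; exact: sqr_ge0.
have h5 : wd t ^+ 2 <= rho ^+ 2.
  rewrite ler_sqr ?nnegrE ?(ltW rho_gt0) ?(ltW (wd_gt0 tt))//.
  by apply: wd_le; case/andP: tt.
rewrite /zz; lra.
Qed.

Let dist2_continuous : continuous dist2.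
Proof.
apply: contT_sum => j.
rewrite (_ : (fun _ => _) = fun y : 'rV[R]_n => (y 0 j - x0 0 j) * (y 0 j - x0 0 j)); last first.
  by apply/funext => y; rewrite expr2.
have c : continuous (fun y : 'rV[R]_n => y 0 j - x0 0 j).
  by apply: contT_sub; [move=> y; exact: coord_continuous|exact: contT_cst].
exact: contT_mul.
Qed.

Let der_dist2 x i :
  is_derive x (delta_mx 0 i : 'rV[R]_n) dist2 (2 * (x 0 i - x0 0 i)).
Proof.
have := @der_sum R _ _ (fun (j : 'I_n) (y : 'rV[R]_n) => (y 0 j - x0 0 j) ^+ 2) x
  (delta_mx 0 i : 'rV[R]_n) (fun j => 2 * (x 0 j - x0 0 j) * (j == i)%:R).
move=> H; apply: der_eq (H _) _.
  move=> j; have D := der_sub (der_coord x i j) (der_cst (x0 0 j) x (delta_mx 0 i : 'rV[R]_n)).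
  rewrite (_ : (fun _ => _) = fun y : 'rV[R]_n => (y 0 j - x0 0 j) * (y 0 j - x0 0 j)); last first.
    by apply/funext => y; rewrite expr2.
  by apply: der_eq (der_mul D D) _; ring.
rewrite (bigD1 i)//= eqxx mulr1 big1 ?addr0// => j ji.
by rewrite (negbTE ji) mulr0.
Qed.

Let der_wd t : 1 < t -> is_derive t (1 : R) wd (- speed alpha t).
Proof.
move=> t1; have t0' : 0 < t by exact: lt_trans t1.
apply: der_eq (der_sub (der_cst rho _ _) (der_sub (der_reach alpha01 t0') (der_cst _ _ _))) _.
by ring.
Qed.

Let wd_continuous t : 1 <= t -> {for t, continuous wd}.
Proof.
move=> t1; have t0' : 0 < t by exact: lt_le_trans t1.
exact: is_derive1_continuous (der_sub (der_cst rho _ _) (der_sub (der_reach alpha01 t0') (der_cst _ _ _))).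
Qed.

Let cl (t : R) : R := clip t0 t.
Let t01w : 1 <= t0. Proof. exact: ltW. Qed.

Let tT t : 1 <= t <= t0 -> (t%:E < T)%E.
Proof. by move=> /andP[_ tt]; apply: le_lt_trans t0T; rewrite lee_fin. Qed.

Let cl_fst_continuous (f : R -> R) : (forall t, 1 <= t -> {for t, continuous f}) ->
  continuous (fun z : point => f (cl z.1)).
Proof.
move=> cf [t x]; apply: (cont_fst (f := fun t => f (cl t))).
apply: (@continuous_comp _ _ _ cl f); first exact: clip_continuous.
by apply: cf; case/andP: (clip_bounds t01w t).
Qed.

Let en_continuous : continuous (fun z : point => en (cl z.1) z.2).
Proof.
have sc : forall t, 1 <= t -> {for t, continuous (speed alpha)}.
  by move=> t t1; apply: powR_continuous; exact: lt_le_trans t1.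
apply: contT_mul.
  apply: contT_mul; last exact: contT_cst.
  apply: contT_add.
    by apply: contT_sqr; exact: (clipped_continuous t01w t0T cut).
  apply: contT_mul; first by apply: contT_sqr; exact: cl_fst_continuous.
  apply: contT_sum => i; apply: contT_sqr.
  exact: (clipped_continuous t01w t0T (@cux i)).
apply: (contT_comp (h := pos_sqr)); first exact: pos_sqr_continuous.
apply: contT_sub.
  by apply: contT_sqr; apply: cl_fst_continuous => t t1; exact: wd_continuous.
by move=> [t x]; exact: (cont_snd (dist2_continuous (x := x))).
Qed.

Let en_slice_continuous t : continuous (fun x => en (cl t) x).
Proof.
move=> x; apply: (@continuous_comp _ _ _ (fun x => (t, x)) (fun z : point => en (cl z.1) z.2)).
  exact: pairl_continuous.
exact: en_continuous.
Qed.

Let den t x : R :=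
  (ut (t, x) * utt (t, x) + speed alpha t ^+ 2 * \sum_(i < n) ux i (t, x) * uxt i (t, x)
    - speed alpha t * (alpha * speed alpha t / t) * \sum_(i < n) ux i (t, x) ^+ 2) * pos_sqr (zz t x)
  + (ut (t, x) ^+ 2 + speed alpha t ^+ 2 * \sum_(i < n) ux i (t, x) ^+ 2) / 2 *
    ((2 * Num.max (zz t x) 0) * (- 2 * wd t * speed alpha t)).

Let der_en t x : 1 < t -> (t%:E < T)%E ->
  is_derive t (1 : R) (fun r => en r x) (den t x).
Proof.
move=> t1 tT'; have t0' : 0 < t by exact: lt_trans t1.
have DS : is_derive t (1 : R) (fun r => \sum_(i < n) ux i (r, x) ^+ 2)
    (2 * \sum_(i < n) ux i (t, x) * uxt i (t, x)).
  rewrite mulr_sumr; apply: der_sum => i.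
  by apply: der_eq (der_sqr (Duxt i x t1 tT')) _; ring.
apply: der_eq (der_mul (der_mul (der_add (der_sqr (Dut x t1 tT'))
  (der_mul (der_sqr (der_speed alpha t0')) DS)) (der_cst 2^-1 _ _))
  (der_comp (der_pos_sqr _) (der_sub (der_sqr (der_wd t1)) (der_cst (dist2 x) _ _)))) _.
rewrite /den /zz; clearbody ut ux utt uxt uxx.
by field; rewrite gt_eqF.
Qed.

Let den_continuous t x : 1 < t -> (t%:E < T)%E ->
  {for (t, x), continuous (fun z : point => den z.1 z.2)}.
Proof.
move=> t1 tT'; have t0' : 0 < t by exact: lt_trans t1.
have w (F : point -> R) : {within strip T, continuous F} ->
    {for (t, x), continuous (fun z : point => F (z.1, z.2))}.
  by move=> cF; apply: cont_uncurry; exact: within_continuous_interior.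
have cs : {for (t, x), continuous (fun z : point => speed alpha z.1)}.
  by apply: cont_fst; exact: powR_continuous.
have cw : {for (t, x), continuous (fun z : point => wd z.1)}.
  by apply: cont_fst; exact: wd_continuous (ltW t1).
have ci : {for (t, x), continuous (fun z : point => z.1^-1)}.
  apply: (cont_fst (f := fun t => t^-1)).
  by apply: is_derive1_continuous (der_inv _); rewrite gt_eqF.
have cd : {for (t, x), continuous (fun z : point => dist2 z.2)}.
  exact: (cont_snd (dist2_continuous (x := x))).
have cz : {for (t, x), continuous (fun z : point => zz z.1 z.2)}.
  exact: (cont_sub (cont_sqr cw) cd).
have cp : {for (t, x), continuous (fun z : point => pos_sqr (zz z.1 z.2))}.
  by apply: (cont_comp (h := pos_sqr)) cz; exact: pos_sqr_continuous.
have cm : {for (t, x), continuous (fun z : point => Num.max (zz z.1 z.2) 0)}.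
  by apply: (cont_comp (h := fun z => Num.max z 0)) cz; exact: max0_continuous.
have cS : {for (t, x), continuous (fun z : point => \sum_(i < n) ux i (z.1, z.2) ^+ 2)}.
  by apply: cont_sum => i; apply: cont_sqr; exact: (w _ (@cux i)).
have cX : {for (t, x), continuous (fun z : point => \sum_(i < n) ux i (z.1, z.2) * uxt i (z.1, z.2))}.
  by apply: cont_sum => i; exact: (cont_mul (w _ (@cux i)) (w _ (@cuxt i))).
have k (c : R) : {for (t, x), continuous (fun _ : point => c)} by exact: cont_cst.
exact: (cont_add
  (cont_mul (cont_sub (cont_add (cont_mul (w _ cut) (w _ cutt)) (cont_mul (cont_sqr cs) cX))
     (cont_mul (cont_mul cs (cont_mul (cont_mul (k alpha) cs) ci)) cS)) cp)
  (cont_mul (cont_mul (cont_add (cont_sqr (w _ cut)) (cont_mul (cont_sqr cs) cS)) (k 2^-1))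
     (cont_mul (cont_mul (k 2) cm) (cont_mul (cont_mul (k (- 2)) cw) cs)))).
Qed.

(** The i-th derivative of u_t u_(x_i) psi, the i-th component of the energy flux up
    to the factor - speed^2. *)
Let dfl i t x : R :=
  uxt i (t, x) * ux i (t, x) * pos_sqr (zz t x) + ut (t, x) * uxx i (t, x) * pos_sqr (zz t x)
  + ut (t, x) * ux i (t, x) * (2 * Num.max (zz t x) 0 * (- 2 * (x 0 i - x0 0 i))).

Let zz_slice t : continuous (zz t).
Proof. by apply: contT_sub; [exact: contT_cst|exact: dist2_continuous]. Qed.

Let slice_continuous (F : point -> R) t : {within strip T, continuous F} -> 1 <= t <= t0 ->
  continuous (fun x => F (t, x)).
Proof. by move=> cF tt; exact: (clipped_slice_continuous t01w t0T cF tt). Qed.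

Let dfl_continuous i t : 1 <= t <= t0 -> continuous (dfl i t).
Proof.
move=> tt.
have S1 : continuous (fun x => ut (t, x)) := slice_continuous cut tt.
have S2 : continuous (fun x => ux i (t, x)) := slice_continuous (@cux i) tt.
have S3 : continuous (fun x => uxt i (t, x)) := slice_continuous (@cuxt i) tt.
have S4 : continuous (fun x => uxx i (t, x)) := slice_continuous (@cuxx i) tt.
have cp : continuous (fun x => pos_sqr (zz t x)).
  by apply: (contT_comp (h := pos_sqr)) => //; exact: pos_sqr_continuous.
have cm : continuous (fun x => Num.max (zz t x) 0).
  by apply: (contT_comp (h := fun z => Num.max z 0)) => //; exact: max0_continuous.
have cx : continuous (fun x : 'rV[R]_n => - 2 * (x 0 i - x0 0 i)).
  apply: contT_mul; first exact: contT_cst.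
  by apply: contT_sub; [move=> y; exact: coord_continuous|exact: contT_cst].
have c2m : continuous (fun x => 2 * Num.max (zz t x) 0).
  by apply: contT_mul cm; exact: contT_cst.
exact: (contT_add (contT_add (contT_mul (contT_mul S3 S2) cp)
  (contT_mul (contT_mul S1 S4) cp)) (contT_mul (contT_mul S1 S2) (contT_mul c2m cx))).
Qed.

Let cubeint_dfl i t : 1 < t <= t0 -> cubeint L (dfl i t) = 0.
Proof.
move=> /andP[t1 tt]; have tt' : 1 <= t <= t0 by rewrite ltW.
have tT' := tT tt'.
have cp : continuous (fun x => pos_sqr (zz t x)).
  by apply: (contT_comp (h := pos_sqr)); [exact: pos_sqr_continuous|exact: zz_slice].
apply: (@cubeint_div R n L (fun x => ut (t, x) * ux i (t, x) * pos_sqr (zz t x)) _ i L_gt0).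
- exact: (contT_mul (contT_mul (slice_continuous cut tt') (slice_continuous (@cux i) tt')) cp).
- exact: dfl_continuous.
- move=> x; apply: der_eq (der_mul (der_mul (Dutx i x t1 tT') (Duxx i x (ltW t1) tT'))
   (der_comp (der_pos_sqr _) (der_sub (der_cst (wd t ^+ 2) _ _) (der_dist2 x i)))) _.
  by rewrite /dfl /zz; ring.
- by move=> x xL; rewrite (zz_face tt' xL) mulr0.
Qed.

Let ut_bound : exists2 K, 0 <= K & forall t x, 1 <= t <= t0 -> cube L x -> `|ut (t, x)| <= K.
Proof.
have cK : compact (`[1, t0] `*` cube (n := n) L).
  by apply: compact_setX; [exact: segment_compact|exact: cube_compact].
have cf : continuous (fun z : point => `|clipped t0 ut z|).
  apply: (contT_comp (h := fun y : R => `|y|)); first exact: norm_continuous.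
  exact: (clipped_continuous t01w t0T cut).
have K0 : (`[1, t0] `*` cube (n := n) L) !=set0.
  exists (1, 0); split => /=; first by rewrite in_itv/= lexx.
  by move=> j; rewrite mxE oppr_le0 (ltW L_gt0).
have [c _ Hc] := compact_EVT_max K0 cK (continuous_subspaceT cf).
exists `|clipped t0 ut c| => // t x tt xL.
have := Hc (t, x); rewrite inE /clipped/= clip_id//; apply.
by split => //=; rewrite in_itv.
Qed.

(** The energy E vanishes at time 1, and E' <= M E by [energy_pointwise], after the
    divergence of the flux has been subtracted under the integral at no cost. Hence
    E vanishes up to t0, while its density at x0 is at least a positive multiple of
    u_t^2. *)
Lemma cone_ut0 : ut (t0, x0) = 0.
Proof.
have [K K0 HK] := ut_bound.
pose M := 2 * K `^ (p - 1).
pose E t := cubeint L (en (cl t)).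
have LP := @cubeint_poslin R n L.
have E0 t : 0 <= E t.
  rewrite -(poslin0 LP); have [_ le] := LP; apply: le => //; first exact: contT_cst.
  move=> x _; rewrite /en mulr_ge0 ?pos_sqr_ge0// divr_ge0// addr_ge0 ?sqr_ge0//.
  by rewrite mulr_ge0 ?sqr_ge0// sumr_ge0// => i _; exact: sqr_ge0.
have cE : continuous E.
  apply: (poslin_continuous LP (F := fun t x => en (cl t) x)) en_continuous.
  exact: cube_compact.
have DE t : 1 < t < t0 -> is_derive t (1 : R) E (cubeint L (den t)).
  move=> tt; have [t1 tt0] := andP tt.
  apply: (poslin_derive (F := fun t x => en (cl t) x) (G := den) LP).
  - exact: cube_compact.
  - have := near_clip tt => ncl.
    near=> r.
    have r1 : 1 < r by near: r; exact: lt_nbhsr.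
    have rt0 : r < t0 by near: r; exact: lt_nbhsl.
    split; first exact: en_slice_continuous.
    move=> x; apply: near_eq_is_derive (der_en x r1 _).
      have := near_clip (T1 := t0) (t := r); rewrite r1 rt0 => /(_ isT).
      by apply: filterS => q; rewrite /cl => ->.
    by apply: tT; rewrite !ltW.
  - by move=> x; apply: den_continuous => //; apply: tT; rewrite !ltW.
have dE t : 1 < t < t0 -> cubeint L (den t) <= M * E t.
  move=> tt; have [t1 tt0] := andP tt.
  have tt' : 1 <= t <= t0 by rewrite !ltW.
  have t0' : 0 < t by exact: lt_trans t1.
  have clt : cl t = t by exact: clip_id.
  have cden : continuous (den t).
    move=> x; apply: (@continuous_comp _ _ _ (fun x => (t, x)) (fun z : point => den z.1 z.2)).
      exact: pairl_continuous.
    by apply: den_continuous => //; exact: tT.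
  have cdf : continuous (fun x => \sum_(i < n) dfl i t x).
    by apply: contT_sum => i; exact: dfl_continuous.
  have cdf' : continuous (fun x => speed alpha t ^+ 2 * \sum_(i < n) dfl i t x).
    by apply: contT_mul => //; exact: contT_cst.
  have -> : cubeint L (den t) =
      cubeint L (fun x => den t x - speed alpha t ^+ 2 * \sum_(i < n) dfl i t x).
    rewrite (poslinB LP)// (poslinZ LP)// (poslin_sum LP); last by move=> i; exact: dfl_continuous.
    by rewrite big1 ?mulr0 ?subr0// => i _; apply: cubeint_dfl; rewrite t1 ltW.
  rewrite /E -(poslinZ LP); last exact: en_slice_continuous.
  have [_ le] := LP; apply: le.
  - exact: contT_sub.
  - by apply: contT_mul; [exact: contT_cst|exact: en_slice_continuous].
  - move=> x xL; rewrite clt.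
    apply: (@energy_pointwise R n (ut (t, x)) (utt (t, x)) (speed alpha t) (wd t) mu t alpha K p
      (zz t x) _ _ (fun i => ux i (t, x)) (fun i => uxt i (t, x)) (fun i => uxx i (t, x))
      (fun i => x 0 i - x0 0 i)) => //.
    + exact: speed_gt0.
    + exact: wd_gt0.
    + by case/andP: alpha01.
    + exact: HK.
    + by apply: solution_pde => //; exact: tT.
have E1 : E 1 = 0.
  have clt : cl 1 = 1 by apply: clip_id; rewrite lexx ltW.
  rewrite /E clt -[RHS](poslin0 LP); congr cubeint; apply/funext => x.
  have oneT : (1%:E < T)%E by apply: tT; rewrite lexx ltW.
  rewrite /en; have [z0|z0] := leP (zz 1 x) 0.
    by rewrite /pos_sqr (max_idPr z0) expr0n mulr0.
  have xr : rad < enorm x.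
    rewrite ltNge; apply/negP => xr.
    have d : dist2 x < rho ^+ 2 by move: z0; rewrite /zz /wd subrr subr0 subr_gt0.
    have rho2 : 0 < rho ^+ 2 - dist2 x by rewrite subr_gt0.
    (* A radius strictly between |x - x0| and rho, because the bound must be strict. *)
    pose b := (Num.sqrt (dist2 x) + rho) / 2.
    have d0 : 0 <= dist2 x by apply: sumr_ge0 => j _; exact: sqr_ge0.
    have sd : Num.sqrt (dist2 x) < rho.
      by rewrite -(ger0_norm (ltW rho_gt0)) -sqrtr_sqr ltr_sqrt// exprn_gt0.
    have sb : Num.sqrt (dist2 x) <= b by rewrite /b; lra.
    have br : b < rho by rewrite /b; lra.
    have b0 : 0 < b by rewrite divr_gt0// ltr_wpDl ?sqrtr_ge0.
    have db : dist2 x <= b ^+ 2.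
      rewrite -(sqr_sqrtr d0) ler_sqr ?nnegrE ?sqrtr_ge0//; exact: ltW.
    have := @enorm_separation R n x x0 rad b rad0 b0 xr db.
    by rewrite /rho in br; lra.
  have nu0 := out_of_supp supp0 xr.
  have [_ _ ini0 ini1] := sol.
  rewrite [ut (1, x)]ini1 (nbhs_singleton (out_of_supp supp1 xr)) mulr0 expr0n add0r.
  rewrite big1 ?mulr0 ?mul0r// => i _.
  rewrite (is_derive_near0 (Dux i x (lexx 1) oneT)) ?expr0n//.
  by apply: filterS nu0 => y y0; rewrite ini0 y0 mulr0.
have Et0 : E t0 <= 0.
  pose h t := - (expR (- M * t) * E t).
  have : h 1 <= h t0.
    apply: (@der_ge0_le _ h (fun t => - (expR (- M * t) * (- M) * E t + expR (- M * t) * cubeint L (den t))) _ _ t01w).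
    - move=> t _; apply: cvgN; apply: cvgM; last exact: cE.
      apply: (@continuous_comp _ _ _ (fun t => - M * t) expR); last exact: continuous_expR.
      by apply: cvgM; [exact: cvg_cst|exact: cvg_id].
    - move=> t tt; apply: der_opp; apply: der_eq (der_mul (der_comp (der_exp _)
        (der_mul (der_cst (- M) _ _) (der_id t))) (DE t tt)) _.
      by ring.
    - move=> t tt; have := ler_wpM2l (expR_ge0 (- M * t)) (dE t tt); lra.
  rewrite /h E1 mulr0 oppr0 oppr_ge0 => H.
  by rewrite -(pmulr_rle0 _ (expR_gt0 (- M * t0))).
have enge0 x : 0 <= en (cl t0) x.
  rewrite /en mulr_ge0 ?pos_sqr_ge0// divr_ge0// addr_ge0 ?sqr_ge0//.
  by rewrite mulr_ge0 ?sqr_ge0// sumr_ge0// => i _; exact: sqr_ge0.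
have clt : cl t0 = t0 by apply: clip_id; rewrite lexx t01w.
have en0 : en t0 x0 <= 0.
  rewrite leNgt; apply/negP => en_gt0.
  suff : 0 < E t0 by rewrite ltNge Et0.
  apply: (@cubeint_gt0 _ _ _ _ x0) => //; last by rewrite clt.
  move=> j; rewrite -ltr_norml.
  have h1 := coord_le_enorm x0 j.
  by apply: le_lt_trans h1 _; rewrite /L; have := rho_gt0; lra.
have w0 : 0 < wd t0 by apply: wd_gt0; rewrite lexx t01w.
have d0 : dist2 x0 = 0 by rewrite /dist2 big1// => j _; rewrite subrr expr0n.
have ps : 0 < pos_sqr (zz t0 x0).
  rewrite /zz d0 subr0 /pos_sqr (max_idPl _) ?sqr_ge0//.
  by rewrite !exprn_gt0.
move: en0; rewrite /en pmulr_lle0//.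
have S0 : 0 <= speed alpha t0 ^+ 2 * \sum_(i < n) ux i (t0, x0) ^+ 2.
  by rewrite mulr_ge0 ?sqr_ge0// sumr_ge0// => i _; exact: sqr_ge0.
move=> H; have H2 : ut (t0, x0) ^+ 2 <= 0 by lra.
by apply/eqP; rewrite -sqrf_eq0; apply/eqP/le_anti; rewrite H2 sqr_ge0.
Unshelve. all: end_near. Qed.

End Cone.
Lemma ut_out t x : 1 <= t -> (t%:E < T)%E ->
  rad + (reach alpha t - reach alpha 1) < enorm x -> ut (t, x) = 0.
Proof.
rewrite le_eqVlt => /orP[/eqP<- _|t1 tT]; last exact: cone_ut0.
rewrite subrr addr0 => xr; have [_ _ _ h] := sol.
by rewrite [ut _]h (nbhs_singleton (out_of_supp supp1 xr)) mulr0.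
Qed.

Lemma u_out t x : 1 <= t -> (t%:E < T)%E ->
  rad + (reach alpha t - reach alpha 1) < enorm x -> u (t, x) = 0.
Proof.
move=> t1 tT xr; have r1 := reach_homo (lexx 1) t1.
have u1x : u (1, x) = 0.
  have [_ _ -> _] := sol.
  by rewrite (nbhs_singleton (out_of_supp supp0 _)) ?mulr0//; lra.
pose f r := clipped t u (r, x).
have cf r : {for r, continuous f}.
  apply: (@continuous_comp _ _ _ (fun r : R => (r, x)) (clipped t u)).
    by apply: pair_continuous; [exact: cvg_id|exact: cvg_cst].
  exact: (clipped_continuous t1 tT (C2_continuous C2u)).
have Df r : 1 < r < t -> is_derive r (1 : R) f 0.
  move=> rt; have [r1' rt'] := andP rt.
  have rT : (r%:E < T)%E by apply: lt_trans tT; rewrite lte_fin.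
  have D := strip_is_derive_t x (C2_derivable C2u C2_dir_t) r1' rT.
  have e : d_t T u (r, x) = 0.
    apply: ut_out => //; first exact: ltW.
    by apply: le_lt_trans xr; have := reach_homo (ltW r1') (ltW rt'); lra.
  rewrite e in D; apply: near_eq_is_derive D.
  by apply: filterS (near_clip rt) => q; rewrite /f /clipped/= => ->.
have f1 : f 1 = 0 by rewrite /f /clipped/= clip_id ?lexx ?t1.
have <- : f t = u (t, x) by rewrite /f /clipped/= clip_id ?lexx ?t1.
apply/eqP; rewrite eq_le; apply/andP; split.
  rewrite -oppr_ge0 -[leLHS]oppr0 -[X in - X]f1.
  apply: (@der_ge0_le _ (fun r => - f r) (fun=> - 0) _ _ t1) => [r _|r rt|r _].
  - by apply: cvgN; exact: cf.
  - exact: der_opp (Df r rt).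
  - by rewrite oppr0.
by rewrite -f1; apply: (@der_ge0_le _ f (fun=> 0) _ _ t1).
Qed.

Lemma ux_out i t x : 1 <= t -> (t%:E < T)%E ->
  rad + (reach alpha t - reach alpha 1) < enorm x -> ux i (t, x) = 0.
Proof.
move=> t1 tT xr; apply: is_derive_near0 (Dux i x t1 tT) _.
have : \forall y \near x, rad + (reach alpha t - reach alpha 1) < enorm y.
  exact: (cvgr_gt _ (@enorm_continuous R n x)).
by apply: filterS => y; exact: u_out.
Qed.

(** * Weighted means of a solution *)

Section Moment.
Variables (T1 L : R) (w : 'rV[R]_n -> R) (kap : 'I_n -> R).
Hypotheses (T1_gt1 : 1 < T1) (T1T : (T1%:E < T)%E).
Hypothesis L_large : rad + (reach alpha T1 - reach alpha 1) < L.
Hypotheses (cw : continuous w) (w0 : forall x, 0 <= w x)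
  (Dw : forall x i, is_derive x (delta_mx 0 i : 'rV[R]_n) w (kap i * w x)).

Definition moment (F : point -> R) t : R := cubeint L (fun x => F (t, x) * w x).
Let cl (t : R) : R := clip T1 t.
Let T1w : 1 <= T1. Proof. exact: ltW. Qed.

Let tT t : t <= T1 -> (t%:E < T)%E.
Proof. by move=> tt; apply: le_lt_trans T1T; rewrite lee_fin. Qed.

Let L_gt0 : 0 < L.
Proof. by have := reach_homo (lexx 1) T1w; have := rad0; have := L_large; lra. Qed.

Lemma moment_continuous (F : point -> R) : {within strip T, continuous F} ->
  continuous (fun t => moment F (cl t)).
Proof.
move=> cF; apply: (poslin_continuous (@cubeint_poslin R n L)
  (F := fun t x => F (cl t, x) * w x)); first exact: cube_compact.
apply: contT_mul; first exact: (clipped_continuous T1w T1T cF).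
by move=> [t x]; exact: (cont_snd (cw (x := x))).
Qed.

Lemma moment_slice_continuous (F : point -> R) t : {within strip T, continuous F} ->
  1 <= t <= T1 -> continuous (fun x => F (t, x) * w x).
Proof.
move=> cF tt; apply: contT_mul => //.
exact: (clipped_slice_continuous T1w T1T cF tt).
Qed.

Lemma moment_derive (F Ft : point -> R) t : {within strip T, continuous F} ->
  {within strip T, continuous Ft} ->
  (forall r x, 1 < r -> (r%:E < T)%E ->
     is_derive r (1 : R) (fun r => F (r, x)) (Ft (r, x))) ->
  1 < t < T1 -> is_derive t (1 : R) (fun t => moment F (cl t)) (moment Ft t).
Proof.
move=> cF cFt DF tt; have [t1 tT1] := andP tt.
apply: near_eq_is_derive (_ : is_derive t (1 : R) (moment F) (moment Ft t)).
  by apply: filterS (near_clip tt) => r; rewrite /cl => ->.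
apply: (poslin_derive (F := fun t x => F (t, x) * w x)
  (G := fun t x => Ft (t, x) * w x) (@cubeint_poslin R n L)).
- exact: cube_compact.
- near=> r.
  have r1 : 1 < r by near: r; exact: lt_nbhsr.
  have rT1 : r < T1 by near: r; exact: lt_nbhsl.
  split; first by apply: moment_slice_continuous => //; rewrite !ltW.
  move=> x; apply: der_eq (der_mul (DF r x r1 (tT (ltW rT1))) (der_cst (w x) _ _)) _.
  by rewrite mulr0 addr0.
- move=> x.
  have c1 : {for (t, x), continuous (fun z : point => Ft (z.1, z.2))}.
    apply: cont_uncurry; apply: within_continuous_interior => //.
    exact: tT (ltW tT1).
  exact: (cont_mul c1 (cont_snd (cw (x := x)))).
Unshelve. all: end_near. Qed.

Let face t x i : 1 <= t <= T1 -> `|x 0 i| = L ->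
  rad + (reach alpha t - reach alpha 1) < enorm x.
Proof.
move=> /andP[t1 tT1] xL; have := reach_homo t1 tT1.
have h1 := coord_le_enorm x i.
by rewrite xL in h1; have := L_large; lra.
Qed.

(** Two integrations by parts, without boundary terms because u and its gradient
    vanish on the faces of the cube. *)
Lemma moment_uxx i t : 1 <= t <= T1 ->
  moment (uxx i) t = kap i ^+ 2 * moment u t.
Proof.
move=> tt; have [t1 tT1] := andP tt; have tT' := tT tT1.
have LP := @cubeint_poslin R n L.
have c0 := moment_slice_continuous (C2_continuous C2u) tt.
have c1 := moment_slice_continuous (@cux i) tt.
have c2 := moment_slice_continuous (@cuxx i) tt.
have ibp (F G : point -> R) : {within strip T, continuous F} ->
    {within strip T, continuous G} ->
    (forall x, is_derive x (delta_mx 0 i : 'rV[R]_n) (fun y => F (t, y)) (G (t, x))) ->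
    (forall x, `|x 0 i| = L -> F (t, x) = 0) ->
    moment G t = - kap i * moment F t.
  move=> cF cG D F0.
  have cFw := moment_slice_continuous cF tt; have cGw := moment_slice_continuous cG tt.
  have ckF : continuous (fun x => kap i * (F (t, x) * w x)).
    by apply: contT_mul => //; exact: contT_cst.
  have := @cubeint_div R n L (fun x => F (t, x) * w x)
    (fun x => G (t, x) * w x + kap i * (F (t, x) * w x)) i L_gt0 cFw (contT_add cGw ckF).
  rewrite (poslinD LP)// (poslinZ LP)// => H.
  rewrite /moment; have {}H := H _ _; rewrite mulNr; apply/eqP; rewrite -addr_eq0; apply/eqP/H.
    by move=> x; apply: der_eq (der_mul (D x) (Dw x i)) _; ring.
  by move=> x xL; rewrite F0 ?mul0r.
have E1 := ibp (ux i) (uxx i) (@cux i) (@cuxx i) (fun x => Duxx i x t1 tT')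
  (fun x xL => ux_out i t1 tT' (face tt xL)).
have E2 := ibp u (ux i) (C2_continuous C2u) (@cux i) (fun x => Dux i x t1 tT')
  (fun x xL => u_out t1 tT' (face tt xL)).
by rewrite E1 E2; ring.
Qed.

Definition source t : R := cubeint L (fun x => `|ut (t, x)| `^ p * w x).

Let abs_ut_continuous t : 1 <= t <= T1 ->
  continuous (fun x => `|ut (t, x)| `^ p * w x).
Proof.
move=> tt; apply: contT_mul => //.
apply: (contT_comp (h := fun y : R => `|y| `^ p)).
  by apply: abs_powR_continuous; exact: lt_trans p1.
exact: (clipped_slice_continuous T1w T1T cut tt).
Qed.

Lemma moment_utt t : 1 < t < T1 -> moment utt t =
  (\sum_(i < n) kap i ^+ 2) * speed alpha t ^+ 2 * moment u t
  - mu / t * moment ut t + source t.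
Proof.
move=> tt; have [t1 tT1] := andP tt; have tt' : 1 <= t <= T1 by rewrite !ltW.
have LP := @cubeint_poslin R n L.
have cS : continuous (fun x => \sum_(i < n) uxx i (t, x) * w x).
  by apply: contT_sum => i; exact: moment_slice_continuous (@cuxx i) tt'.
have c1 : continuous (fun x => speed alpha t ^+ 2 * \sum_(i < n) uxx i (t, x) * w x).
  by apply: contT_mul => //; exact: contT_cst.
have c2 : continuous (fun x => mu / t * (ut (t, x) * w x)).
  by apply: contT_mul; [exact: contT_cst|exact: moment_slice_continuous cut tt'].
have -> : moment utt t = cubeint L (fun x =>
    speed alpha t ^+ 2 * (\sum_(i < n) uxx i (t, x) * w x)
    - mu / t * (ut (t, x) * w x) + `|ut (t, x)| `^ p * w x).
  congr cubeint; apply/funext => x.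
  rewrite -(solution_pde x t1 (tT (ltW tT1))) -mulr_suml; ring.
have c3 := abs_ut_continuous tt'.
have cu := moment_slice_continuous cut tt'.
rewrite (poslinD LP (contT_sub c1 c2) c3) (poslinB LP c1 c2) (poslinZ LP _ cS) (poslinZ LP _ cu).
rewrite (poslin_sum LP (fun i => moment_slice_continuous (@cuxx i) tt')).
congr (_ - _ + _).
rewrite [in RHS]mulrAC mulr_suml mulrC; congr (_ * _).
by apply: eq_bigr => i _; exact: moment_uxx.
Qed.

Lemma source_ge0 t : 1 <= t <= T1 -> 0 <= source t.
Proof.
move=> tt; rewrite -(poslin0 (@cubeint_poslin R n L)).
have [_ le] := @cubeint_poslin R n L; apply: le => [||x _].
- exact: contT_cst.
- exact: abs_ut_continuous.
- by rewrite mulr_ge0 ?powR_ge0.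
Qed.

Lemma source_ge t (V : R) (W : 'rV[R]_n -> R) : 1 <= t <= T1 -> 0 < V ->
  continuous W -> (forall x, 0 <= W x) -> cubeint L W <= V ->
  (forall x, enorm x <= rad + (reach alpha t - reach alpha 1) -> w x <= W x) ->
  0 < moment ut t -> V `^ (1 - p) * (moment ut t / 2) `^ p <= source t.
Proof.
move=> tt V0 cW W0 WV wW m0; have [t1 tT1] := andP tt.
apply: (@cubeint_hoelder R n L p V (fun x => ut (t, x)) w W) => //.
  exact: (clipped_slice_continuous T1w T1T cut tt).
move=> x ux0; apply: wW; rewrite leNgt; apply/negP => xr.
by move: ux0; rewrite ut_out ?eqxx//; exact: tT.
Qed.

End Moment.

End FiniteSpeed.

(** * Bounds on the time of existence *)

Section Lifespan.
Context {R : realType} {n : nat}.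
Local Notation point := (R * 'rV[R]_n)%type.
Variables (alpha mu p rad : R) (u0 u1 : 'rV[R]_n -> R).
Hypotheses (n2 : (2 <= n)%N) (alpha01 : 0 <= alpha < 1) (mu0 : 0 <= mu) (p1 : 1 < p).
Hypotheses (cu0 : continuous u0) (cu1 : continuous u1).
Hypotheses (u1_nontriv : exists x, u1 x != 0).
Hypotheses (rad0 : 0 < rad)
  (supp0 : supp u0 `<=` [set x | enorm x <= rad])
  (supp1 : supp u1 `<=` [set x | enorm x <= rad])
  (u01 : forall x, 0 <= u0 x <= u1 x).
Implicit Types (w : 'rV[R]_n -> R) (t eps L : R) (T : \bar R).

(** Taken over a cube that depends on the data only, so that it bounds the initial
    means below uniformly in the time of existence and in eps. *)
Definition data_moment w : R := cubeint (rad + 1) (fun x => u1 x * w x).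

Lemma data_moment_gt0 w : continuous w -> (forall x, 0 < w x) -> 0 < data_moment w.
Proof.
move=> cw w0; have [x x0] := u1_nontriv.
have u10 y : 0 <= u1 y by have /andP[a b] := u01 y; exact: le_trans b.
have xr : enorm x <= rad by apply: supp1; exact: subset_closure.
apply: (@cubeint_gt0 _ _ _ _ x).
- exact: contT_mul.
- by move=> y; rewrite mulr_ge0// ltW.
- move=> j; rewrite -ltr_norml.
  have h1 := coord_le_enorm x j.
  by apply: le_lt_trans h1 _; rewrite (le_lt_trans xr)// ltrDl.
- by rewrite mulr_gt0// lt_neqAle eq_sym x0 u10.
Qed.

Lemma data_moment_le w L : continuous w -> (forall x, 0 <= w x) -> rad + 1 <= L ->
  data_moment w <= cubeint L (fun x => u1 x * w x).
Proof.
move=> cw w0 L1; apply: cubeint_widen => //; first exact: contT_mul.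
by move=> x; rewrite mulr_ge0//; have /andP[a b] := u01 x; exact: le_trans b.
Qed.

Let radius t : R := rad + (reach alpha t - reach alpha 1).

Let growth : R := rad + (1 - alpha)^-1.

Let growth_gt0 : 0 < growth.
Proof. by rewrite addr_gt0// invr_gt0 (oneBalpha_gt0 alpha01). Qed.

Let radius_le t : 1 <= t -> radius t <= growth * t `^ (1 - alpha).
Proof.
move=> t1; have al := oneBalpha_gt0 alpha01.
have h : 1 <= t `^ (1 - alpha) by rewrite -[leLHS](powRr0 t) ler_powR// ltW.
have r1 : 0 <= reach alpha 1 by rewrite /reach powR1 divr_ge0 ?(ltW al).
have h2 := ler_wpM2l (ltW rad0) h.
rewrite /radius /growth /reach in r1 *; lra.
Qed.

Let radius_ge t : 1 <= t -> rad <= radius t.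
Proof.
move=> t1; have h := reach_homo alpha01 (lexx 1) t1.
by rewrite /radius; lra.
Qed.

Let i0 : 'I_n := Ordinal (ltnW n2).

(** The spatial factor of the plane wave exp(x_1 - reach t). *)
Definition plane_weight (x : 'rV[R]_n) : R := expR (x 0 i0).

Lemma plane_weight_continuous : continuous plane_weight.
Proof. by apply: (coord_comp_continuous (g := expR)); exact: continuous_expR. Qed.

Lemma der_plane_weight (x : 'rV[R]_n) (i : 'I_n) :
  is_derive x (delta_mx 0 i : 'rV[R]_n) plane_weight ((i0 == i)%:R * plane_weight x).
Proof. by apply: der_eq (der_comp (der_exp _) (der_coord x i i0)) _; rewrite mulrC. Qed.

Definition wave_volume : R :=
  16 * expR (rad - reach alpha 1) * pi * (pi * (2 * Num.sqrt growth)) ^+ n.-1.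

Definition wave_const : R :=
  wave_volume `^ (p - 1) * (2 * wave_ratio alpha mu) `^ p / (p - 1) *
  wave_weight alpha mu 1 `^ (1 - p) * data_moment plane_weight `^ (1 - p).

Definition mean_volume : R := (2 * pi * growth) ^+ n.

Definition mean_const : R :=
  mean_volume `^ (p - 1) * 2 `^ p / (p - 1) * data_moment (fun=> 1) `^ (1 - p).

Let wave_volume_gt0 : 0 < wave_volume.
Proof.
have sg : 0 < Num.sqrt growth by rewrite sqrtr_gt0.
by rewrite mulr_gt0 ?exprn_gt0 ?mulr_gt0 ?expR_gt0 ?pi_gt0.
Qed.

Let mean_volume_gt0 : 0 < mean_volume.
Proof. by rewrite exprn_gt0 ?mulr_gt0 ?pi_gt0. Qed.

Lemma wave_const_ge0 : 0 <= wave_const.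
Proof.
rewrite /wave_const mulr_ge0 ?powR_ge0// mulr_ge0 ?powR_ge0//.
by rewrite divr_ge0 ?subr_ge0 ?(ltW p1)// mulr_ge0 ?powR_ge0.
Qed.

Lemma mean_const_ge0 : 0 <= mean_const.
Proof.
rewrite /mean_const mulr_ge0 ?powR_ge0//.
by rewrite divr_ge0 ?subr_ge0 ?(ltW p1)// mulr_ge0 ?powR_ge0.
Qed.

Section Solution.
Variables (eps : R) (T : \bar R) (u : point -> R).
Hypotheses (eps0 : 0 < eps) (sol : classical_solution alpha mu p eps u0 u1 T u).
Variable T1 : R.
Hypotheses (T1_gt1 : 1 < T1) (T1T : (T1%:E < T)%E).

Let L : R := radius T1 + 1.
Let C2u : Ck_on spacetime_dirs 2 (strip T) u. Proof. by case: sol. Qed.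

Let L_large : rad + (reach alpha T1 - reach alpha 1) < L.
Proof. by rewrite /L /radius ltrDl. Qed.

Let L_ge : rad + 1 <= L.
Proof. by rewrite /L lerD2r radius_ge// ltW. Qed.

Section Weight.
Variables (w : 'rV[R]_n -> R) (kap : 'I_n -> R).
Hypotheses (cw : continuous w) (w0 : forall x, 0 < w x)
  (Dw : forall x i, is_derive x (delta_mx 0 i : 'rV[R]_n) w (kap i * w x)).
Let w0' x : 0 <= w x. Proof. exact: ltW. Qed.

Let A t : R := moment L w u (clip T1 t).
Let A1 t : R := moment L w (d_t T u) (clip T1 t).
Let N t : R := source T u p L w t.

Lemma moment_at1 : A 1 = eps * cubeint L (fun x => u0 x * w x).
Proof.
have -> : A 1 = moment L w u 1 by rewrite /A clip_id// lexx ltW.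
rewrite -(poslinZ (cubeint_poslin L)); last exact: contT_mul.
have [_ _ ini _] := sol.
by congr cubeint; apply/funext => x; rewrite ini mulrA.
Qed.

Lemma moment_ut_at1 : A1 1 = eps * cubeint L (fun x => u1 x * w x).
Proof.
have -> : A1 1 = moment L w (d_t T u) 1 by rewrite /A1 clip_id// lexx ltW.
rewrite -(poslinZ (cubeint_poslin L)); last exact: contT_mul.
have [_ _ _ ini] := sol.
by congr cubeint; apply/funext => x; rewrite ini mulrA.
Qed.

Lemma moment_ut_lower : 0 < eps * data_moment w <= A1 1.
Proof.
rewrite moment_ut_at1 mulr_gt0 ?data_moment_gt0//= ler_pM2l//.
exact: data_moment_le.
Qed.

Lemma moment_compare : 0 <= A 1 <= A1 1.
Proof.
rewrite moment_at1 moment_ut_at1 ler_pM2l// pmulr_rge0//.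
have LP := @cubeint_poslin R n L; have [_ le] := LP.
apply/andP; split; last first.
  apply: le; [exact: contT_mul|exact: contT_mul|] => x _.
  by rewrite ler_wpM2r//; have /andP[] := u01 x.
rewrite -(poslin0 LP); apply: le; [exact: contT_cst|exact: contT_mul|] => x _.
by rewrite mulr_ge0//; have /andP[] := u01 x.
Qed.

Lemma weight_cA : continuous A.
Proof. exact: (moment_continuous (L := L) T1_gt1 T1T cw (C2_continuous C2u)). Qed.

Lemma weight_cA1 : continuous A1.
Proof.
exact: (moment_continuous (L := L) T1_gt1 T1T cw (C2_derive_continuous C2u C2_dir_t)).
Qed.

Lemma weight_DA t : 1 < t < T1 -> is_derive t (1 : R) A (A1 t).
Proof.
move=> tt; have e : A1 t = moment L w (d_t T u) t.
  by rewrite /A1 clip_id//; case/andP: tt => /ltW-> /ltW->.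
have D := moment_derive L T1_gt1 T1T cw (C2_continuous C2u)
  (C2_derive_continuous C2u C2_dir_t)
  (fun r x => strip_is_derive_t x (C2_derivable C2u C2_dir_t)) tt.
exact: (der_eq D (esym e)).
Qed.

Lemma weight_DA1 t : 1 < t < T1 -> is_derive t (1 : R) A1
  ((\sum_(i < n) kap i ^+ 2) * speed alpha t ^+ 2 * A t - mu / t * A1 t + N t).
Proof.
move=> tt; have tt' : 1 <= t <= T1 by case/andP: tt => /ltW-> /ltW->.
have e1 : A1 t = moment L w (d_t T u) t by rewrite /A1 clip_id.
have e0 : A t = moment L w u t by rewrite /A clip_id.
have D := moment_derive L T1_gt1 T1T cw (C2_derive_continuous C2u C2_dir_t)
  (C2_derive2_continuous C2u C2_dir_t C2_dir_t)
  (fun r x => strip_is_derive_t x (C2_derive_derivable C2u C2_dir_t C2_dir_t)) tt.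
have H := moment_utt alpha01 mu0 p1 rad0 supp0 supp1 sol T1_gt1 T1T L_large cw Dw tt.
rewrite e0 e1; exact: (der_eq D H).
Qed.

Lemma weight_N_ge0 t : 1 < t < T1 -> 0 <= N t.
Proof.
move=> tt; apply: (source_ge0 p1 sol L T1_gt1 T1T cw w0').
by case/andP: tt => /ltW-> /ltW->.
Qed.

Lemma weight_N_ge t (V : R) (W : 'rV[R]_n -> R) : 1 < t < T1 -> 0 < V ->
  continuous W -> (forall x, 0 <= W x) -> cubeint L W <= V ->
  (forall x, enorm x <= radius t -> w x <= W x) ->
  0 < A1 t -> V `^ (1 - p) * (A1 t / 2) `^ p <= N t.
Proof.
move=> tt V0 cW W0 WV wW; have tt' : 1 <= t <= T1 by case/andP: tt => /ltW-> /ltW->.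
have -> : A1 t = moment L w (d_t T u) t by rewrite /A1 clip_id.
exact: (source_ge alpha01 mu0 p1 rad0 supp0 supp1 sol T1_gt1 T1T cw w0' tt' V0 cW W0 WV wW).
Qed.

Lemma powR_data : A1 1 `^ (1 - p) <= data_moment w `^ (1 - p) * eps `^ (- (p - 1)).
Proof.
have /andP[d0 dA] := moment_ut_lower.
have dm := data_moment_gt0 cw w0.
rewrite -[1 - p]opprB -powRM ?(ltW dm) ?(ltW eps0)// mulrC.
rewrite !powRN lef_pV2 ?posrE ?powR_gt0//; last exact: lt_le_trans dA.
apply: ge0_ler_powR; rewrite ?nnegrE ?subr_ge0 ?(ltW p1) ?(ltW d0)//.
by apply: ltW; exact: lt_le_trans dA.
Qed.

End Weight.

(** [wave_blowup] for the plane weight: its volume on the support of u is bounded by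
    a cap of width proportional to t^((1-alpha)/2), the square root of the radius. *)
Lemma wave_estimate (Q : R -> R) :
  (forall t, 0 < t -> is_derive t (1 : R) Q
    (t `^ (- (((1 - alpha) * (n%:R - 1) + mu + alpha) * (p - 1) / 2)))) ->
  Q T1 - Q 1 <= wave_const * eps `^ (- (p - 1)).
Proof.
move=> DQ; have al := oneBalpha_gt0 alpha01.
have cw := plane_weight_continuous; have Dw := der_plane_weight.
have w0 x : 0 < plane_weight x by exact: expR_gt0.
have DA1 t : 1 < t < T1 -> is_derive t (1 : R)
    (fun t => moment L plane_weight (d_t T u) (clip T1 t))
    (speed alpha t ^+ 2 * moment L plane_weight u (clip T1 t)
     - mu / t * moment L plane_weight (d_t T u) (clip T1 t)
     + source T u p L plane_weight t).
  have S : \sum_(i < n) (i0 == i)%:R ^+ 2 = 1 :> R.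
    rewrite (bigD1 i0) // eqxx expr1n big1 => [|i ii]; first exact: addr0.
    by rewrite eq_sym (negbTE ii) expr0n.
  by move=> tt; have := weight_DA1 cw Dw tt; rewrite S mul1r.
have /andP[A0 A01] := moment_compare cw w0.
have /andP[d0 dA] := moment_ut_lower cw w0.
have A1pos := lt_le_trans d0 dA.
have DQ' t : 0 < t -> is_derive t (1 : R) Q
    (t `^ (- ((p - 1) * ((mu + alpha) / 2 + (1 - alpha) / 2 * n.-1%:R)))).
  move=> t0; apply: der_eq (DQ t t0) _; congr (_ `^ _).
  have -> : n.-1%:R = n%:R - 1 :> R by rewrite -subn1 natrB// ltnW.
  by field.
have HN t : 1 < t < T1 -> 0 < moment L plane_weight (d_t T u) (clip T1 t) ->
    (wave_volume * (expR (reach alpha t) * t `^ ((1 - alpha) / 2 * n.-1%:R))) `^ (1 - p) *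
    (moment L plane_weight (d_t T u) (clip T1 t) / 2) `^ p
    <= source T u p L plane_weight t.
  move=> tt; have [t1 tT1] := andP tt; have t0 : 0 < t by exact: lt_trans t1.
  pose d := 2 * Num.sqrt growth * t `^ ((1 - alpha) / 2).
  have sg : 0 < Num.sqrt growth by rewrite sqrtr_gt0.
  have dpos : 0 < d by rewrite !mulr_gt0 ?powR_gt0.
  have L0 : 0 < L by have := L_ge; have := rad0; lra.
  have r0 : 0 < radius t by apply: lt_le_trans rad0 (radius_ge (ltW t1)).
  have dr : 4 * radius t <= d ^+ 2.
    have -> : d ^+ 2 = 4 * (growth * t `^ (1 - alpha)).
      rewrite /d !exprMn sqr_sqrtr ?(ltW growth_gt0)//.
      rewrite -(powR_mulrn 2 (powR_ge0 t ((1 - alpha) / 2))) -powRrM divfK//.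
      by ring.
    by rewrite ler_pM2l// radius_le// ltW.
  apply: (weight_N_ge cw w0 (W := cap_majorant i0 (radius t) d)) => //.
  - apply: mulr_gt0; first exact: wave_volume_gt0.
    by apply: mulr_gt0; [exact: expR_gt0|exact: powR_gt0].
  - exact: cap_majorant_continuous.
  - move=> x; apply: prodr_ge0 => j _; rewrite /cap_factor; case: ifP => _.
      by rewrite !mulr_ge0 ?expR_ge0// ltW// bump_gt0.
    by rewrite ltW// bump_gt0.
  - apply: le_trans (cubeint_cap_majorant i0 (radius t) L0 dpos) _.
    rewrite le_eqVlt; apply/orP; left; apply/eqP.
    rewrite /wave_volume /d /radius.
    have -> : rad + (reach alpha t - reach alpha 1) = (rad - reach alpha 1) + reach alpha t by ring.
    rewrite expRD !exprMn (powRrM _ ((1 - alpha) / 2)) powR_mulrn ?powR_ge0//.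
    ring.
  - by move=> x xr; apply: cap_majorant_ge.
apply: le_trans (wave_blowup alpha01 mu0 T1_gt1
  (fun t _ => weight_cA cw (x := t)) (fun t _ => weight_cA1 cw (x := t))
  (weight_DA cw) DA1 (weight_N_ge0 cw w0) A0 A1pos A01 p1 wave_volume_gt0 HN DQ') _.
rewrite /wave_const -[leRHS]mulrA ler_wpM2l//; last exact: powR_data.
by rewrite mulr_ge0 ?powR_ge0// divr_ge0 ?subr_ge0 ?(ltW p1)// mulr_ge0 ?powR_ge0.
Qed.

(** [mean_blowup] for the constant weight, with the volume of the support of u. *)
Lemma mean_estimate (Q : R -> R) :
  (forall t, 0 < t -> is_derive t (1 : R) Q
    (t `^ (- ((p - 1) * (n%:R * (1 - alpha) + mu))))) ->
  Q T1 - Q 1 <= mean_const * eps `^ (- (p - 1)).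
Proof.
move=> DQ; have al := oneBalpha_gt0 alpha01.
pose w := fun _ : 'rV[R]_n => 1 : R.
have cw : continuous w by exact: contT_cst.
have w0 x : 0 < w x by [].
have Dw (x : 'rV[R]_n) (i : 'I_n) :
    is_derive x (delta_mx 0 i : 'rV[R]_n) w ((fun=> 0) i * w x).
  by apply: der_eq (der_cst 1 x _) _; rewrite mul0r.
have DA1 t : 1 < t < T1 -> is_derive t (1 : R)
    (fun t => moment L w (d_t T u) (clip T1 t))
    (- (mu / t * moment L w (d_t T u) (clip T1 t)) + source T u p L w t).
  move=> tt; have := weight_DA1 cw Dw tt.
  by rewrite big1 ?mul0r ?add0r// => i _; rewrite expr0n.
have /andP[d0 dA] := moment_ut_lower cw w0.
have A1pos := lt_le_trans d0 dA.
have DQ' t : 0 < t -> is_derive t (1 : R) Q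
    (t `^ (- ((p - 1) * (mu + n%:R * (1 - alpha))))).
  by move=> t0; apply: der_eq (DQ t t0) _; rewrite [mu + _]addrC.
have HN t : 1 < t < T1 -> 0 < moment L w (d_t T u) (clip T1 t) ->
    (mean_volume * t `^ (n%:R * (1 - alpha))) `^ (1 - p) *
    (moment L w (d_t T u) (clip T1 t) / 2) `^ p <= source T u p L w t.
  move=> tt; have [t1 tT1] := andP tt; have t0 : 0 < t by exact: lt_trans t1.
  pose r := growth * t `^ (1 - alpha).
  have rpos : 0 < r by rewrite mulr_gt0 ?growth_gt0 ?powR_gt0.
  have L0 : 0 < L by have := L_ge; have := rad0; lra.
  apply: (weight_N_ge cw w0 (W := ball_majorant r)) => //.
  - by apply: mulr_gt0; [exact: mean_volume_gt0|exact: powR_gt0].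
  - exact: ball_majorant_continuous.
  - move=> x; apply: prodr_ge0 => j _.
    by rewrite mulr_ge0// ltW// bump_gt0.
  - apply: le_trans (cubeint_ball_majorant L0 rpos) _.
    rewrite le_eqVlt; apply/orP; left; apply/eqP.
    rewrite /mean_volume /r mulrA [in LHS]exprMn; congr (_ * _).
    by rewrite [n%:R * _]mulrC powRrM powR_mulrn ?powR_ge0.
  - move=> x xr; apply: ball_majorant_ge1 => //.
    by apply: le_trans xr _; apply: radius_le; exact: ltW.
apply: le_trans (mean_blowup p1 mean_volume_gt0 T1_gt1
  (fun t _ => weight_cA1 cw (x := t)) DA1 (weight_N_ge0 cw w0) HN A1pos DQ') _.
rewrite /mean_const -[leRHS]mulrA ler_wpM2l//; last exact: powR_data.
by rewrite divr_ge0 ?subr_ge0 ?(ltW p1)// mulr_ge0 ?powR_ge0.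
Qed.

End Solution.
End Lifespan.

(** * The lifespan *)

Section TimeBounds.
Context {R : realType}.
Implicit Types (T : \bar R) (t : R).

Lemma le_of_real_times T (B : R) : (1%:E < T)%E ->
  (forall T1 : R, 1 < T1 -> (T1%:E < T)%E -> T1 <= B) -> (T <= B%:E)%E.
Proof.
move=> T1 H; rewrite leNgt; apply/negP => BT.
pose m := Num.max 1 B.
have mT : (m%:E < T)%E by rewrite /m; case: (leP 1 B).
have m1 : 1 <= m by rewrite le_max lexx.
have mB : B <= m by rewrite le_max lexx orbT.
have [r mr rT] : exists2 r : R, m < r & (r%:E < T)%E.
  case: T mT {T1 BT H} => [s||//]; rewrite ?lte_fin => ms.
    by exists ((m + s) / 2); rewrite ?lte_fin; lra.
  by exists (m + 1); rewrite ?ltry// ltrDl.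
have := H r (le_lt_trans m1 mr) rT; rewrite leNgt => /negP; apply.
exact: le_lt_trans mB mr.
Qed.

Lemma power_time_bound (g K T1 : R) : 0 < g -> 0 <= K -> 1 < T1 ->
  (forall Q : R -> R,
     (forall t, 0 < t -> is_derive t (1 : R) Q (t `^ (- (1 - g)))) ->
     Q T1 - Q 1 <= K) ->
  T1 <= (1 + g * K) `^ g^-1.
Proof.
move=> g0 K0 T11 H; have T10 : 0 < T1 by exact: lt_trans T11.
have := H (fun t => t `^ g / g) _; rewrite powR1 -mulrBl ler_pdivrMr// => h.
have {}h : T1 `^ g <= 1 + g * K.
  rewrite -lerBlDl [g * K]mulrC; apply: h => t t0.
  apply: der_eq (der_mul (der_powR g t0) (der_cst g^-1 _ _)) _.
  by rewrite mulr0 addr0 mulrAC divff ?mul1r ?gt_eqF// opprB.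
have -> : T1 = (T1 `^ g) `^ g^-1 by rewrite -powRrM divff ?gt_eqF// powRr1 ?ltW.
apply: ge0_ler_powR; rewrite ?nnegrE ?powR_ge0// ?invr_ge0 ?(ltW g0)//.
by rewrite addr_ge0// mulr_ge0// ltW.
Qed.

Lemma log_time_bound (K T1 : R) : 1 < T1 ->
  (forall Q : R -> R,
     (forall t, 0 < t -> is_derive t (1 : R) Q (t `^ (- 1))) ->
     Q T1 - Q 1 <= K) ->
  T1 <= expR K.
Proof.
move=> T11 H; have T10 : 0 < T1 by exact: lt_trans T11.
have := H (@ln R) _; rewrite ln1 subr0 => h.
rewrite -[leLHS]lnK ?posrE// ler_expR; apply: h => t t0.
by rewrite powR_inv1 ?ltW//; exact: is_derive1_ln.
Qed.

(** For eps <= 1 the constant 1 is absorbed by the negative power of eps, at the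
    expense of the constant in front. *)
Lemma power_time_bound_small (g K p eps : R) : 0 < g -> 0 <= K -> 1 < p ->
  0 < eps <= 1 ->
  (1 + g * (K * eps `^ (- (p - 1)))) `^ g^-1 <=
  (1 + g * K) `^ g^-1 * eps `^ (- (p - 1) / g).
Proof.
move=> g0 K0 p1 /andP[e0 e1]; have gK : 0 <= g * K by rewrite mulr_ge0// ltW.
rewrite powRrM -powRM ?addr_ge0 ?powR_ge0//.
have h : 1 <= eps `^ (- (p - 1)).
  by rewrite -[leLHS](powRr0 eps) ger_powR ?e0// oppr_le0 subr_ge0 ltW.
apply: ge0_ler_powR; rewrite ?nnegrE ?invr_ge0 ?(ltW g0)//.
- by rewrite addr_ge0// mulr_ge0 ?(ltW g0)// mulr_ge0 ?powR_ge0.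
- by rewrite mulr_ge0 ?powR_ge0// addr_ge0.
- by rewrite mulrDl mul1r mulrA lerD2r.
Qed.

End TimeBounds.
Theorem theorem2p1 (R : realType) (n : nat) (alpha mu p rad : R)
    (u0 u1 : 'rV[R]_n -> R)
    (hn : (2 <= n)%N) (halpha : 0 <= alpha < 1) (hmu : 0 <= mu)
    (hp : 1 < p <= p_G' n alpha mu \/ 1 < p < p_0 n alpha mu)
    (hu0 : Ck_on space_dirs 2 setT u0) (hu1 : Ck_on space_dirs 1 setT u1)
    (hu0_nontriv : exists x, u0 x != 0) (hu1_nontriv : exists x, u1 x != 0)
    (hu01 : forall x, 0 <= u0 x <= u1 x)
    (hrad : 0 < rad)
    (hsupp0 : supp u0 `<=` [set x | enorm x <= rad])
    (hsupp1 : supp u1 `<=` [set x | enorm x <= rad]) :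
  (forall (eps : R) (T : \bar R) (u : R * 'rV[R]_n -> R),
     0 < eps -> (1%:E < T)%E ->
     classical_solution alpha mu p eps u0 u1 T u -> (T < +oo)%E) /\
  (exists eps0 C : R, 0 < eps0 /\ 0 < C /\
     forall eps : R, 0 < eps <= eps0 ->
       (p < p_G' n alpha mu ->
          (lifespan alpha mu p eps u0 u1 <=
           (C * eps `^ (- (p - 1) /
              (1 - ((1 - alpha) * (n%:R - 1) + mu + alpha) * (p - 1) / 2)))%:E)%E) /\
       (p = p_G' n alpha mu ->
          (lifespan alpha mu p eps u0 u1 <=
           (expR (C * eps `^ (- (p - 1))))%:E)%E) /\
       (p < p_0 n alpha mu ->
          (lifespan alpha mu p eps u0 u1 <=
           (C * eps `^ (- (p - 1) /
              (1 - (p - 1) * (n%:R * (1 - alpha) + mu))))%:E)%E)).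
Proof.
have p1 : 1 < p by case: hp => /andP[].
have cu0 : continuous u0 by apply/continuous_subspace_setT; case: hu0.
have cu1 : continuous u1 by apply/continuous_subspace_setT; case: hu1.
set A := (1 - alpha) * (n%:R - 1) + mu + alpha.
set B := n%:R * (1 - alpha) + mu.
have n1 : 1 <= n%:R - 1 :> R.
  have h : (2%:R : R) <= n%:R by rewrite ler_nat.
  lra.
have [al0 al1] := andP halpha.
have A0 : 0 < A.
  have h : 0 < (1 - alpha) * (n%:R - 1).
    by apply: mulr_gt0; lra.
  by rewrite /A; lra.
have B0 : 0 < B.
  have h : 0 < n%:R * (1 - alpha) by apply: mulr_gt0; lra.
  by rewrite /B; lra.
pose Kw := wave_const alpha mu p rad u1 hn.
pose Km := mean_const alpha p rad u1.
have Kw0 : 0 <= Kw by exact: wave_const_ge0.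
have Km0 : 0 <= Km by exact: mean_const_ge0.
pose gw := 1 - A * (p - 1) / 2.
pose gm := 1 - (p - 1) * B.
have sub_w : p < p_G' n alpha mu -> 0 < gw.
  rewrite /p_G' -/A -ltrBlDl ltr_pdivlMr// => h; rewrite /gw; lra.
have crit_w : p = p_G' n alpha mu -> A * (p - 1) / 2 = 1.
  by move=> ->; rewrite /p_G' [1 + _]addrC addrK -/A; field; rewrite gt_eqF.
have sub_m : p < p_0 n alpha mu -> 0 < gm.
  rewrite /p_0 -/B -ltrBlDl ltr_pdivlMr// => h; rewrite /gm; lra.
have W := @wave_estimate R n alpha mu p rad u0 u1 hn halpha hmu p1 cu0 cu1
  hu1_nontriv hrad hsupp0 hsupp1 hu01.
have M := @mean_estimate R n alpha mu p rad u0 u1 halpha hmu p1 cu1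
  hu1_nontriv hrad hsupp0 hsupp1 hu01.
have Kwe0 eps : 0 <= Kw * eps `^ (- (p - 1)) by rewrite mulr_ge0 ?powR_ge0.
have Kme0 eps : 0 <= Km * eps `^ (- (p - 1)) by rewrite mulr_ge0 ?powR_ge0.
have bound_w eps T u : 0 < eps -> (1%:E < T)%E -> p < p_G' n alpha mu ->
    classical_solution alpha mu p eps u0 u1 T u ->
    (T <= ((1 + gw * (Kw * eps `^ (- (p - 1)))) `^ gw^-1)%:E)%E.
  move=> e0 T1 /sub_w g0 sol; apply: le_of_real_times => // S S1 ST.
  apply: power_time_bound => // Q DQ; apply: (W eps T u) => // t t0.
  by apply: der_eq (DQ t t0) _; congr (_ `^ _); rewrite /gw /A; ring.
have bound_c eps T u : 0 < eps -> (1%:E < T)%E -> p = p_G' n alpha mu ->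
    classical_solution alpha mu p eps u0 u1 T u ->
    (T <= (expR (Kw * eps `^ (- (p - 1))))%:E)%E.
  move=> e0 T1 /crit_w g0 sol; apply: le_of_real_times => // S S1 ST.
  apply: log_time_bound => // Q DQ; apply: (W eps T u) => // t t0.
  by apply: der_eq (DQ t t0) _; congr (_ `^ _); rewrite -/A g0.
have bound_m eps T u : 0 < eps -> (1%:E < T)%E -> p < p_0 n alpha mu ->
    classical_solution alpha mu p eps u0 u1 T u ->
    (T <= ((1 + gm * (Km * eps `^ (- (p - 1)))) `^ gm^-1)%:E)%E.
  move=> e0 T1 /sub_m g0 sol; apply: le_of_real_times => // S S1 ST.
  apply: power_time_bound => // Q DQ; apply: (M eps T u) => // t t0.
  by apply: der_eq (DQ t t0) _; congr (_ `^ _); rewrite /gm /B; ring.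
split.
  move=> eps T u e0 T1 sol.
  have fin r : (T <= r%:E)%E -> (T < +oo)%E by move=> /le_lt_trans; apply; exact: ltry.
  case: hp => [/andP[_]|/andP[_ h]]; last exact: fin (bound_m _ _ _ e0 T1 h sol).
  rewrite le_eqVlt => /orP[/eqP h|h]; first exact: fin (bound_c _ _ _ e0 T1 h sol).
  exact: fin (bound_w _ _ _ e0 T1 h sol).
pose Cw := (1 + gw * Kw) `^ gw^-1; pose Cm := (1 + gm * Km) `^ gm^-1.
have Cw0 : 0 <= Cw by exact: powR_ge0.
have Cm0 : 0 <= Cm by exact: powR_ge0.
pose C := 1 + Cw + Cm + Kw.
exists 1, C; split=> //; split; first by rewrite /C; lra.
move=> eps e01; have [e0 e1] := andP e01.
split; [|split] => hpp; apply: ge_ereal_sup => T [T1 [u sol]].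
- apply: le_trans (bound_w _ _ _ e0 T1 hpp sol) _; rewrite lee_fin.
  apply: le_trans (power_time_bound_small (sub_w hpp) Kw0 p1 e01) _.
  by rewrite ler_wpM2r ?powR_ge0// /C -/Cw; lra.
- apply: le_trans (bound_c _ _ _ e0 T1 hpp sol) _; rewrite lee_fin ler_expR.
  by rewrite ler_wpM2r ?powR_ge0// /C; lra.
- apply: le_trans (bound_m _ _ _ e0 T1 hpp sol) _; rewrite lee_fin.
  apply: le_trans (power_time_bound_small (sub_m hpp) Km0 p1 e01) _.
  by rewrite ler_wpM2r ?powR_ge0// /C -/Cm; lra.
Qed.
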